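(* Let $d\in\mathbb{N}$. In the fixed design regression setting on the simplex described in the context, suppose that Assumptions (A1)--(A4) listed in the context hold. Then, as $n\to\infty$, $$\mathrm{MISE}(\hat m_{n,b}^{\mathrm{GM}})=\int_{\mathcal{S}_d}\mathrm{MSE}\{\hat m_{n,b}^{\mathrm{GM}}(\boldsymbol{s})\}\,d\boldsymbol{s}=b^2\int_{\mathcal{S}_d}g^2(\boldsymbol{s})\,d\boldsymbol{s}+n^{-1}b^{-d/2}\int_{\mathcal{S}_d}v(\boldsymbol{s})\,d\boldsymbol{s}+\mathrm{o}(b^2+n^{-1}b^{-d/2}),$$ where $g$ and $v$ are the functions defined in the context. In particular, if $g\not\equiv0$, $\sigma^2\not\equiv0$ and $d\in\{1,2,3\}$, the asymptotically (global) optimal smoothing parameter $b$, which minimizes $b^2\int_{\mathcal{S}_d}g^2(\boldsymbol{s})\,d\boldsymbol{s}+n^{-1}b^{-d/2}\int_{\mathcal{S}_d}v(\boldsymbol{s})\,d\boldsymbol{s}$ over $b\in(0,\infty)$, is $$b_{\mathrm{opt}}=n^{-2/(d+4)}\left\{\frac d4\,\frac{\int_{\mathcal{S}_d}v(\boldsymbol{s})\,d\boldsymbol{s}}{\int_{\mathcal{S}_d}g^2(\boldsymbol{s})\,d\boldsymbol{s}}\right\}^{2/(d+4)},$$ and with the choice $b=b_{\mathrm{opt}}$, $$\mathrm{MISE}(\hat m_{n,b_{\mathrm{opt}}}^{\mathrm{GM}})=n^{-4/(d+4)}\left\{\frac{1+d/4}{(d/4)^{d/(d+4)}}\right\}\f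rac{\big\{\int_{\mathcal{S}_d}v(\boldsymbol{s})\,d\boldsymbol{s}\big\}^{4/(d+4)}}{\big\{\int_{\mathcal{S}_d}g^2(\boldsymbol{s})\,d\boldsymbol{s}\big\}^{-d/(d+4)}}+\mathrm{o}(n^{-4/(d+4)}).$$
   Context: Notation. $\mathcal{S}_d=\{\boldsymbol{s}\in[0,1]^d:\|\boldsymbol{s}\|_1\le 1\}$, $\mathrm{Int}(\mathcal{S}_d)=\{\boldsymbol{s}\in(0,1)^d:\|\boldsymbol{s}\|_1<1\}$, with $\|\cdot\|_1$ the $\ell^1$ norm; $[n]=\{1,\dots,n\}$; $\mathrm{Leb}$ is Lebesgue measure on $\mathbb{R}^d$. For $\boldsymbol{\alpha}\in(0,\infty)^d$, $\beta\in(0,\infty)$, the $\mathrm{Dirichlet}(\boldsymbol{\alpha},\beta)$ density on $\mathcal{S}_d$ is $$K_{\boldsymbol{\alpha},\beta}(\boldsymbol{s})=\frac{\Gamma(\|\boldsymbol{\alpha}\|_1+\beta)}{\Gamma(\beta)\prod_{j=1}^d\Gamma(\alpha_j)}(1-\|\boldsymbol{s}\|_1)^{\beta-1}\prod_{j=1}^d s_j^{\alpha_j-1}.$$ For $\boldsymbol{s}\in\mathcal{S}_d$ and $b\in(0,\infty)$ put $\kappa_{\boldsymbol{s},b}=K_{\boldsymbol{s}/b+\boldsymbol{1},\,(1-\|\boldsymbol{s}\|_1)/b+1}$, with $\boldsymbol{1}=(1,\dots,1)$. Setting. For each $n$ there are deterministic design points $\boldsymbol{x}_1,\dots,\boldsymbol{x}_n\in\mathrm{Int}(\mathcal{S}_d)$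 (depending on $n$; the dependence is suppressed), with design density $f$, a probability density on $\mathcal{S}_d$: for every Borel set $B\subseteq\mathbb{R}^d$ with $\mathrm{Leb}(\partial B)=0$, $\lim_{n\to\infty}\frac1n\sum_{i=1}^n\mathbf{1}_B(\boldsymbol{x}_i)=\int_B f(\boldsymbol{x})\,d\boldsymbol{x}$. The responses are $Y_i=m(\boldsymbol{x}_i)+\varepsilon_i$, $i\in[n]$, where $m:\mathcal{S}_d\to\mathbb{R}$ and, for each $n$, the errors $\varepsilon_1,\dots,\varepsilon_n$ are mutually independent with $\varepsilon_i$ of mean zero and variance $\sigma^2(\boldsymbol{x}_i)$. Given a smoothing parameter $b=b(n)\in(0,\infty)$ and sets $B_1,\dots,B_n$ (depending on $n$) as in (A4) below, the Dirichlet-kernel Gasser--Müller estimator is $$\hat m_{n,b}^{\mathrm{GM}}(\boldsymbol{s})=\sum_{i=1}^n Y_i\int_{B_i}\kappa_{\boldsymbol{s},b}(\boldsymbol{x})\,d\boldsymbol{x},\qquad\boldsymbol{s}\in\mathcal{S}_d,$$ and $\mathrm{MSE}\{\hat m_{n,b}^{\mathrm{GM}}(\boldsymbol{s})\}=\mathsf{E}[\{\hat m_{n,b}^{\mathrm{GM}}(\boldsymbol{s})-m(\boldsymbol{s})\}^2]$. Functions $g$ and $v$. $$g(\boldsymbol{s})=\sum_{j=1}^d\{1-(d+1)s_j\}\frac{\partial}{\partial s_j}m(\boldsymbol{s})+\frac12\sum_{j,k=1}^d s_j(\mathbf{1}_{\{j=k\}}-s_k)\frac{\partial^2}{\partial s_j\partial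 s_k}m(\boldsymbol{s}),$$ $$v(\boldsymbol{s})=\frac{\psi_\emptyset(\boldsymbol{s})\,\sigma^2(\boldsymbol{s})}{f(\boldsymbol{s})},\qquad\psi_\emptyset(\boldsymbol{s})=\Big\{(4\pi)^d(1-\|\boldsymbol{s}\|_1)\prod_{j=1}^d s_j\Big\}^{-1/2},\qquad\boldsymbol{s}\in\mathrm{Int}(\mathcal{S}_d).$$ Assumptions. (A1) $f$ and $\sigma^2$ are Lipschitz continuous on $\mathcal{S}_d$, and $m$ is twice continuously differentiable on $\mathcal{S}_d$ (in particular $\sigma^2$ is bounded on $\mathcal{S}_d$). (A2) $\min_{\mathcal{S}_d}f>0$ and $\min_{\mathcal{S}_d}\sigma^2>0$. (A3) $b=b(n)\to0$ and $n^{-1/d}=\mathrm{o}(b)$ as $n\to\infty$. (A4) For every $n\in\mathbb{N}$, $B_1,\dots,B_n$ are convex compact subsets of $\mathcal{S}_d$ such that: (a) $\mathrm{Int}(B_i)\cap\mathrm{Int}(B_j)=\emptyset$ for $i\ne j$ and $B_1\cup\dots\cup B_n=\mathcal{S}_d$; (b) $\boldsymbol{x}_i\in\mathrm{Int}(B_i)$ for every $i\in[n]$; (c) $\mathrm{Leb}(\partial B_i)=0$ for every $i\in[n]$; (d) $\mathrm{diam}(B_i)=\mathcal{O}(n^{-1/d})$ uniformly in $i$ as $n\to\infty$; (e) $|\int_{B_i}f(\boldsymbol{t})\,d\boldsymbol{t}-n^{-1}|=\mathcal{O}(n^{-1-1/d})$ uniformly in $i$ as $n\to\infty$. *)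

(* Defs.v *)
From HB Require Import structures.
From mathcomp Require Import all_boot all_order all_algebra.
From mathcomp Require Import all_classical all_reals all_analysis.

Set Implicit Arguments.
Unset Strict Implicit.
Unset Printing Implicit Defensive.

Import Order.TTheory GRing.Theory Num.Theory.
Import numFieldNormedType.Exports.

Local Open Scope classical_set_scope.
Local Open Scope ring_scope.

Section borel_rV.
Context {R : realType} (n : nat).

Definition rV_coord (i : 'I_n) (v : 'rV[R]_n) : R := v ord0 i.

Let rV_set0 : g_sigma_preimage rV_coord set0.
Proof. exact: sigma_algebra0. Qed.

Let rV_setC A : g_sigma_preimage rV_coord A -> g_sigma_preimage rV_coord (~` A).
Proof. exact: sigma_algebraC. Qed.

Let rV_bigcup (F : (set 'rV[R]_n)^nat) :
  (forall i, g_sigma_preimage rV_coord (F i)) ->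
  g_sigma_preimage rV_coord (\bigcup_i (F i)).
Proof. exact: sigma_algebra_bigcup. Qed.

HB.instance Definition _ :=
  @isMeasurable.Build (measure_tuple_display default_measure_display)
    'rV[R]_n (g_sigma_preimage rV_coord) rV_set0 rV_setC rV_bigcup.

Lemma measurable_rV_coord i : measurable_fun [set: 'rV[R]_n] (rV_coord i).
Proof.
move=> _ Y mY; rewrite setTI; apply: sub_sigma_algebra => /=.
rewrite -bigcup_seq/=; exists i => /=; first by rewrite mem_index_enum.
by exists Y => //; rewrite setTI.
Qed.

Lemma measurable_fun_rV d (T : measurableType d) (f : T -> 'rV[R]_n) :
  (forall i, measurable_fun [set: T] (fun t => f t ord0 i)) ->
  measurable_fun [set: T] f.
Proof.
move=> mf; apply: (@measurability _ _ _ _ _ _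
  (\big[setU/set0]_(i < n) preimage_set_system setT (rV_coord i) measurable)).
  by [].
move=> _ [A + <-]; rewrite -bigcup_seq/= => -[i _ [B mB <-]].
by rewrite setTI; exact: mf.
Qed.

(* The product sigma-algebra is the Borel sigma-algebra of R^n. *)
Lemma measurable_rVE : @measurable _ 'rV[R]_n = <<s [set A | open A] >>.
Proof.
apply/seteqP; split.
- apply: smallest_sub; first exact: smallest_sigma_algebra.
  move=> A; rewrite -bigcup_seq/= => -[i _ [B mB <-]].
  have := @measurability _ _ (g_sigma_algebraType [set A | @open 'rV[R]_n A])
    R setT (rV_coord i) _ (measurable_realfun.RGenOInfty.measurableE R).
  apply=> //.
  move=> _ [_ [x ->] <-]; rewrite setTI; apply: sub_sigma_algebra => /=.
  apply: open_comp; last exact: interval_open.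
  by move=> v _; exact: coord_continuous.
- apply: smallest_sub; first exact: sigma_algebra_measurable.
  move=> A /= oA.
  pose box (q : 'I_n -> rat * rat) : set 'rV[R]_n :=
    \bigcap_(i in [set: 'I_n]) rV_coord i @^-1` `](ratr (q i).1), (ratr (q i).2)[.
  have mbox q : measurable (box q).
    apply: fin_bigcap_measurable => // i _.
    by rewrite -[X in measurable X]setTI; exact: measurable_rV_coord.
  have -> : A = \bigcup_(q in [set q : {ffun 'I_n -> rat * rat} | box q `<=` A]) box q.
    apply/seteqP; split; last by move=> v [q /= qA]; exact: qA.
    move=> v Av; have /nbhs_ballP[e /= e0 eA] : nbhs v A by move: oA; rewrite openE; exact.
    have /choice[q qP] : forall i : 'I_n, exists q : rat * rat,
        v ord0 i - e < ratr q.1 < v ord0 i /\ v ord0 i < ratr q.2 < v ord0 i + e.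
      move=> i.
      have /rat_in_itvoo[a] : v ord0 i - e < v ord0 i by rewrite ltrBlDr ltrDl.
      have /rat_in_itvoo[b] : v ord0 i < v ord0 i + e by rewrite ltrDl.
      by rewrite !in_itv/= => bP aP; exists (a, b).
    exists [ffun i => q i].
      move=> w /= qw; apply: eA; split=> // k j; rewrite ord1.
      have /= := qw j I; rewrite /rV_coord ffunE in_itv/= => /andP[w1 w2].
      have [/andP[a1 a2] /andP[b1 b2]] := qP j.
      rewrite /ball/= ltr_distlC.
      by rewrite (lt_trans a1 w1) (lt_trans w2 b2).
    move=> i _; rewrite /= ffunE in_itv/=.
    by have [/andP[_ ->] /andP[-> _]] := qP i.
  rewrite bigcup_mkcond; apply: countable_bigcupT_measurable => [|q].
    exact: countableP.
  by case: ifPn.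
Qed.

End borel_rV.

Section lebesgue_rV.
Context {R : realType}.

Definition rV_cons n (p : R * 'rV[R]_n) : 'rV[R]_n.+1 :=
  row_mx (p.1%:M : 'rV_1) p.2.

Definition rV_uncons n (v : 'rV[R]_n.+1) : R * 'rV[R]_n :=
  (v ord0 ord0, @rsubmx R 1 1 n v).

Lemma rV_consK n : cancel (@rV_cons n) (@rV_uncons n).
Proof.
move=> [x v]; rewrite /rV_uncons /rV_cons/= row_mxKr; congr pair.
transitivity (row_mx (x%:M : 'rV_1) v ord0 (lshift n ord0)).
  by congr (row_mx _ _ _ _); exact: val_inj.
by rewrite row_mxEl mxE mulr1n.
Qed.

Lemma rV_unconsK n : cancel (@rV_uncons n) (@rV_cons n).
Proof.
move=> v; transitivity (row_mx (@lsubmx R 1 1 n v) (@rsubmx R 1 1 n v)).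
  rewrite /rV_cons/= (_ : (v ord0 ord0)%:M = @lsubmx R 1 1 n v)//.
  apply/rowP => i; rewrite !mxE !ord1/= mulr1n; congr (v _ _); exact: val_inj.
exact: (@hsubmxK R 1 1 n v).
Qed.

Lemma measurable_rV_cons n : measurable_fun setT (@rV_cons n).
Proof.
apply: measurable_fun_rV => i.
have [j ->|j ->] := @split_ordP 1 n i.
- rewrite [X in measurable_fun _ X](_ : _ = fst)//.
  apply/funext => -[x v]; rewrite /rV_cons/=.
  by rewrite (row_mxEl (x%:M : 'rV_1) v ord0 j) mxE !ord1.
- rewrite [X in measurable_fun _ X](_ : _ = rV_coord j \o snd).
    exact: measurableT_comp (measurable_rV_coord j) measurable_snd.
  apply/funext => -[x v]; rewrite /rV_cons/=.
  exact: (row_mxEr (x%:M : 'rV_1) v ord0 j).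
Qed.

Lemma measurable_rV_uncons n : measurable_fun setT (@rV_uncons n).
Proof.
apply: measurable_fun_pair; first exact: measurable_rV_coord.
apply: measurable_fun_rV => i.
rewrite [X in measurable_fun _ X](_ : _ = rV_coord (rshift 1 i)).
  exact: measurable_rV_coord.
by apply/funext => v; rewrite mxE.
Qed.

Let sigma_finite_prod d1 d2 (T1 : measurableType d1) (T2 : measurableType d2)
  (m1 : {sigma_finite_measure set T1 -> \bar R})
  (m2 : {sigma_finite_measure set T2 -> \bar R}) :
  sigma_finite setT (m1 \x m2)%E.
Proof.
have /sigma_finiteP[F [TF ndF Foo]] := sigma_finiteT m1.
have /sigma_finiteP[G [TG ndG Goo]] := sigma_finiteT m2.
exists (fun n => F n `*` G n).
 rewrite -setXTT TF TG predeqE => -[x y]; split.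
    move=> [/= [n _ Fnx] [k _ Gky]]; exists (maxn n k) => //; split.
    - by move: x Fnx; exact/subsetPset/ndF/leq_maxl.
    - by move: y Gky; exact/subsetPset/ndG/leq_maxr.
  by move=> [n _ []/= ? ?]; split; exists n.
move=> k; have [? ?] := Foo k; have [? ?] := Goo k.
split; first exact: measurableX.
by rewrite product_measure1E// lte_mul_pinfty// ge0_fin_numE.
Qed.

Definition lebesgue_rV_succ n (mu : set 'rV[R]_n -> \bar R) :
    set 'rV[R]_n.+1 -> \bar R :=
  pushforward (lebesgue_measure \x mu)%E (@rV_cons n).

Section lebesgue_rV_succ_measure.
Variables (n : nat) (mu : {sigma_finite_measure set 'rV[R]_n -> \bar R}).

Let nu : {measure set 'rV[R]_n.+1 -> \bar R} :=
  measure_function_pushforward__canonical__measure_function_Measure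
    (lebesgue_measure \x mu)%E (@measurable_rV_cons n).

Let lebesgue_rV_succ0 : lebesgue_rV_succ mu set0 = 0%E.
Proof. exact: (measure0 nu). Qed.

Let lebesgue_rV_succ_ge0 A : (0 <= lebesgue_rV_succ mu A)%E.
Proof. exact: (measure_ge0 nu). Qed.

Let lebesgue_rV_succ_sigma_additive :
  semi_sigma_additive (lebesgue_rV_succ mu).
Proof. exact: (@measure_semi_sigma_additive _ _ _ nu). Qed.

HB.instance Definition _ := isMeasure.Build _ _ _ (lebesgue_rV_succ mu)
  lebesgue_rV_succ0 lebesgue_rV_succ_ge0 lebesgue_rV_succ_sigma_additive.

Let lebesgue_rV_succ_sigma_finite : sigma_finite setT (lebesgue_rV_succ mu).
Proof.
have [F TF Foo] := sigma_finite_prod lebesgue_measure mu.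
exists (fun k => @rV_uncons n @^-1` F k).
  by rewrite -preimage_bigcup -TF preimage_setT.
move=> k; have [mF Fk] := Foo k; split.
  by rewrite -[X in measurable X]setTI; exact: measurable_rV_uncons.
rewrite /lebesgue_rV_succ /pushforward -comp_preimage (_ : _ \o _ = id)//.
by apply/funext => p; exact: rV_consK.
Qed.

HB.instance Definition _ := Measure_isSigmaFinite.Build _ _ _
  (lebesgue_rV_succ mu) lebesgue_rV_succ_sigma_finite.

End lebesgue_rV_succ_measure.

Fixpoint lebesgue_rV n : {sigma_finite_measure set 'rV[R]_n -> \bar R} :=
  match n with
  | 0%N => \d_(0 : 'rV[R]_0)
  | m.+1 => lebesgue_rV_succ (lebesgue_rV m)
  end.

Lemma lebesgue_rV_box n (a b : 'rV[R]_n) : (forall j, a ord0 j <= b ord0 j) ->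
  lebesgue_rV n [set v | forall j, a ord0 j <= v ord0 j <= b ord0 j] =
  (\prod_(j < n) (b ord0 j - a ord0 j))%:E.
Proof.
elim: n a b => [|n IH] a b ab.
  by rewrite big_ord0 /= diracE mem_set//= => -[].
pose tl (v : 'rV[R]_n.+1) : 'rV[R]_n := \row_j v ord0 (lift ord0 j).
pose box m (a b : 'rV[R]_m) := [set v : 'rV[R]_m | forall j, a ord0 j <= v ord0 j <= b ord0 j].
have mbox m (c d : 'rV[R]_m) : measurable (box m c d).
  have -> : box m c d = \bigcap_(j in [set: 'I_m]) rV_coord j @^-1` `[c ord0 j, d ord0 j].
    by apply/seteqP; split => v /= bv j; have := bv j; rewrite /= in_itv//=; exact.
  apply: fin_bigcap_measurable => // j _.
  by rewrite -[X in measurable X]setTI; exact: measurable_rV_coord.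
have cons0 (p : R * 'rV[R]_n) : rV_cons p ord0 ord0 = p.1.
  by rewrite -[in RHS](rV_consK p).
have consS (p : R * 'rV[R]_n) j : rV_cons p ord0 (lift ord0 j) = p.2 ord0 j.
  rewrite (_ : lift ord0 j = rshift 1 j); last exact: val_inj.
  exact: (row_mxEr (p.1%:M : 'rV_1) p.2 ord0 j).
rewrite /= /lebesgue_rV_succ /pushforward.
rewrite [X in product_measure1 _ _ X](_ : _ =
    `[a ord0 ord0, b ord0 ord0] `*` box n (tl a) (tl b)); last first.
  apply/seteqP; split => p /=.
    move=> bp; rewrite in_itv/= -(cons0 p); split => // j.
    by have := bp (lift ord0 j); rewrite (consS p j) !mxE.
  rewrite in_itv/= => -[p1 p2] j.
  have [k ->|->] := unliftP ord0 j; last by rewrite cons0.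
  by rewrite (consS p k); have := p2 k; rewrite !mxE.
transitivity (lebesgue_measure `[a ord0 ord0, b ord0 ord0] *
    lebesgue_rV n (box n (tl a) (tl b)))%E.
  by apply: product_measure1E => //; exact: mbox.
have -> : lebesgue_measure `[a ord0 ord0, b ord0 ord0] =
    (b ord0 ord0 - a ord0 ord0)%:E.
  rewrite lebesgue_measure_itv/= lte_fin.
  by case: ltgtP (ab ord0) => // -> _; rewrite subrr.
rewrite [X in (_ * X)%E](IH (tl a) (tl b)) => [|j]; last by rewrite !mxE.
rewrite -EFinM big_ord_recl; congr (_ * _)%:E.
by apply: eq_bigr => j _; rewrite !mxE.
Qed.

End lebesgue_rV.

Definition frontier (T : topologicalType) (A : set T) : set T :=
  closure A `\` A°.

(* On row vectors [`|_|] is the maximum norm. Another choice of norm would only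
   change the constants in the bounds on [diam] and in Lipschitz conditions. *)
Definition diam (R : realType) (V : normedModType R) (A : set V) : R :=
  sup [set `|p.1 - p.2| | p in A `*` A].

Definition positive_min_on (R : realType) (T : Type) (A : set T) (h : T -> R) :=
  exists2 s0, A s0 & (forall s, A s -> h s0 <= h s) /\ 0 < h s0.

Definition Gamma (R : realType) (a : R) : R :=
  \int[lebesgue_measure]_(t in `]0, +oo[) (t `^ (a - 1) * expR (- t)).

Section dirichlet_kernel.
Context {R : realType} (d : nat).
Implicit Types (s x alpha : 'rV[R]_d) (b beta : R).

Definition l1norm s : R := \sum_(j < d) `|s ord0 j|.

Definition simplex : set 'rV[R]_d :=
  [set s : 'rV[R]_d | (forall j, 0 <= s ord0 j <= 1) /\ l1norm s <= 1].

Definition open_simplex : set 'rV[R]_d :=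
  [set s : 'rV[R]_d | (forall j, 0 < s ord0 j < 1) /\ l1norm s < 1].

Definition dirichlet_pdf alpha beta s : R :=
  Gamma (l1norm alpha + beta) /
    (Gamma beta * \prod_(j < d) Gamma (alpha ord0 j)) *
  (1 - l1norm s) `^ (beta - 1) *
  \prod_(j < d) s ord0 j `^ (alpha ord0 j - 1).

Definition kappa s b : 'rV[R]_d -> R :=
  dirichlet_pdf (b^-1 *: s + const_mx 1) ((1 - l1norm s) / b + 1).

End dirichlet_kernel.

Section regression_functions.
Context {R : realType} (d : nat).
Implicit Types (s : 'rV[R]_d) (h m f sigmasq : 'rV[R]_d -> R).
Local Notation S := (@simplex R d).
Local Notation IntS := (@open_simplex R d).

Definition basis_rV (j : 'I_d) : 'rV[R]_d := delta_mx ord0 j.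

Definition partial (j : 'I_d) h s : R := 'D_(basis_rV j) h s.

(* [h], known on the open simplex, extends continuously to the simplex. *)
Definition extends_continuously h :=
  exists2 h' : 'rV[R]_d -> R,
    {within S, continuous h'} & forall s, IntS s -> h s = h' s.

(* C^2 on the closed simplex: the partial derivatives up to order two exist on
   the open simplex and extend continuously to the boundary. *)
Definition C2_on_simplex m :=
  [/\ {within S, continuous m},
      forall j, (forall s, IntS s -> derivable m s (basis_rV j)) /\
                extends_continuously (partial j m)
    & forall j k,
        (forall s, IntS s -> derivable (partial k m) s (basis_rV j)) /\
        extends_continuously (partial j (partial k m))].

(* [g] and [v] are functions on the open simplex. As total functions they are
   extended by 0, so that their integrals over the closed simplex do not depend
   on the values of the derivatives on its boundary, which is a null set. *)
Definition g_fun m : 'rV[R]_d -> R := (fun s : 'rV[R]_d =>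
  \sum_(j < d) (1 - (d%:R + 1) * s ord0 j) * partial j m s +
  2^-1 * \sum_(j < d) \sum_(k < d)
    s ord0 j * ((j == k)%:R - s ord0 k) * partial j (partial k m) s) \_ IntS.

Definition psi0 s : R :=
  ((4 * pi) ^+ d * (1 - l1norm s) * \prod_(j < d) s ord0 j) `^ (- 2^-1).

Definition v_fun f sigmasq : 'rV[R]_d -> R :=
  (fun s => psi0 s * sigmasq s / f s) \_ IntS.

Definition int_g2 m : R := \int[lebesgue_rV d]_(s in S) g_fun m s ^+ 2.

Definition int_v f sigmasq : R := \int[lebesgue_rV d]_(s in S) v_fun f sigmasq s.

Definition amise m f sigmasq (n : nat) (b : R) : R :=
  b ^+ 2 * int_g2 m + n%:R^-1 * b `^ (- (d%:R / 2)) * int_v f sigmasq.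

Definition b_opt m f sigmasq (n : nat) : R :=
  n%:R `^ (- (2 / (d%:R + 4))) *
  (d%:R / 4 * (int_v f sigmasq / int_g2 m)) `^ (2 / (d%:R + 4)).

End regression_functions.

Section gasser_mueller.
Context {R : realType} (d : nat) {dO : measure_display}
  {Omega : measurableType dO}.
Variables (P : probability Omega R) (m : 'rV[R]_d -> R).
Variables (n : nat) (x : 'I_n -> 'rV[R]_d) (eps : 'I_n -> {RV P >-> R}).
Variables (B : 'I_n -> set 'rV[R]_d).
Implicit Types (b : R) (s : 'rV[R]_d).

Definition response (i : 'I_n) (w : Omega) : R := m (x i) + eps i w.

Definition GM_estimator b s (w : Omega) : R :=
  \sum_(i < n) response i w * \int[lebesgue_rV d]_(t in B i) kappa s b t.

Definition MSE b s : \bar R :=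
  ('E_P[fun w => ((GM_estimator b s w - m s) ^+ 2)%R])%E.

Definition MISE b : \bar R :=
  (\int[lebesgue_rV d]_(s in @simplex R d) MSE b s)%E.

Definition mutually_independent (X : 'I_n -> {RV P >-> R}) :=
  forall (J : {set 'I_n}) (A : 'I_n -> set R),
    (forall i, measurable (A i)) ->
    P (\bigcap_(i in [set` J]) X i @^-1` A i) =
    (\prod_(i in J) P (X i @^-1` A i))%E.

End gasser_mueller.

(* Samples, errors and cells are triangular arrays; the row of size 0 carries no
   information. *)
Section assumptions.
Context {R : realType} (d : nat).
Local Notation S := (@simplex R d).
Implicit Types (f sigmasq m : 'rV[R]_d -> R) (b : nat -> R).
Implicit Types (x : forall n, 'I_n -> 'rV[R]_d).
Implicit Types (B : forall n, 'I_n -> set 'rV[R]_d).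

Definition density_on_simplex f :=
  (forall s, S s -> 0 <= f s) /\
  (\int[lebesgue_rV d]_(s in S) (f s)%:E = 1)%E.

Definition design f x :=
  (forall n i, open_simplex (x n i)) /\
  forall A : set 'rV[R]_d, measurable A -> lebesgue_rV d (frontier A) = 0%E ->
    n%:R^-1 * \sum_(i < n) \1_A (x n i) @[n --> \oo] -->
    \int[lebesgue_rV d]_(s in A `&` S) f s.

Definition errors {dO : measure_display} {Omega : measurableType dO}
    (P : probability Omega R) sigmasq x (eps : forall n, 'I_n -> {RV P >-> R}) :=
  forall n, [/\ mutually_independent (eps n),
    forall i, ('E_P[eps n i])%E = 0%E
    & forall i, ('V_P[eps n i])%E = (sigmasq (x n i))%:E].

Definition regularity f sigmasq m :=
  [/\ [lipschitz f s | s in S], [lipschitz sigmasq s | s in S]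
    & C2_on_simplex m].

Definition positivity f sigmasq := positive_min_on S f /\ positive_min_on S sigmasq.

Definition bandwidth b :=
  [/\ forall n, (0 < n)%N -> 0 < b n, b n @[n --> \oo] --> (0 : R)
    & (fun n => n%:R `^ (- d%:R^-1)) =o_\oo b].

Record cells f x B : Prop := {
  cells_convex_compact : forall n i,
    [/\ convex_set (B n i), compact (B n i) & B n i `<=` S];
  cells_interior_disjoint : forall n i j, i != j ->
    (B n i)° `&` (B n j)° = set0;
  cells_cover : forall n, (0 < n)%N -> \bigcup_i B n i = S;
  cells_design : forall n i, (B n i)° (x n i);
  cells_frontier : forall n i, lebesgue_rV d (frontier (B n i)) = 0%E;
  cells_diam : exists C, \forall n \near \oo, forall i,
    diam (B n i) <= C * n%:R `^ (- d%:R^-1);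
  cells_mass : exists C, \forall n \near \oo, forall i,
    `|\int[lebesgue_rV d]_(t in B n i) f t - n%:R^-1|
      <= C * n%:R `^ (- 1 - d%:R^-1) }.

End assumptions.

(* Main.v *)
(* The weights of the estimator are the masses that the Dirichlet law with density
   [kappa s b] gives to the cells, so the mean squared error splits into a squared
   bias and a variance.

   Bias: up to the cell diameter, which is o(b), the mean of the estimator at [s] is
   the mean of [m] under the kernel. A second order Taylor expansion and the moments of
   the Dirichlet law, up to the fourth, give [b * g s + o(b)], and O(b) uniformly in [s].

   Variance: the square of [kappa s b] is a constant times [kappa s (b / 2)]. Duplication
   formula bounds for Gamma show that the constant is [b `^ (- d / 2) * psi0 s] times a
   factor that is bounded and tends to 1. The mass of a cell is its volume times a
   value of the kernel. Cauchy-Schwarz on each cell bounds the variance by a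
   multiple of [psi0]. For the limit, the kernel varies by a factor close to 1 on cells
   near [s], because their diameter is o(b), and Chebyshev's inequality for the kernel of
   parameter [b / 2] discards the other cells.

   Dominated convergence, with [psi0] integrable as a multiple of the
   Dirichlet(1/2, ..., 1/2) density, integrates both expansions over the simplex. The
   optimal bandwidth comes from [1 + y < expR y], applied to the logarithm of [b / b_opt]. *)
Require Import Defs.
From HB Require Import structures.
From mathcomp Require Import all_boot all_order all_algebra.
From mathcomp Require Import all_classical all_reals all_analysis.
From mathcomp Require Import measurable_realfun ring lra.

Set Implicit Arguments.
Unset Strict Implicit.
Unset Printing Implicit Defensive.

Import Order.TTheory GRing.Theory Num.Theory.
Import numFieldNormedType.Exports.

Local Open Scope classical_set_scope.
Local Open Scope ring_scope.

(** * Gamma and beta integrals *)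

(** The function [psi0] blows up at the boundary of the simplex, so the proof seeks no uniform
    expansion of the variance: it combines a pointwise limit on the open simplex with an integrable
    bound. The bound must hold up to the boundary at each bandwidth, where [s_j / b] may be small.
    Asymptotic formulas for Gamma do not reach that regime; the two-sided estimate of
    [central_binom], valid at every positive argument, gives both the bound and the limit. Gamma and
    beta integrals are first treated in the extended reals, where Tonelli asks for no integrability;
    finiteness comes out afterwards. Cell volumes are not prescribed. The cells have mass close to
    [1 / n] under [f], which is Lipschitz and bounded below, so [n] times the volume is close to
    [1 / f]; this is the origin of the factor [1 / f] in [v_fun]. The condition [n^(-1/d) = o(b)]
    makes two errors negligible: replacing [m] by its values at the design points, and the variation
    of the logarithm of the kernel on a cell. For [b_opt], of order [n^(-2/(d+4))], it amounts to
    [d < 4]. *)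

Section lebesgue_invariance.
Context {R : realType}.
Local Notation mu := (@lebesgue_measure R).
Local Open Scope ereal_scope.

(** The pushforward of Lebesgue measure under the shift gives half-open intervals their length, and
    Lebesgue measure is the only measure that does. *)
Lemma ge0_integral_translation (c : R) (f : R -> \bar R) :
  measurable_fun setT f -> (forall x, 0 <= f x) ->
  \int[mu]_x f (x + c)%R = \int[mu]_x f x.
Proof.
move=> mf f0.
have mphi : measurable_fun [set: measurableTypeR R]
    ((fun x => x + c)%R : _ -> measurableTypeR R) by exact: measurable_funD.
have := ge0_integral_pushforward mphi mu measurableT mf (fun y _ => f0 y).
rewrite preimage_setT /= => <-.
apply: eq_measure_integral => A mA _; apply/esym.
have H := @lebesgue_measure_unique R (measure_function_pushforward__canonical__measure_function_Measure mu mphi).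
apply: H mA => _ [[a b] _ <-] /=.
rewrite /pushforward (_ : _ @^-1` _ = `](a - c)%R, (b - c)%R]%classic).
  rewrite !lebesgue_measure_itv/= !lte_fin ltrD2r; case: ifPn => // _.
  by rewrite -!EFinB; congr (_ %:E); ring.
apply/seteqP; split => x /=; rewrite !in_itv/= ltrBlDr lerBrDr//.
Qed.

(** The same uniqueness argument, for [c] times the pushforward under [x => c * x]. *)
Lemma ge0_integral_dilation (c : R) (f : R -> \bar R) : (0 < c)%R ->
  measurable_fun setT f -> (forall x, 0 <= f x) ->
  c%:E * \int[mu]_x f (c * x)%R = \int[mu]_x f x.
Proof.
move=> c0 mf f0.
have mphi : measurable_fun [set: measurableTypeR R]
    ((fun x => c * x)%R : _ -> measurableTypeR R) by exact: measurable_funM.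
have cc0 : (0 <= c)%R by exact: ltW.
have := ge0_integral_pushforward mphi mu measurableT mf (fun y _ => f0 y).
rewrite preimage_setT /= => <-.
rewrite -[X in X%:E](_ : (NngNum cc0)%:num%R = c)//.
rewrite -ge0_integral_mscale//.
apply: eq_measure_integral => A mA _; apply/esym.
have H := @lebesgue_measure_unique R (mscale (NngNum cc0) (measure_function_pushforward__canonical__measure_function_Measure mu mphi)).
apply: H mA => _ [[a b] _ <-] /=.
rewrite /mscale/= /pushforward (_ : _ @^-1` _ = `](a / c)%R, (b / c)%R]%classic).
  rewrite !lebesgue_measure_itv/= !lte_fin ltr_pM2r ?invr_gt0//; case: ifPn => // _; last by rewrite mule0.
  rewrite -!EFinB -EFinM; congr (_ %:E); field; exact: lt0r_neq0.
apply/seteqP; split => x /=; rewrite !in_itv/= ltr_pdivrMr// ler_pdivlMr// mulrC//.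
Qed.

Lemma integral_expRN_tail (y : R) :
  \int[mu]_(x in `[y, +oo[) (expR (- x))%:E = (expR (- y))%:E.
Proof.
rewrite (@ge0_continuous_FTC2y _ (fun x => expR (- x))%R (fun x => - expR (- x))%R y 0%R).
- by rewrite -EFinB opprK add0r.
- by move=> x _; exact: expR_ge0.
- apply: continuous_subspaceT => x.
  by apply: continuous_comp; [exact: opp_continuous | exact: continuous_expR].
- by rewrite -oppr0; apply: cvgN; exact: cvgr_expR.
- by move=> x _; apply: ex_derive.
- apply: cvg_at_right_filter; apply: cvgN.
  by apply: continuous_comp; [exact: opp_continuous | exact: continuous_expR].
- move=> x _; rewrite derive1E.
  have H : is_derive x 1%R (fun x => - expR (- x))%R (- (expR (- x) * - 1))%R.
    by apply: is_deriveN; apply: is_derive1_comp.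
  by rewrite derive_val mulrN1 opprK.
Qed.

End lebesgue_invariance.

Section power_gamma_beta.
Context {R : realType}.
Local Notation mu := (@lebesgue_measure R).
Implicit Types a b c r x : R.

(** The cut-off at 0 is built into the function, so that Gamma, beta and Dirichlet integrals run
    over the whole space and can be translated or exchanged without tracking domains. *)
Definition pos_pow a x : R := if 0 < x then expR ((a - 1) * ln x) else 0.

Lemma pos_pow_ge0 a x : 0 <= pos_pow a x.
Proof. by rewrite /pos_pow; case: ifP => // _; exact: expR_ge0. Qed.

Lemma pos_pow_le0 a x : x <= 0 -> pos_pow a x = 0.
Proof. by rewrite /pos_pow ltNge => ->. Qed.

Lemma pos_powE a x : 0 < x -> pos_pow a x = x `^ (a - 1).
Proof. by move=> x0; rewrite /pos_pow x0 /powR gt_eqF. Qed.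

Lemma pos_powZ a c x : 0 < c -> pos_pow a (c * x) = expR ((a - 1) * ln c) * pos_pow a x.
Proof.
move=> c0; rewrite /pos_pow pmulr_rgt0//; case: ifPn => x0; last by rewrite mulr0.
by rewrite -expRD lnM ?posrE// mulrDr.
Qed.

Lemma pos_powS a x : x * pos_pow a x = pos_pow (a + 1) x.
Proof.
rewrite /pos_pow; case: ifPn => x0; last by rewrite mulr0.
rewrite -[X in X * _](@lnK _ x)// -expRD; congr expR; ring.
Qed.

Lemma measurable_pos_pow2 d (T : measurableType d) (f g : T -> R) :
  measurable_fun setT f -> measurable_fun setT g ->
  measurable_fun setT (fun t => pos_pow (f t) (g t)).
Proof.
move=> mf mg; apply: measurable_fun_ifT => //=.
- exact: measurable_fun_ltr.
- apply: measurableT_comp; first exact: measurable_expR.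
  apply: measurable_funM; first exact: measurable_funB.
  exact: measurableT_comp mg.
Qed.

(** Valued in the extended reals, like [egamma], so that product formulas can be proved before
    finiteness and can then be used to prove it. *)
Definition ebeta a b : \bar R := (\int[mu]_u (pos_pow a u * pos_pow b (1 - u))%:E)%E.

Definition egamma a : \bar R := (\int[mu]_u (pos_pow a u * expR (- u))%:E)%E.

Let measurable_conv a b r : measurable_fun setT (fun u => (pos_pow a u * pos_pow b (r - u))%:E).
Proof.
apply/measurable_EFinP; apply: measurable_funM; apply: measurable_pos_pow2 => //.
exact: measurable_funB.
Qed.

Let measurable_gam a : measurable_fun setT (fun u => (pos_pow a u * expR (- u))%:E).
Proof.
apply/measurable_EFinP; apply: measurable_funM; first exact: measurable_pos_pow2.
by apply: measurableT_comp; [exact: measurable_expR | exact: oppr_measurable].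
Qed.

(** For positive [r], substitute [u = r u'] and use the homogeneity of [pos_pow]. Otherwise [u] and
    [r - u] are never both positive, and both sides vanish. *)
Lemma integral_pos_pow_conv a b r :
  (\int[mu]_u (pos_pow a u * pos_pow b (r - u))%:E = (pos_pow (a + b) r)%:E * ebeta a b)%E.
Proof.
have [r0|r0] := ltP 0 r; last first.
  rewrite pos_pow_le0// mul0e integral0_eq// => u _.
  have [u0|u0] := leP u 0; first by rewrite pos_pow_le0// mul0r.
  by rewrite [X in _ * X]pos_pow_le0 ?mulr0// subr_le0 (le_trans r0)// ltW.
rewrite -(ge0_integral_dilation r0) => [|//|u]; last by rewrite lee_fin mulr_ge0// pos_pow_ge0.
transitivity (r%:E * \int[mu]_u ((expR ((a - 1) * ln r + (b - 1) * ln r))%:E *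
    (pos_pow a u * pos_pow b (1 - u))%:E))%E.
  congr (_ * _)%E; apply: eq_integral => u _; rewrite -[X in X - r * _]mulr1 -mulrBr !pos_powZ// mulrACA -expRD.
  by rewrite EFinM.
have mc := measurable_conv a b 1.
rewrite ge0_integralZl//; last by move=> u _; rewrite lee_fin mulr_ge0// pos_pow_ge0.
rewrite muleA -EFinM; congr (_%:E * _)%E.
rewrite /pos_pow r0 -[X in X * _](@lnK _ r)// -expRD; congr expR; ring.
Qed.

(* Substituting [v = w - u] in the double integral for [egamma a * egamma b]
   turns the inner integral into a convolution. *)
Lemma egammaM a b : (egamma a * egamma b = ebeta a b * egamma (a + b))%E.
Proof.
have mga := measurable_gam a; have mgb := measurable_gam b; have mgab := measurable_gam (a + b).
have pe0 c u : 0 <= pos_pow c u * expR (- u) by rewrite mulr_ge0 ?pos_pow_ge0 ?expR_ge0.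
rewrite {1}/egamma -ge0_integralZr//; last 2 first.
- by move=> u _; rewrite lee_fin.
- by apply: integral_ge0 => u _; rewrite lee_fin.
pose F (p : R * R) := ((pos_pow a p.1 * pos_pow b (p.2 - p.1)) * expR (- p.2))%:E.
transitivity (\int[mu]_u \int[mu]_w F (u, w))%E.
  apply: eq_integral => u _.
  transitivity (\int[mu]_v (pos_pow a u * expR (- u) * (pos_pow b v * expR (- v)))%:E)%E.
    rewrite /egamma -ge0_integralZl//; last 2 first.
    - by move=> v _; rewrite lee_fin.
    - by rewrite lee_fin.
  rewrite -[LHS](ge0_integral_translation (- u)); last 2 first.
  - by apply/measurable_EFinP; apply: measurable_funM => //; exact/measurable_EFinP.
  - by move=> v; rewrite lee_fin mulr_ge0.
  apply: eq_integral => w _; rewrite /F/=; congr (_%:E).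
  rewrite mulrACA -expRD; congr (_ * expR _); ring.
rewrite fubini_tonelli; last 2 first.
- apply/measurable_EFinP; apply: measurable_funM; last first.
    apply: measurableT_comp; first exact: measurable_expR.
    by apply: measurableT_comp.
  by apply: measurable_funM; apply: measurable_pos_pow2 => //; exact: measurable_funB.
- by move=> p; rewrite lee_fin !mulr_ge0 ?pos_pow_ge0 ?expR_ge0.
rewrite /egamma -ge0_integralZl//; last 2 first.
- by move=> u _; rewrite lee_fin.
- by apply: integral_ge0 => u _; rewrite lee_fin mulr_ge0// pos_pow_ge0.
apply: eq_integral => w _; rewrite /F/=.
under eq_integral => u _ do rewrite EFinM.
have mc := measurable_conv a b w.
rewrite ge0_integralZr//; last by move=> u _; rewrite lee_fin mulr_ge0// pos_pow_ge0.
by rewrite integral_pos_pow_conv EFinM muleAC muleC muleA.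
Qed.

Lemma egamma1 : egamma 1 = 1%E.
Proof.
rewrite /egamma.
transitivity (\int[mu]_(x in `]0%R, +oo[) (expR (- x))%:E)%E.
  rewrite [RHS]integral_mkcond; apply: eq_integral => x _.
  rewrite /pos_pow patchE mem_setE in_itv/= andbT.
  by case: ifPn => _; rewrite ?mul0r// subrr mul0r expR0 mul1r.
rewrite integral_itv_obnd_cbnd; last first.
  by apply: measurable_funTS; apply/measurable_EFinP; apply: measurableT_comp.
by rewrite integral_expRN_tail oppr0 expR0.
Qed.

(** The lower end stays positive because the primitive [x^a / a] is differentiated through [ln]; the
    passage to 0 takes place in [ebeta_r1]. *)
Lemma integral_powR_itv a (e : R) : 0 < a -> 0 < e < 1 ->
  (\int[mu]_(x in `[e, 1%R]) (pos_pow a x)%:E = ((1 - expR (a * ln e)) / a)%:E)%E.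
Proof.
move=> a0 /andP[e0 e1].
have dF x : 0 < x -> is_derive x 1 (fun x : R => a^-1 * expR (a * ln x))%R (a^-1 * (expR (a * ln x) * (a * x^-1)))%R.
  move=> x0; have D1 := is_derive1_ln x0.
  have D2 : is_derive x 1 (fun x : R => a * ln x)%R (a * x^-1)%R by exact: is_deriveZ.
  have D3 : is_derive x 1 (fun x : R => expR (a * ln x))%R (expR (a * ln x) * (a * x^-1))%R.
    exact: (@is_derive1_comp _ expR (fun x => a * ln x)%R).
  exact: is_deriveZ.
have cF x : 0 < x -> {for x, continuous (fun x : R => a^-1 * expR (a * ln x))%R}.
  move=> x0; have [+ _] := dF x x0.
  by move=> /derivable1_diffP/differentiable_continuous.
transitivity (\int[mu]_(x in `[e, 1%R]) (expR ((a - 1) * ln x))%:E)%E.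
  apply: eq_integral => x; rewrite inE/= in_itv/= => /andP[ex _].
  by rewrite /pos_pow (lt_le_trans e0 ex).
rewrite (@continuous_FTC2 _ _ (fun x => a^-1 * expR (a * ln x))%R)//.
- by rewrite ln1 mulr0 expR0 -EFinB -mulrBr mulrC.
- apply: (@continuous_in_subspaceT) => x; rewrite inE/= in_itv/= => /andP[ex _].
  have x0 : 0 < x by exact: lt_le_trans ex.
  apply: (@continuous_comp _ _ _ (fun x => (a - 1) * ln x) expR); last exact: continuous_expR.
  by apply: cvgM; [exact: cvg_cst | exact: continuous_ln].
- split => [x|  |]; rewrite ?in_itv/=.
  + by move=> /andP[ex _]; have [] := dF x (lt_trans e0 ex).
  + by apply: cvg_at_right_filter; exact: cF.
  + by apply: cvg_at_left_filter; exact: cF.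
- move=> x; rewrite in_itv/= => /andP[ex _]; have x0 := lt_trans e0 ex.
  rewrite derive1E; have := dF x x0 => D; rewrite derive_val.
  rewrite mulrBl mul1r expRB lnK//; field.
  by rewrite !gt_eqF.
Qed.

Lemma ebeta_r1 a : 0 < a -> ebeta a 1 = (a^-1)%:E.
Proof.
move=> a0.
have mp : measurable_fun setT (fun x => (pos_pow a x)%:E).
  by apply/measurable_EFinP; exact: measurable_pos_pow2.
transitivity (\int[mu]_(x in `]0%R, 1%R]) (pos_pow a x)%:E)%E.
  transitivity (\int[mu]_(x in `]0%R, 1%R[) (pos_pow a x)%:E)%E.
    rewrite [RHS]integral_mkcond; apply: eq_integral => x _.
    rewrite patchE mem_setE in_itv/= /pos_pow subr_gt0 subrr mul0r expR0.
    by case: ifPn => // _; case: ifPn; rewrite ?mulr1 ?mulr0 ?mul0r.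
  by rewrite integral_itv_bndo_bndc//; exact: measurable_funTS.
(* [n.+2] keeps the left end strictly below 1, as [integral_powR_itv] demands. *)
pose F n : set R := [set` `[n.+2%:R^-1, 1%R]].
have UF : \bigcup_n F n = [set` `]0%R, 1%R]].
  apply/seteqP; split => x /=.
    by move=> [n _]; rewrite /F/= !in_itv/= => /andP[nx ->]; rewrite andbT (lt_le_trans _ nx).
  rewrite in_itv/= => /andP[x0 x1]; have [N _ /(_ N (leqnn _)) H] := near_infty_natSinv_lt (PosNum x0).
  exists N => //; rewrite /F/= in_itv/= x1 andbT; apply: ltW; apply: le_lt_trans H.
  by rewrite lef_pV2 ?posrE// ler_nat.
rewrite -UF.
have cvI : (\int[mu]_(x in F i) (pos_pow a x)%:E)%E @[i --> \oo] -->
    (\int[mu]_(x in \bigcup_i F i) (pos_pow a x)%:E)%E.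
  apply: ge0_nondecreasing_set_cvg_integral.
  - move=> n m nm; apply/subsetPset => x; rewrite /F/= !in_itv/= => /andP[nx ->].
    by rewrite andbT (le_trans _ nx)// lef_pV2 ?posrE// ler_nat !ltnS.
  - by move=> i; exact: measurable_itv.
  - by move=> i; exact: measurable_funTS.
  - by move=> i x _; rewrite lee_fin pos_pow_ge0.
apply: (cvg_unique _ cvI) => //.
have -> : (fun i => \int[mu]_(x in F i) (pos_pow a x)%:E)%E =
    EFin \o (fun i => (1 - (i.+2%:R^-1) `^ a) / a).
  apply/funext => n; rewrite integral_powR_itv//; last by apply/andP; split; rewrite ?invf_lt1 ?invr_gt0 ?ltr1n.
  by rewrite /= /powR gt_eqF.
apply: cvg_EFin; first by near=> n.
rewrite -[X in _ --> X]mul1r -[X in X * _]subr0.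
apply: cvgMl; apply: cvgB; first exact: cvg_cst.
have c1 : (n.+2%:R^-1 : R) @[n --> \oo] --> 0^'+.
  apply: (@cvg_trans _ (within (fun x : R => 0 < x) (nbhs (0:R)))) => // A.
  have c0 : (n.+2%:R^-1 : R) @[n --> \oo] --> (0 : R).
    apply/cvgrPdist_lt => e e0; near=> n; rewrite sub0r normrN gtr0_norm ?invr_gt0//.
    apply: (@lt_trans _ _ n.+1%:R^-1); first by rewrite ltf_pV2 ?posrE// ltr_nat.
    by near: n; exact: (near_infty_natSinv_lt (PosNum e0)).
  by move=> /c0[N _ HN]; exists N => // n Nn; apply: (HN n Nn); rewrite /= invr_gt0.
exact: (cvg_comp _ _ c1 (powR_cvg0 a0)).
Unshelve. all: end_near. Qed.

Lemma egamma_gt0 a : (0 < egamma a)%E.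
Proof.
(* On [[1, 2]] both [x] and [ln x] lie between 0 and 2, so this constant minorizes the integrand for
   every real [a]. *)
pose c := expR (- (2 * `|a - 1|) - 2).
have : (\int[mu]_(x in `[1%R, 2%R]) c%:E <= egamma a)%E.
  rewrite /egamma integral_mkcond; apply: ge0_le_integral => //.
  - by move=> x _; rewrite patchE; case: ifP => // _; rewrite lee_fin expR_ge0.
  - by apply/(measurable_restrictT (fun=> c%:E)); [exact: measurable_itv | exact: measurable_cst].
  - exact: measurable_gam.
  move=> x _; rewrite patchE; case: ifPn => [|_]; last first.
    by rewrite lee_fin mulr_ge0 ?pos_pow_ge0 ?expR_ge0.
  rewrite inE/= in_itv/= => /andP[x1 x2]; have x0 : 0 < x by exact: lt_le_trans x1.
  rewrite lee_fin /pos_pow x0 -expRD ler_expR lerD//; last by rewrite lerN2.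
  rewrite -normrN -[X in X * ln _]opprK mulNr lerN2; apply: le_trans (ler_wpM2r _ (ler_norm _)) _.
    exact: ln_ge0.
  rewrite mulrC ler_wpM2r// (le_trans _ x2)//.
  by have := ln_sublinear x0; exact: ltW.
apply: lt_le_trans; rewrite integral_cst//= lebesgue_measure_itv/= lte_fin ltr1n.
by rewrite -EFinB -EFinM lte_fin mulr_gt0 ?expR_gt0// subr_gt0 ltr1n.
Qed.

(** No integration by parts: this is the product formula with second parameter 1, where the beta
    integral is [1 / a]. *)
Lemma egammaS a : 0 < a -> egamma (a + 1) = (a%:E * egamma a)%E.
Proof.
move=> a0; have := egammaM a 1; rewrite egamma1 mule1 ebeta_r1// => ->.
by rewrite muleA -EFinM divff ?gt_eqF// mul1e.
Qed.

(** For [a <= 1] the integrand is at most [x^(a-1)] below 1 and [exp (- x)] beyond, both with known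
    finite integrals. The functional equation then climbs one unit at a time. *)
Lemma egamma_fin_num a : 0 < a -> egamma a \is a fin_num.
Proof.
have H1 b : 0 < b <= 1 -> egamma b \is a fin_num.
  move=> /andP[b0 b1]; rewrite ge0_fin_numE; last exact/ltW/egamma_gt0.
  apply: (@le_lt_trans _ _ (ebeta b 1 + egamma 1)%E); last first.
    by rewrite ebeta_r1// egamma1 -EFinD ltry.
  have m1 := measurable_conv b 1 1; have m2 := measurable_gam b; have m3 := measurable_gam 1.
  rewrite /ebeta /egamma -ge0_integralD//; last 2 first.
  - by move=> x _; rewrite lee_fin mulr_ge0 ?pos_pow_ge0.
  - by move=> x _; rewrite lee_fin mulr_ge0 ?pos_pow_ge0 ?expR_ge0.
  apply: ge0_le_integral => //.
  - by move=> x _; rewrite lee_fin mulr_ge0 ?pos_pow_ge0 ?expR_ge0.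
  - apply: emeasurable_funD => //.
  move=> x _; rewrite -EFinD lee_fin.
  have [x0|x0] := leP x 0; first by rewrite !(pos_pow_le0 _ x0) !mul0r addr0.
  have [x1|x1] := ltP x 1.
    rewrite [pos_pow 1 (1 - x)]/pos_pow subr_gt0 x1 subrr mul0r expR0 mulr1.
    apply: (@le_trans _ _ (pos_pow b x)).
      rewrite ler_piMr ?pos_pow_ge0// -expR0 ler_expR oppr_le0; exact: ltW.
    by rewrite lerDl mulr_ge0 ?pos_pow_ge0 ?expR_ge0.
  rewrite [pos_pow 1 (1 - x)]pos_pow_le0 ?subr_le0// mulr0 add0r ler_wpM2r ?expR_ge0//.
  rewrite /pos_pow x0 subrr mul0r ler_expR.
  by apply: mulr_le0_ge0; [rewrite subr_le0 | exact: ln_ge0].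
have H2 n : forall b, 0 < b <= n.+1%:R -> egamma b \is a fin_num.
  elim: n => // n IH b /andP[b0 bn].
  have [b1|b1] := leP b 1; first by rewrite H1// b0 b1.
  rewrite -(subrK 1 b) egammaS ?subr_gt0// fin_numM// IH// subr_gt0 b1/=.
  by rewrite lerBlDr natr1.
move=> a0; have [n an] : exists n, a <= n.+1%:R.
  exists (Num.truncn a); exact/ltW/truncnS_gt.
by apply: (H2 n); rewrite a0 an.
Qed.

Lemma GammaE a : Gamma a = fine (egamma a).
Proof.
rewrite /Gamma /Rintegral; congr fine; rewrite integral_mkcond; apply: eq_integral => x _.
rewrite patchE mem_setE in_itv/= andbT /pos_pow.
by case: ifPn => x0; rewrite ?mul0r// /powR gt_eqF.
Qed.

Lemma Gamma_gt0 a : 0 < a -> 0 < Gamma a.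
Proof.
by move=> a0; rewrite GammaE fine_gt0// egamma_gt0/= -ge0_fin_numE ?egamma_fin_num// ltW ?egamma_gt0.
Qed.

Lemma Gamma_egamma a : 0 < a -> egamma a = (Gamma a)%:E.
Proof. by move=> a0; rewrite GammaE fineK// egamma_fin_num. Qed.

Lemma GammaS a : 0 < a -> Gamma (a + 1) = a * Gamma a.
Proof.
move=> a0; rewrite GammaE egammaS// Gamma_egamma//.
Qed.

Lemma ebetaE a b : 0 < a -> 0 < b ->
  ebeta a b = (Gamma a * Gamma b / Gamma (a + b))%:E.
Proof.
move=> a0 b0; have ab0 : 0 < a + b by rewrite addr_gt0.
have := egammaM a b; rewrite !Gamma_egamma// => H.
have G0 := Gamma_gt0 ab0.
have -> : ebeta a b = (ebeta a b * (Gamma (a + b))%:E * (Gamma (a + b))^-1%:E)%E.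
  by rewrite -muleA -EFinM divff ?gt_eqF// mule1.
by rewrite -H -!EFinM.
Qed.

End power_gamma_beta.

(** * The central binomial coefficient at real arguments *)

Section gamma_half_integers.
Context {R : realType}.
Local Notation mu := (@lebesgue_measure R).
Implicit Types x y : R.

Lemma pos_pow1 y : pos_pow 1 y = (0 < y)%R%:R.
Proof. by rewrite /pos_pow subrr mul0r expR0; case: ifP. Qed.

Lemma expR_half_ln y : 0 < y -> expR (2^-1 * ln y) = Num.sqrt y.
Proof. by move=> y0; rewrite -powR12_sqrt ?ltW// /powR gt_eqF. Qed.

Lemma pos_pow_sqrt y : pos_pow (3 / 2) y = Num.sqrt y.
Proof.
rewrite /pos_pow; case: ltP => y0; last by rewrite ler0_sqrtr.
rewrite (_ : 3 / 2 - 1 = 2^-1); last by lra.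
by rewrite (expR_half_ln y0).
Qed.

(* Both sides equal the double integral of [exp (- y)] over [0 <= w, w^2 <= y]. *)
Lemma Gamma_3half : Gamma (3 / 2) = Num.sqrt pi / 2 :> R.
Proof.
rewrite GammaE /egamma.
pose F (p : R * R) := (\1_([set` `]0%R, +oo[] : set R) p.1 *
  (\1_([set` `[0%R, +oo[] : set R) (p.2 - p.1 ^+ 2) * expR (- p.2)))%:E.
have mF : measurable_fun setT F.
  apply/measurable_EFinP; apply: measurable_funM.
    by apply: measurableT_comp => //; exact: measurable_indic.
  apply: measurable_funM; apply: measurableT_comp.
  - exact: measurable_indic.
  - by apply: measurable_funB => //; exact: measurable_funX.
  - exact: measurable_expR.
  - by apply: measurableT_comp.
have F0 p : (0 <= F p)%E by rewrite lee_fin !mulr_ge0 ?expR_ge0.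
transitivity (fine (\int[mu]_y \int[mu]_w F (w, y)))%E.
  congr fine; apply: eq_integral => y _; rewrite pos_pow_sqrt.
  have sq0 : 0 <= Num.sqrt y by exact: sqrtr_ge0.
  transitivity (\int[mu]_(w in `]0%R, Num.sqrt y]) (expR (- y))%:E)%E.
    rewrite integral_cst//= lebesgue_measure_itv/= lte_fin muleC.
    case: ltP => [s0|]; first by rewrite sube0.
    by rewrite le_eqVlt ltNge sq0 orbF => /eqP ->; rewrite mul0r mul0e.
  rewrite integral_mkcond; apply: eq_integral => w _.
  rewrite patchE mem_setE in_itv/= /F/= !indicE !mem_setE !in_itv/= !andbT subr_ge0.
  have [w0|w0] := ltP 0 w; last by rewrite mul0r.
  rewrite mul1r /=; have [y0|y0] := leP 0 y.
    have -> : (w <= Num.sqrt y) = (w ^+ 2 <= y).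
      by rewrite -[in RHS](sqr_sqrtr y0) ler_sqr// nnegrE ltW.
    by case: ifP => _; rewrite ?mul0r ?mul1r.
  rewrite ler0_sqrtr ?(ltW y0)// leNgt w0/= leNgt (lt_le_trans y0) ?sqr_ge0//=.
  by rewrite mul0r.
rewrite -fubini_tonelli//.
transitivity (fine (\int[mu]_(w in `[0%R, +oo[) (gauss_fun w)%:E)%E); last by rewrite integral0y_gauss.
congr fine; rewrite -integral_itv_obnd_cbnd; last first.
  by apply: measurable_funTS; apply/measurable_EFinP; exact: measurable_gauss_fun.
rewrite [RHS]integral_mkcond; apply: eq_integral => w _.
rewrite patchE mem_setE in_itv/= /F/= !indicE !mem_setE !in_itv/= !andbT.
case: ltP => w0/=; last by apply: integral0_eq => y _; rewrite mul0r.
rewrite -integral_expRN_tail [RHS]integral_mkcond; apply: eq_integral => y _.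
rewrite patchE mem_setE in_itv/= mul1r !indicE !mem_setE !in_itv/= !andbT subr_ge0.
by case: ifP => _; rewrite ?mul0r ?mul1r.
Qed.

(** Both sides integrate [y^(x-1)] over the region [0 < y < 4 u (1 - u)]. Integrating in [y] first
    gives [(4 u (1 - u))^x / x]; for fixed [y] in []0, 1[] the admissible [u] form an interval
    centred at 1/2 of length [sqrt (1 - y)]. This is Legendre's duplication formula in beta form. *)
Lemma ebeta_duplication x : 0 < x ->
  ((expR (x * ln 4) / x)%:E * ebeta (x + 1) (x + 1) = ebeta x (3 / 2))%E.
Proof.
move=> x0.
pose F (p : R * R) := (pos_pow x p.2 * pos_pow 1 (4 * p.1 * (1 - p.1) - p.2))%:E.
have mF : measurable_fun setT F.
  apply/measurable_EFinP; apply: measurable_funM; apply: measurable_pos_pow2 => //.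
  apply: measurable_funB => //; apply: measurable_funM; first exact: measurable_funM.
  exact: measurable_funB.
have F0 p : (0 <= F p)%E by rewrite lee_fin mulr_ge0 ?pos_pow_ge0.
transitivity (\int[mu]_u \int[mu]_y F (u, y))%E.
  rewrite /ebeta -ge0_integralZl//; last 3 first.
  - apply/measurable_EFinP; apply: measurable_funM; apply: measurable_pos_pow2 => //.
    exact: measurable_funB.
  - by move=> u _; rewrite lee_fin mulr_ge0 ?pos_pow_ge0.
  - by rewrite lee_fin divr_ge0 ?expR_ge0 ?ltW.
  apply: eq_integral => u _; rewrite /F/= integral_pos_pow_conv ebeta_r1// -!EFinM; congr EFin.
  rewrite mulrAC; congr (_ / _).
  have [u0|u0] := leP u 0.
    rewrite (pos_pow_le0 _ u0) mul0r mulr0 pos_pow_le0//.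
    by rewrite mulr_le0_ge0 ?subr_ge0 ?(le_trans u0)// pmulr_rle0.
  have [u1|u1] := ltP u 1; last first.
    by rewrite [pos_pow _ (1 - u)]pos_pow_le0 ?subr_le0// mulr0 mulr0 pos_pow_le0// mulr_ge0_le0 ?subr_le0// mulr_ge0// ltW.
  rewrite /pos_pow u0 subr_gt0 u1 !mulr_gt0 ?subr_gt0// -!expRD; congr expR.
  by rewrite !lnM ?posrE ?mulr_gt0 ?subr_gt0// addrK; ring.
rewrite fubini_tonelli//; apply: eq_integral => y _; rewrite /F/=.
under eq_integral do rewrite EFinM.
rewrite ge0_integralZl//; last 3 first.
- apply/measurable_EFinP; apply: measurable_pos_pow2 => //.
  apply: measurable_funB => //; apply: measurable_funM; first exact: measurable_funM.
  exact: measurable_funB.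
- by move=> u _; rewrite lee_fin pos_pow_ge0.
- by rewrite lee_fin pos_pow_ge0.
rewrite EFinM; congr (_ * _)%E.
pose s := Num.sqrt (1 - y).
have s0 : 0 <= s by exact: sqrtr_ge0.
transitivity (\int[mu]_(u in `](2^-1 * (1 - s))%R, (2^-1 * (1 + s))%R[) (1:R)%:E)%E; last first.
  rewrite integral_cst//= mul1e lebesgue_measure_itv/= lte_fin pos_pow_sqrt -/s.
  case: ifPn => h; first by rewrite -EFinB; congr EFin; field.
  by congr EFin; apply/eqP; rewrite eq_le s0/= leNgt; apply: contra h => h; lra.
rewrite [RHS]integral_mkcond; apply: eq_integral => u _.
rewrite patchE mem_setE in_itv/= pos_pow1.
have -> : (0 < 4 * u * (1 - u) - y) = (2^-1 * (1 - s) < u < 2^-1 * (1 + s)).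
  have -> : 4 * u * (1 - u) - y = (1 - y) - (2 * u - 1) ^+ 2 by ring.
  have -> : (2^-1 * (1 - s) < u < 2^-1 * (1 + s)) = (`|2 * u - 1| < s).
    rewrite ltr_norml; congr (_ && _); apply/idP/idP => ?; lra.
  rewrite subr_gt0; have [y1|y1] := leP y 1.
    by rewrite -[in RHS]ltr_sqr ?nnegrE ?normr_ge0// real_normK ?num_real// sqr_sqrtr// subr_ge0.
  rewrite /s ler0_sqrtr ?subr_le0 ?ltW// normr_lt0.
  by apply/negbTE; rewrite -leNgt (@le_trans _ _ 0)// ?sqr_ge0// subr_le0 ltW.
by case: ifP.
Qed.

(* AM-GM under the integral: [2 sqrt t <= c + t / c] with [c = sqrt x]. *)
Lemma Gamma_half_le x : 0 < x -> Gamma (x + 2^-1) <= Num.sqrt x * Gamma x.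
Proof.
move=> x0; set c := Num.sqrt x; have c0 : 0 < c by rewrite sqrtr_gt0.
have mg a : measurable_fun setT (fun u : R => (pos_pow a u * expR (- u))%:E).
  apply/measurable_EFinP; apply: measurable_funM; first exact: measurable_pos_pow2.
  by apply: measurableT_comp; [exact: measurable_expR | exact: oppr_measurable].
have g0 a (u : R) : (0 <= (pos_pow a u * expR (- u))%:E)%E by rewrite lee_fin mulr_ge0 ?pos_pow_ge0 ?expR_ge0.
have : (2%:E * egamma (x + 2^-1) <= c%:E * egamma x + c^-1%:E * egamma (x + 1))%E.
  rewrite /egamma -!ge0_integralZl//; last 6 first.
  all: try exact: mg.
  all: try by rewrite lee_fin ?invr_ge0 ltW.
  rewrite -ge0_integralD//; last 4 first.
  - by move=> u _; rewrite mule_ge0// lee_fin ltW.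
  - by apply: measurable_funeM; exact: mg.
  - by move=> u _; rewrite mule_ge0// lee_fin invr_ge0 ltW.
  - by apply: measurable_funeM; exact: mg.
  apply: ge0_le_integral => //.
  - by move=> u _; rewrite mule_ge0// lee_fin.
  - by apply: measurable_funeM; exact: mg.
  - by apply: emeasurable_funD; apply: measurable_funeM; exact: mg.
  move=> u _; rewrite -!EFinM -EFinD lee_fin !mulrA -mulrDl ler_wpM2r ?expR_ge0//.
  have [u0|u0] := leP u 0; first by rewrite !(pos_pow_le0 _ u0) !mulr0 addr0.
  rewrite -pos_powS.
  have -> : pos_pow (x + 2^-1) u = Num.sqrt u * pos_pow x u.
    by rewrite /pos_pow u0 -expR_half_ln// -expRD; congr expR; ring.
  rewrite !mulrA -mulrDl ler_wpM2r ?pos_pow_ge0//.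
  rewrite -subr_ge0 (_ : _ - _ = (c - Num.sqrt u) ^+ 2 / c).
    by rewrite divr_ge0 ?sqr_ge0 ?ltW.
  have us := sqr_sqrtr (ltW u0); set s := Num.sqrt u in us *.
  rewrite -us; field; exact: lt0r_neq0.
rewrite egammaS// !Gamma_egamma ?addr_gt0 ?invr_gt0// -!EFinM -EFinD lee_fin.
have -> : c^-1 * (x * Gamma x) = c * Gamma x.
  have xc : x = c ^+ 2 by rewrite sqr_sqrtr ?ltW.
  by move: (Gamma x) => G; rewrite xc; field; exact: lt0r_neq0.
by rewrite -mulr2n -[X in _ <= X]mulr_natl ler_pM2l.
Qed.

(* For integer [x] this is [binom (2x) x / 4^x]. *)
Definition central_binom x := Gamma (2 * x + 1) / (expR (x * ln 4) * Gamma (x + 1) ^+ 2).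

(** [ebeta_duplication] expressed with [Gamma]; the factor [sqrt pi] comes from [Gamma (3 / 2)]. *)
Lemma central_binomE x : 0 < x ->
  central_binom x = Gamma (x + 2^-1) / (Num.sqrt pi * Gamma (x + 1)).
Proof.
move=> x0; have := ebeta_duplication x0.
have x10 : 0 < x + 1 by rewrite addr_gt0.
rewrite !ebetaE ?divr_gt0// -EFinM => -[].
have -> : x + 1 + (x + 1) = (2 * x + 1) + 1 by ring.
have -> : x + 3 / 2 = (x + 2^-1) + 1 by field.
have h0 : 0 < 2 * x + 1 by rewrite addr_gt0// mulr_gt0.
have h1 : 0 < x + 2^-1 by rewrite addr_gt0// invr_gt0.
rewrite (GammaS h0) (GammaS h1) (GammaS x0) Gamma_3half /central_binom (GammaS x0).
have := Gamma_gt0 x0.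
have : 0 < Gamma (2 * x + 1) by rewrite Gamma_gt0// addr_gt0// mulr_gt0.
have : 0 < Gamma (x + 2^-1) by rewrite Gamma_gt0// addr_gt0// invr_gt0.
have : 0 < Num.sqrt pi :> R by rewrite sqrtr_gt0 pi_gt0.
have := expR_gt0 (x * ln 4).
move: (Gamma (2 * x + 1)) (Gamma (x + 2^-1)) (Gamma x) (expR (x * ln 4)) (Num.sqrt pi).
move=> A B C E P E0 P0 B0 A0 C0 H.
(* In [H] the unknown [A] occurs only in a denominator, so it is written through the inverse of the
   left side of [H]. *)
have -> : A = (E / x * (x * C * (x * C) / ((2 * x + 1) * A)))^-1 * (E * x * C ^+ 2 / (2 * x + 1)).
  by field; rewrite !gt_eqF// addr_gt0// mulr_gt0.
rewrite H; field.
by rewrite !gt_eqF// ?addr_gt0// mulr_gt0.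
Qed.

Lemma central_binom_gt0 x : 0 < x -> 0 < central_binom x.
Proof.
move=> x0; rewrite /central_binom divr_gt0 ?Gamma_gt0 ?mulr_gt0 ?exprn_gt0 ?expR_gt0//.
all: by rewrite ?Gamma_gt0 ?addr_gt0 ?mulr_gt0.
Qed.

Lemma central_binom_le x : 0 < x -> central_binom x <= (Num.sqrt (pi * x))^-1.
Proof.
move=> x0; rewrite central_binomE// GammaS//.
rewrite ler_pdivrMr ?mulr_gt0 ?sqrtr_gt0 ?pi_gt0 ?Gamma_gt0//.
apply: le_trans (Gamma_half_le x0) _; rewrite sqrtrM ?pi_ge0//.
rewrite -{4}(sqr_sqrtr (ltW x0)) le_eqVlt; apply/orP; left; apply/eqP; field.
by rewrite !gt_eqF// sqrtr_gt0// pi_gt0.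
Qed.

(** [Gamma_half_le] taken at [x + 1/2] bounds [Gamma (x + 1)] from above by a multiple of
    [Gamma (x + 1/2)], which is a lower bound for their quotient. *)
Lemma central_binom_ge x : 0 < x -> (Num.sqrt (pi * (x + 2^-1)))^-1 <= central_binom x.
Proof.
move=> x0; rewrite central_binomE//.
have y0 : 0 < x + 2^-1 by rewrite addr_gt0// invr_gt0.
have := Gamma_half_le y0; rewrite -addrA (_ : 2^-1 + 2^-1 = 1); last by field.
move=> H; rewrite ler_pdivlMr ?mulr_gt0 ?sqrtr_gt0 ?pi_gt0 ?Gamma_gt0 ?addr_gt0//.
rewrite sqrtrM ?pi_ge0// mulrC ler_pdivrMr ?mulr_gt0 ?sqrtr_gt0 ?pi_gt0//.
by rewrite mulrCA ler_wpM2l ?sqrtr_ge0// mulrC.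
Qed.

End gamma_half_integers.

(** * Integration over row vectors *)

Section rV_integration.
Context {R : realType}.
Local Notation mu := (@lebesgue_measure R).
Local Notation leb := (@lebesgue_rV R).

Lemma rV_cons0 n (p : R * 'rV[R]_n) : rV_cons p ord0 ord0 = p.1.
Proof. by rewrite -[in RHS](rV_consK p). Qed.

Lemma rV_consS n (p : R * 'rV[R]_n) j : rV_cons p ord0 (lift ord0 j) = p.2 ord0 j.
Proof.
rewrite (_ : lift ord0 j = rshift 1 j); last exact: val_inj.
exact: (row_mxEr (p.1%:M : 'rV_1) p.2 ord0 j).
Qed.

Lemma measurable_coord n (j : 'I_n) : measurable_fun setT (fun s : 'rV[R]_n => s ord0 j).
Proof. exact: measurable_rV_coord. Qed.

Lemma ge0_integral_rVS n (f : 'rV[R]_n.+1 -> \bar R) :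
  measurable_fun setT f -> (forall s, 0 <= f s)%E ->
  (\int[leb n.+1]_s f s = \int[mu]_u \int[leb n]_v f (rV_cons (u, v)))%E.
Proof.
move=> mf f0.
have mc : measurable_fun [set: measurableTypeR R * 'rV[R]_n] (@rV_cons R n).
  exact: measurable_rV_cons.
transitivity (\int[mu \x leb n]_p (f (rV_cons p)))%E.
  exact: (ge0_integral_pushforward mc (mu \x leb n)%E measurableT mf (fun y _ => f0 y)).
rewrite fubini_tonelli1//.
exact: (measurableT_comp mf mc).
Qed.

Lemma ge0_integral_rVS_swap n (f : 'rV[R]_n.+1 -> \bar R) :
  measurable_fun setT f -> (forall s, 0 <= f s)%E ->
  (\int[leb n.+1]_s f s = \int[leb n]_v \int[mu]_u f (rV_cons (u, v)))%E.
Proof.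
move=> mf f0; rewrite ge0_integral_rVS//.
apply: (@fubini_tonelli _ _ _ _ _ mu (leb n) (fun p => f (rV_cons p))) => //.
exact: (measurableT_comp mf (@measurable_rV_cons R n)).
Qed.

Lemma measurable_sum_coord n : measurable_fun setT (fun s : 'rV[R]_n => \sum_j s ord0 j).
Proof. by apply: measurable_sum => j; exact: measurable_coord. Qed.

Lemma measurable_level_set d (T : measurableType d) (f : T -> R) (c : R) :
  measurable_fun setT f -> measurable [set t | f t = c].
Proof.
move=> mf; have := mf measurableT [set c] (measurable_set1 c).
by rewrite setTI.
Qed.

(** Once the other coordinates are fixed, the first one is determined, so every slice is a single
    point. Dimension 0 is excluded: there the set can be the whole space, of mass 1. *)
Lemma lebesgue_rV_sum_eq n (c : R) : leb n.+1 [set s | \sum_j s ord0 j = c] = 0%E.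
Proof.
have mA : measurable [set s : 'rV[R]_n.+1 | \sum_j s ord0 j = c].
  by apply: measurable_level_set; exact: measurable_sum_coord.
rewrite -[X in leb n.+1 X]setIT -integral_indic// ge0_integral_rVS_swap//; last first.
  by apply/measurable_EFinP; exact: measurable_indic.
apply: integral0_eq => v _.
pose w := c - \sum_j v ord0 j.
transitivity (\int[mu]_u (\1_[set w] u)%:E)%E.
  apply: eq_integral => u _; congr EFin; rewrite !indicE; congr (nat_of_bool _)%:R; apply/idP/idP.
  - rewrite !inE/= big_ord_recl rV_cons0 /w => <-.
    by under eq_bigr do rewrite rV_consS; rewrite addrK.
  - rewrite !inE/= big_ord_recl rV_cons0 => ->/=.
    by under eq_bigr do rewrite rV_consS; rewrite /w subrK.
by rewrite integral_indic// setIT; exact: lebesgue_measure_set1.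
Qed.

Lemma lebesgue_rV_coord_eq n (j : 'I_n) (c : R) : leb n [set s | s ord0 j = c] = 0%E.
Proof.
elim: n j => [[]//|n IH] j.
have mA m (k : 'I_m) : measurable [set s : 'rV[R]_m | s ord0 k = c].
  by apply: measurable_level_set; exact: measurable_coord.
have m1 : measurable_fun setT (fun s : 'rV[R]_n.+1 => (\1_[set s | s ord0 j = c] s)%:E : \bar R).
  by apply/measurable_EFinP; apply: measurable_indic; exact: mA.
rewrite -[X in leb n.+1 X]setIT -integral_indic//; last exact: mA.
have [k jk|j0] := unliftP ord0 j.
- rewrite ge0_integral_rVS//; apply: integral0_eq => u _.
  transitivity (\int[leb n]_v (\1_[set v | v ord0 k = c] v)%:E)%E.
    apply: eq_integral => v _; congr EFin; rewrite !indicE; congr (nat_of_bool _)%:R.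
    by apply/idP/idP; rewrite !inE/= jk rV_consS.
  by rewrite (integral_indic (leb n) measurableT (mA n k)) setIT; exact: IH.
- rewrite ge0_integral_rVS_swap//; apply: integral0_eq => v _.
  transitivity (\int[mu]_u (\1_[set c] u)%:E)%E.
    apply: eq_integral => u _; congr EFin; rewrite !indicE; congr (nat_of_bool _)%:R.
    by apply/idP/idP; rewrite !inE/= j0 rV_cons0.
  by rewrite integral_indic// setIT; exact: lebesgue_measure_set1.
Qed.

(* Unnormalized Dirichlet density on the simplex of size [r]; it vanishes off the
   open simplex because [pos_pow] vanishes on nonpositive numbers. *)
Definition dirichlet_weight n (a : 'rV[R]_n) b r (s : 'rV[R]_n) : R :=
  (\prod_j pos_pow (a ord0 j) (s ord0 j)) * pos_pow b (r - \sum_j s ord0 j).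

Lemma dirichlet_weight_ge0 n (a : 'rV[R]_n) b r s : 0 <= dirichlet_weight a b r s.
Proof. by rewrite mulr_ge0 ?pos_pow_ge0// prodr_ge0// => j _; exact: pos_pow_ge0. Qed.

Lemma measurable_dirichlet_weight n (a : 'rV[R]_n) b r :
  measurable_fun setT (dirichlet_weight a b r).
Proof.
apply: measurable_funM.
  by apply: measurable_prod => j _; apply: measurable_pos_pow2 => //; exact: measurable_coord.
apply: measurable_pos_pow2 => //; apply: measurable_funB => //; exact: measurable_sum_coord.
Qed.

(** Induction on the dimension. With the first coordinate fixed at [u], the others fill a simplex of
    size [r - u], which is why [r] is a variable. What remains is a convolution in [u] with the
    total parameter of the other coordinates. *)
Lemma integral_dirichlet_weight n (a : 'rV[R]_n) b r :
  (forall j, 0 < a ord0 j) -> 0 < b ->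
  (\int[leb n]_s (dirichlet_weight a b r s)%:E =
   (pos_pow (\sum_j a ord0 j + b) r *
    ((\prod_j Gamma (a ord0 j)) * Gamma b / Gamma (\sum_j a ord0 j + b)))%:E)%E.
Proof.
move=> + b0; elim: n a r => [|n IH] a r a0.
  rewrite /= integral_dirac//; last first.
    by apply/measurable_EFinP; exact: measurable_dirichlet_weight.
  rewrite diracT mul1e /dirichlet_weight !big_ord0 subr0 add0r !mul1r divff ?mulr1//.
  by rewrite gt_eqF// Gamma_gt0.
have mw := measurable_dirichlet_weight a b r.
rewrite ge0_integral_rVS//; last 2 first.
- exact/measurable_EFinP.
- by move=> s; rewrite lee_fin dirichlet_weight_ge0.
pose a' : 'rV[R]_n := \row_j a ord0 (lift ord0 j).
have a'0 j : 0 < a' ord0 j by rewrite mxE.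
have Sa : \sum_j a' ord0 j = \sum_j a ord0 (lift ord0 j) by apply: eq_bigr => j _; rewrite mxE.
have Pa : \prod_j Gamma (a' ord0 j) = \prod_j Gamma (a ord0 (lift ord0 j)).
  by apply: eq_bigr => j _; rewrite mxE.
(* The existential makes [c] an opaque atom for the later rewriting and for [field]. *)
have [c cE] : exists c, c = \sum_j a' ord0 j + b by eexists.
have c0 : 0 < c by rewrite cE; apply: ltr_wpDl => //; apply: sumr_ge0 => j _; exact: ltW.
have [K KE] : exists K, K = (\prod_j Gamma (a' ord0 j)) * Gamma b / Gamma c by eexists.
have K0 : 0 <= K.
  rewrite KE; apply: divr_ge0; last exact/ltW/Gamma_gt0.
  apply: mulr_ge0; last exact/ltW/Gamma_gt0.
  by apply: prodr_ge0 => j _; exact/ltW/Gamma_gt0.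
transitivity (\int[mu]_u (K%:E * (pos_pow (a ord0 ord0) u * pos_pow c (r - u))%:E))%E.
  apply: eq_integral => u _.
  have [p pE] : exists p, p = pos_pow (a ord0 ord0) u by eexists.
  have p0 : 0 <= p by rewrite pE pos_pow_ge0.
  transitivity (\int[leb n]_v (p%:E * (dirichlet_weight a' b (r - u) v)%:E))%E.
    apply: eq_integral => v _; rewrite -EFinM pE; congr EFin.
    rewrite /dirichlet_weight !big_ord_recl rV_cons0 mulrA opprD addrA; congr (_ * _ * pos_pow b (_ - _)).
      by apply: eq_bigr => j _; rewrite rV_consS mxE.
    by apply: eq_bigr => j _; rewrite rV_consS.
  rewrite ge0_integralZl//; last 2 first.
  - by apply/measurable_EFinP; exact: measurable_dirichlet_weight.
  - by move=> v _; rewrite lee_fin dirichlet_weight_ge0.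
  by rewrite (IH a' _ a'0) -!EFinM -cE -KE -pE; congr EFin; ring.
rewrite ge0_integralZl//; last 2 first.
- apply/measurable_EFinP; apply: measurable_funM; apply: measurable_pos_pow2 => //.
  exact: measurable_funB.
- by move=> v _; rewrite lee_fin mulr_ge0 ?pos_pow_ge0.
rewrite integral_pos_pow_conv (ebetaE (a0 ord0) c0) -!EFinM; congr EFin.
rewrite !big_ord_recl -Sa -Pa -addrA -cE KE.
have := Gamma_gt0 c0; have := Gamma_gt0 (addr_gt0 (a0 ord0) c0).
move: (Gamma c) (Gamma (a ord0 ord0 + c)) (pos_pow _ _) (\prod_(i < n) _) => x y z t y0 x0.
by field; rewrite !gt_eqF.
Qed.

End rV_integration.

(** * Dirichlet densities *)

Section simplex_expectation.
Context {R : realType} (d : nat).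
Local Notation leb := (@lebesgue_rV R d).
Local Notation S := (@simplex R d).
Local Notation O := (@open_simplex R d).
Implicit Types (s t alpha : 'rV[R]_d) (phi psi : 'rV[R]_d -> R).

Lemma l1norm_ge0E s : (forall j, 0 <= s ord0 j) -> l1norm s = \sum_j s ord0 j.
Proof. by move=> s0; apply: eq_bigr => j _; rewrite ger0_norm. Qed.

Lemma coord_le_sum s j : (forall k, 0 <= s ord0 k) -> s ord0 j <= \sum_k s ord0 k.
Proof. by move=> s0; rewrite (bigD1 j)//= lerDl sumr_ge0. Qed.

Lemma simplexP s : S s <-> (forall j, 0 <= s ord0 j) /\ \sum_j s ord0 j <= 1.
Proof.
split=> [[s01 s1]|[s0 s1]].
  have s0 j : 0 <= s ord0 j by have /andP[] := s01 j.
  by rewrite -l1norm_ge0E.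
split; last by rewrite l1norm_ge0E.
by move=> j; rewrite s0/= (le_trans _ s1)// coord_le_sum.
Qed.

Lemma open_simplexP s : O s <-> (forall j, 0 < s ord0 j) /\ \sum_j s ord0 j < 1.
Proof.
split=> [[s01 s1]|[s0 s1]].
  have s0 j : 0 < s ord0 j by have /andP[] := s01 j.
  by split=> //; rewrite -l1norm_ge0E// => j; exact: ltW.
have s0' j : 0 <= s ord0 j by exact: ltW.
split; last by rewrite l1norm_ge0E.
by move=> j; rewrite s0/= (le_lt_trans _ s1)// coord_le_sum.
Qed.

Lemma open_simplex_sub : O `<=` S.
Proof.
by move=> s /open_simplexP[s0 s1]; apply/simplexP; split; [move=> j|]; exact: ltW.
Qed.

Lemma measurable_simplex : measurable S.
Proof.
have -> : S = (\bigcap_(j in [set: 'I_d]) [set s | 0 <= s ord0 j]) `&` [set s | \sum_j s ord0 j <= 1].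
  by apply/seteqP; split => s; rewrite simplexP => -[s0 s1]; split => // j; [move=> _; exact: s0 | exact: (s0 j I)].
apply: measurableI; last first.
  have := measurable_fun_ler (@measurable_sum_coord R d) (measurable_cst (1:R)) => /(_ measurableT [set true]).
  by rewrite setTI; apply.
apply: fin_bigcap_measurable => // j _.
have := measurable_fun_ler (measurable_cst (0:R)) (@measurable_coord R d j) => /(_ measurableT [set true]).
by rewrite setTI; apply.
Qed.

Lemma measurable_open_simplex : measurable O.
Proof.
have -> : O = (\bigcap_(j in [set: 'I_d]) [set s | 0 < s ord0 j]) `&` [set s | \sum_j s ord0 j < 1].
  by apply/seteqP; split => s; rewrite open_simplexP => -[s0 s1]; split => // j; [move=> _; exact: s0 | exact: (s0 j I)].
apply: measurableI; last first.
  have := measurable_fun_ltr (@measurable_sum_coord R d) (measurable_cst (1:R)) => /(_ measurableT [set true]).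
  by rewrite setTI; apply.
apply: fin_bigcap_measurable => // j _.
have := measurable_fun_ltr (measurable_cst (0:R)) (@measurable_coord R d j) => /(_ measurableT [set true]).
by rewrite setTI; apply.
Qed.

(** A point of the simplex off its open part has a zero coordinate or coordinates of sum 1, hence
    lies on one of [d + 1] null hyperplanes. *)
Lemma lebesgue_simplex_boundary : (0 < d)%N -> leb (S `\` O) = 0%E.
Proof.
move=> d0; apply/eqP; rewrite eq_le measure_ge0 andbT.
pose H (j : 'I_d) : set 'rV[R]_d := [set s | s ord0 j = 0].
pose H1 : set 'rV[R]_d := [set s | \sum_j s ord0 j = 1].
have mH j : measurable (H j) by apply: measurable_level_set; exact: measurable_coord.
have mH1 : measurable H1 by apply: measurable_level_set; exact: measurable_sum_coord.
have mU : measurable (\big[setU/set0]_j H j) by exact: bigsetU_measurable.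
have -> : 0%E = (leb (\big[setU/set0]_j H j) + leb H1)%E.
  have -> : leb H1 = 0%E.
    by rewrite /H1; case: (d) d0 => // n _; exact: lebesgue_rV_sum_eq.
  rewrite adde0.
  have [] : measurable (\big[setU/set0]_j H j) /\ leb (\big[setU/set0]_j H j) = 0%E; last by [].
  apply: (@big_ind _ (fun A => measurable A /\ leb A = 0%E)).
  - by split; [exact: measurable0 | exact: measure0].
  - move=> A B [mA A0] [mB B0]; split; first exact: measurableU.
    by rewrite measureU0.
  - by move=> j _; split; [exact: mH | exact: lebesgue_rV_coord_eq].
apply: (le_trans _ (measureU2 leb mU mH1)); apply: le_measure; rewrite ?inE.
- by apply: measurableD; [exact: measurable_simplex | exact: measurable_open_simplex].
- exact: measurableU.
move=> s [/simplexP[s0 s1] nO].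
have [e|ne] := eqVneq (\sum_j s ord0 j) 1; first by right.
left; apply: contrapT => nH; apply: nO; apply/open_simplexP; split; last by rewrite lt_neqAle ne.
move=> j; rewrite lt_neqAle s0 andbT; apply/eqP => e; apply: nH.
by rewrite -bigcup_seq; exists j => //=; rewrite mem_index_enum.
Qed.

(** The bridge between the integrals over the closed simplex in the statement and the estimates,
    which are available only on the open simplex. *)
Lemma Rintegral_simplex_open (h : 'rV[R]_d -> R) : (0 < d)%N ->
  measurable_fun S h -> leb.-integrable O (EFin \o h) ->
  leb.-integrable S (EFin \o h) /\ \int[leb]_(t in S) h t = \int[leb]_(t in O) h t.
Proof.
move=> d0 mh ih.
have mN : measurable (S `\` O).
  by apply: measurableD; [exact: measurable_simplex | exact: measurable_open_simplex].
have SN : S `\` (S `\` O) = O.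
  by rewrite setDD; apply/setIidPr; exact: open_simplex_sub.
have iS : leb.-integrable S (EFin \o h).
  apply/(negligible_integrable mN measurable_simplex) => //.
  - exact/measurable_EFinP.
  - exact: lebesgue_simplex_boundary.
  - by rewrite SN.
split=> //; rewrite /Rintegral (negligible_integral mN measurable_simplex iS); last exact: lebesgue_simplex_boundary.
by rewrite SN.
Qed.

Definition dirichlet_norm alpha beta : R :=
  Gamma (\sum_j alpha ord0 j + beta) / (Gamma beta * \prod_j Gamma (alpha ord0 j)).

Lemma dirichlet_weight_out alpha beta t : ~ O t -> dirichlet_weight alpha beta 1 t = 0.
Proof.
move=> nO; rewrite /dirichlet_weight.
have [/forallP h|] := boolP [forall j, 0 < t ord0 j]; last first.
  rewrite negb_forall => /existsP[j]; rewrite -leNgt => tj.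
  by rewrite (bigD1 j)//= pos_pow_le0// !mul0r.
rewrite [X in _ * X]pos_pow_le0 ?mulr0// subr_le0 leNgt; apply/negP => t1.
by apply: nO; apply/open_simplexP.
Qed.

Lemma dirichlet_pdfE alpha beta t : (forall j, 0 <= alpha ord0 j) -> O t ->
  dirichlet_pdf alpha beta t = dirichlet_norm alpha beta * dirichlet_weight alpha beta 1 t.
Proof.
move=> a0 Ot; have /open_simplexP[t0 t1] := Ot.
rewrite /dirichlet_pdf /dirichlet_norm /dirichlet_weight !l1norm_ge0E//; last by move=> j; exact: ltW.
rewrite -mulrA; congr (_ * _); rewrite mulrC; congr (_ * _); last by rewrite pos_powE ?subr_gt0.
by apply: eq_bigr => j _; rewrite pos_powE.
Qed.

Lemma measurable_dirichlet_pdf alpha beta : measurable_fun setT (dirichlet_pdf alpha beta).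
Proof.
have ml : measurable_fun setT (@l1norm R d).
  by apply: measurable_sum => j; apply: measurableT_comp => //; exact: measurable_coord.
apply: measurable_funM; first apply: measurable_funM => //.
  by apply: (measurableT_comp (measurable_powR _)); exact: measurable_funB.
apply: measurable_prod => j _.
by apply: (measurableT_comp (measurable_powR _)); exact: measurable_coord.
Qed.

Lemma dirichlet_norm_gt0 alpha beta : (forall j, 0 < alpha ord0 j) -> 0 < beta ->
  0 < dirichlet_norm alpha beta.
Proof.
move=> a0 b0; apply: divr_gt0; first apply: Gamma_gt0.
  by apply: ltr_wpDl => //; apply: sumr_ge0 => j _; exact: ltW.
by apply: mulr_gt0; [exact: Gamma_gt0 | apply: prodr_gt0 => j _; exact: Gamma_gt0].
Qed.

Lemma dirichlet_pdf_ge0 alpha beta t : (forall j, 0 < alpha ord0 j) -> 0 < beta ->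
  0 <= dirichlet_pdf alpha beta t.
Proof.
move=> a0 b0; apply: mulr_ge0; last by apply: prodr_ge0 => j _; exact: powR_ge0.
apply: mulr_ge0; last exact: powR_ge0.
have := dirichlet_norm_gt0 a0 b0; rewrite /dirichlet_norm l1norm_ge0E => [/ltW//|j]; exact: ltW.
Qed.

Lemma integral_dirichlet_weight_open alpha beta : (forall j, 0 < alpha ord0 j) -> 0 < beta ->
  (\int[leb]_(t in O) (dirichlet_weight alpha beta 1 t)%:E = ((dirichlet_norm alpha beta)^-1)%:E)%E.
Proof.
move=> a0 b0.
transitivity (\int[leb]_t (dirichlet_weight alpha beta 1 t)%:E)%E.
  rewrite integral_mkcond; apply: eq_integral => t _; rewrite patchE.
  by case: ifPn => //; rewrite notin_setE => nO; rewrite dirichlet_weight_out.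
rewrite integral_dirichlet_weight//; congr EFin.
rewrite /pos_pow ltr01 ln1 mulr0 expR0 mul1r /dirichlet_norm invf_div; congr (_ / _).
by rewrite mulrC.
Qed.

Lemma integral_dirichlet_pdf alpha beta : (forall j, 0 < alpha ord0 j) -> 0 < beta ->
  (\int[leb]_(t in O) (dirichlet_pdf alpha beta t)%:E = 1)%E.
Proof.
move=> a0 b0; have c0 := dirichlet_norm_gt0 a0 b0.
transitivity (\int[leb]_(t in O) ((dirichlet_norm alpha beta)%:E * (dirichlet_weight alpha beta 1 t)%:E))%E.
  apply: eq_integral => t; rewrite inE => Ot.
  by rewrite dirichlet_pdfE// => j; exact: ltW.
rewrite ge0_integralZl//; last 4 first.
- exact: measurable_open_simplex.
- by apply: measurable_funTS; apply/measurable_EFinP; exact: measurable_dirichlet_weight.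
- by move=> t _; rewrite lee_fin dirichlet_weight_ge0.
- by rewrite lee_fin ltW.
by rewrite integral_dirichlet_weight_open// -EFinM divff// gt_eqF.
Qed.

Lemma integrable_dirichlet_pdf alpha beta : (forall j, 0 < alpha ord0 j) -> 0 < beta ->
  leb.-integrable O (EFin \o dirichlet_pdf alpha beta).
Proof.
move=> a0 b0; apply/integrableP; split.
  by apply: measurable_funTS; apply/measurable_EFinP; exact: measurable_dirichlet_pdf.
under eq_integral do rewrite gee0_abs ?lee_fin ?dirichlet_pdf_ge0//.
by rewrite integral_dirichlet_pdf// ltry.
Qed.

(** A class of test functions stable under sums, products and powers and integrable against every
    Dirichlet density with positive parameters: integrability conditions reduce to membership. *)
Definition bounded_measurable phi :=
  measurable_fun O phi /\ exists C, forall t, O t -> `|phi t| <= C.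

Lemma bmD phi psi : bounded_measurable phi -> bounded_measurable psi ->
  bounded_measurable (fun t => phi t + psi t).
Proof.
move=> [m1 [C1 h1]] [m2 [C2 h2]]; split; first exact: measurable_funD.
by exists (C1 + C2) => t Ot; rewrite (le_trans (ler_normD _ _))// lerD ?h1 ?h2.
Qed.

Lemma bmM phi psi : bounded_measurable phi -> bounded_measurable psi ->
  bounded_measurable (fun t => phi t * psi t).
Proof.
move=> [m1 [C1 h1]] [m2 [C2 h2]]; split; first exact: measurable_funM.
by exists (C1 * C2) => t Ot; rewrite normrM ler_pM ?h1 ?h2.
Qed.

Lemma bm_cst (c : R) : bounded_measurable (fun=> c).
Proof. by split=> //; exists `|c|. Qed.

Lemma bmZ (c : R) phi : bounded_measurable phi -> bounded_measurable (fun t => c * phi t).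
Proof. by apply: bmM; exact: bm_cst. Qed.

Lemma bmX phi n : bounded_measurable phi -> bounded_measurable (fun t => phi t ^+ n).
Proof.
move=> h; elim: n => [|n IH]; first exact: bm_cst.
by under [X in bounded_measurable X]eq_fun do rewrite exprS; exact: bmM.
Qed.

Lemma bm_coord j : bounded_measurable (fun t => t ord0 j).
Proof.
split; first by apply: measurable_funTS; exact: measurable_coord.
by exists 1 => t [/(_ j)/andP[t0 t1] _]; rewrite gtr0_norm// ltW.
Qed.

Lemma bm_sum (I : finType) (F : I -> 'rV[R]_d -> R) : (forall i, bounded_measurable (F i)) ->
  bounded_measurable (fun t => \sum_i F i t).
Proof.
move=> h; have /choice[C hC] : forall i, exists c, forall t, O t -> `|F i t| <= c.
  by move=> i; have [_] := h i.
split; first by apply: measurable_sum => i; have [] := h i.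
exists (\sum_i C i) => t Ot; apply: le_trans (ler_norm_sum _ _ _) _.
by apply: ler_sum => i _; exact: hC.
Qed.

Lemma bm_integrable alpha beta phi : (forall j, 0 < alpha ord0 j) -> 0 < beta ->
  bounded_measurable phi -> leb.-integrable O (EFin \o (fun t => phi t * dirichlet_pdf alpha beta t)).
Proof.
move=> a0 b0 [mphi [C hC]].
apply: (@le_integrable _ _ _ _ _ measurable_open_simplex _ (fun t => (C%:E * (dirichlet_pdf alpha beta t)%:E)%E)).
- apply/measurable_EFinP; apply: measurable_funM => //.
  by apply: measurable_funTS; exact: measurable_dirichlet_pdf.
- move=> t Ot; rewrite -EFinM/= lee_fin !normrM ler_wpM2r//.
  by rewrite (le_trans (hC t Ot))// ler_norm.
- by apply: integrableZl; [exact: measurable_open_simplex | exact: integrable_dirichlet_pdf].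
Qed.

Definition dirichlet_mean alpha beta phi : R :=
  \int[leb]_(t in O) (phi t * dirichlet_pdf alpha beta t).

Section mean_theory.
Variables (alpha : 'rV[R]_d) (beta : R).
Hypotheses (a0 : forall j, 0 < alpha ord0 j) (b0 : 0 < beta).
Local Notation E := (dirichlet_mean alpha beta).
Local Notation bm := bounded_measurable.

Lemma meanD phi psi : bm phi -> bm psi -> E (fun t => phi t + psi t) = E phi + E psi.
Proof.
move=> h1 h2; rewrite /dirichlet_mean -RintegralD//; last 3 first.
- exact: measurable_open_simplex.
- exact: bm_integrable.
- exact: bm_integrable.
by apply: eq_Rintegral => t _; rewrite mulrDl.
Qed.

Lemma meanZ c phi : bm phi -> E (fun t => c * phi t) = c * E phi.
Proof.
move=> h; rewrite /dirichlet_mean -RintegralZl//; last 2 first.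
- exact: measurable_open_simplex.
- exact: bm_integrable.
by apply: eq_Rintegral => t _; rewrite mulrA.
Qed.

Lemma mean1 : E (fun=> 1) = 1.
Proof.
rewrite /dirichlet_mean /Rintegral.
by under eq_integral do rewrite mul1r; rewrite integral_dirichlet_pdf.
Qed.

Lemma mean_cst c : E (fun=> c) = c.
Proof.
have h := meanZ c (bm_cst 1); rewrite mean1 mulr1 in h.
by rewrite -[RHS]h /=; congr E; apply/funext => t; rewrite mulr1.
Qed.

Lemma le_mean phi psi : bm phi -> bm psi -> (forall t, O t -> phi t <= psi t) -> E phi <= E psi.
Proof.
move=> h1 h2 h; apply: le_Rintegral.
- exact: measurable_open_simplex.
- exact: bm_integrable.
- exact: bm_integrable.
- by move=> t Ot; rewrite ler_wpM2r ?dirichlet_pdf_ge0// h.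
Qed.

Lemma mean_ge0 phi : (forall t, O t -> 0 <= phi t) -> 0 <= E phi.
Proof.
by move=> h; apply: Rintegral_ge0 => t Ot; rewrite mulr_ge0 ?h// dirichlet_pdf_ge0.
Qed.

Lemma ler_norm_mean phi psi : bm phi -> bm psi -> (forall t, O t -> `|phi t| <= psi t) -> `|E phi| <= E psi.
Proof.
move=> h1 h2 h; rewrite ler_norml; apply/andP; split; last first.
  by apply: le_mean => // t Ot; rewrite (le_trans (ler_norm _))// h.
rewrite -mulN1r -meanZ//; apply: le_mean => //; first exact: bmZ.
by move=> t Ot; have := h t Ot; rewrite mulN1r ler_norml => /andP[].
Qed.

Lemma eq_mean phi psi : (forall t, O t -> phi t = psi t) -> E phi = E psi.
Proof. by move=> h; apply: eq_Rintegral => t; rewrite inE => Ot; rewrite h. Qed.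

Lemma mean_sum (I : finType) (F : I -> 'rV[R]_d -> R) : (forall i, bm (F i)) ->
  E (fun t => \sum_i F i t) = \sum_i E (F i).
Proof.
move=> h.
have H (r : seq I) : bm (fun t => \sum_(i <- r) F i t) /\ E (fun t => \sum_(i <- r) F i t) = \sum_(i <- r) E (F i).
  elim: r => [|i r [IH1 IH2]].
    rewrite big_nil; split; first by under [X in bm X]eq_fun do rewrite big_nil; exact: bm_cst.
    by under eq_mean do rewrite big_nil; rewrite mean_cst.
  split; first by under [X in bm X]eq_fun do rewrite big_cons; exact: bmD.
  by under eq_mean do rewrite big_cons; rewrite meanD// IH2 big_cons.
by have [] := H (index_enum I).
Qed.

End mean_theory.

(* Multiplying the density by [t_j] shifts the parameter [alpha_j] by one. *)
Lemma mean_coordM alpha beta j phi : (forall j, 0 < alpha ord0 j) -> 0 < beta -> bounded_measurable phi ->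
  dirichlet_mean alpha beta (fun t => t ord0 j * phi t) =
  alpha ord0 j / (\sum_j alpha ord0 j + beta) *
    dirichlet_mean (alpha + delta_mx ord0 j) beta phi.
Proof.
move=> a0 b0 bphi; set alpha' := alpha + delta_mx ord0 j.
have a'E k : alpha' ord0 k = alpha ord0 k + (k == j)%:R by rewrite !mxE eqxx.
have a'0 k : 0 < alpha' ord0 k by rewrite a'E ltr_wpDr.
have Sa' : \sum_k alpha' ord0 k = \sum_k alpha ord0 k + 1.
  under eq_bigr do rewrite a'E; rewrite big_split/=; congr (_ + _).
  rewrite (bigD1 j)//= eqxx; by rewrite big1 ?addr0// => k /negbTE ->.
have A0 : 0 < \sum_k alpha ord0 k + beta.
  by apply: ltr_wpDl => //; apply: sumr_ge0 => k _; exact: ltW.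
(* Only two Gamma factors change, the one at [alpha_j] and the one at the total parameter; the
   functional equation applies to each. *)
have nE : dirichlet_norm alpha beta = alpha ord0 j / (\sum_k alpha ord0 k + beta) * dirichlet_norm alpha' beta.
  have P1 : \prod_k Gamma (alpha ord0 k) = Gamma (alpha ord0 j) * \prod_(k < d | k != j) Gamma (alpha' ord0 k).
    rewrite (bigD1 j) /=; last by [].
    apply: (congr1 (fun z => Gamma (alpha ord0 j) * z)).
    by apply: eq_bigr => k /negbTE kj; rewrite a'E kj addr0.
  have P2 : \prod_k Gamma (alpha' ord0 k) = alpha ord0 j * Gamma (alpha ord0 j) * \prod_(k < d | k != j) Gamma (alpha' ord0 k).
    rewrite (bigD1 j) /=; last by [].
    by rewrite a'E eqxx (GammaS (a0 j)).
  rewrite /dirichlet_norm Sa' addrAC (GammaS A0) P1 P2.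
  have := a0 j; have := Gamma_gt0 (a0 j); have := Gamma_gt0 b0.
  have : 0 < \prod_(i < d | i != j) Gamma (alpha' ord0 i) by apply: prodr_gt0 => k _; exact: Gamma_gt0.
  move: A0 (Gamma_gt0 A0); set A := _ + beta; move: A (Gamma A) (Gamma beta) (Gamma (alpha ord0 j)) (\prod_(_ < _ | _) _) (alpha ord0 j).
  by move=> A B C D E F *; field; rewrite !gt_eqF.
rewrite /dirichlet_mean.
transitivity (\int[leb]_(t in O) (alpha ord0 j / (\sum_k alpha ord0 k + beta) * (phi t * dirichlet_pdf alpha' beta t))).
  apply: eq_Rintegral => t; rewrite inE => Ot.
  rewrite !dirichlet_pdfE//; try by move=> k; exact: ltW.
  have W : dirichlet_weight alpha' beta 1 t = t ord0 j * dirichlet_weight alpha beta 1 t.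
    rewrite /dirichlet_weight mulrA; apply: (congr1 (fun z => z * _)).
    rewrite (bigD1 j) /=; last by [].
    rewrite [in RHS](bigD1 j) /=; last by [].
    rewrite mulrA a'E eqxx -pos_powS; apply: (congr1 (fun z => _ * z)).
    by apply: eq_bigr => k /negbTE kj; rewrite a'E kj addr0.
  by rewrite nE W; ring.
rewrite RintegralZl//; last exact: bm_integrable.
exact: measurable_open_simplex.
Qed.

End simplex_expectation.

(** * Moments of the Dirichlet kernel *)

Section dirichlet_moments.
Context {R : realType} (d : nat).
Implicit Types (s t alpha : 'rV[R]_d).

Lemma sum_delta_mx (j : 'I_d) : \sum_k (delta_mx ord0 j : 'rV[R]_d) ord0 k = 1.
Proof.
rewrite (bigD1 j) /=; last by [].
rewrite mxE !eqxx/= big1 ?addr0// => k /negbTE kj.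
by rewrite mxE eqxx kj.
Qed.

(** Induction on [n] with [alpha] free, because each use of [mean_coordM] raises [alpha_j] and the
    total parameter by one. The product is a quotient of rising factorials. *)
Lemma mean_coordX alpha beta j n : (forall j, 0 < alpha ord0 j) -> 0 < beta ->
  dirichlet_mean alpha beta (fun t => t ord0 j ^+ n) =
  \prod_(i < n) ((alpha ord0 j + i%:R) / (\sum_k alpha ord0 k + beta + i%:R)).
Proof.
move=> + b0; elim: n alpha => [|n IH] alpha a0.
  by rewrite big_ord0; exact: mean1.
transitivity (dirichlet_mean alpha beta (fun t => t ord0 j * t ord0 j ^+ n)).
  by apply: eq_mean => t _; rewrite exprS.
rewrite mean_coordM//; last exact/bmX/bm_coord.
have a'0 k : 0 < (alpha + delta_mx ord0 j) ord0 k by rewrite !mxE ltr_wpDr// ler0n.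
rewrite (IH _ a'0) big_ord_recl !addr0; congr (_ * _); apply: eq_bigr => i _.
rewrite lift0 -natr1; congr (_ / _).
  by rewrite !mxE !eqxx/= -addrA [1 + _]addrC.
have -> : \sum_k (alpha + delta_mx ord0 j) ord0 k = \sum_k alpha ord0 k + 1.
  by rewrite -(sum_delta_mx j) -big_split/=; apply: eq_bigr => k _; rewrite mxE.
ring.
Qed.

End dirichlet_moments.

Section kernel_moments.
Context {R : realType} (d : nat).
Local Notation leb := (@lebesgue_rV R d).
Local Notation S := (@simplex R d).
Local Notation O := (@open_simplex R d).
Variables (s : 'rV[R]_d) (b : R).
Hypotheses (Ss : S s) (b0 : 0 < b).
Local Notation D := (d%:R + 1 : R).

Definition kernel_alpha : 'rV[R]_d := b^-1 *: s + const_mx 1.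
Definition kernel_beta : R := (1 - l1norm s) / b + 1.

Lemma kernel_alphaE j : kernel_alpha ord0 j = s ord0 j / b + 1.
Proof. by rewrite !mxE mulrC. Qed.

Lemma simplex_coord01 j : 0 <= s ord0 j <= 1.
Proof. by have [] := Ss. Qed.

Lemma kernel_alpha_gt0 j : 0 < kernel_alpha ord0 j.
Proof.
rewrite kernel_alphaE ltr_wpDl//; apply: divr_ge0; last exact: ltW.
by have /andP[] := simplex_coord01 j.
Qed.

Lemma kernel_beta_gt0 : 0 < kernel_beta.
Proof.
rewrite /kernel_beta ltr_wpDl//; apply: divr_ge0; last exact: ltW.
by rewrite subr_ge0; have [] := Ss.
Qed.

(** The barycentric coordinates of [s] sum to 1 and contribute [1 / b]; each of the [d + 1]
    parameters contributes one more unit. This is where the constant [D] comes from. *)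
Lemma kernel_sum : \sum_j kernel_alpha ord0 j + kernel_beta = (1 + b * D) / b.
Proof.
have [s0 s1] := (simplexP s).1 Ss.
rewrite /kernel_beta l1norm_ge0E//.
under eq_bigr do rewrite kernel_alphaE.
rewrite big_split/= -mulr_suml sumr_const card_ord -[1 *+ d]/(d%:R).
by field; exact: lt0r_neq0.
Qed.

Definition kernel_mean (phi : 'rV[R]_d -> R) := dirichlet_mean kernel_alpha kernel_beta phi.

Let ka0 := kernel_alpha_gt0.
Let kb0 := kernel_beta_gt0.

Let q_gt0 (i : nat) : 0 < 1 + b * (D + i%:R).
Proof. by rewrite addr_gt0// mulr_gt0// ltr_wpDr// ltr_wpDl. Qed.

Lemma kernel_mean_coordX j n : kernel_mean (fun t => t ord0 j ^+ n) =
  \prod_(i < n) ((s ord0 j + b * (1 + i%:R)) / (1 + b * (D + i%:R))).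
Proof.
rewrite /kernel_mean mean_coordX//; apply: eq_bigr => i _.
rewrite kernel_sum kernel_alphaE.
have := q_gt0 i; move: (i%:R : R) (d%:R : R) (s ord0 j) => x y z q0; field.
by rewrite !lt0r_neq0//=; move: q0; congr (0 < _); ring.
Qed.

Lemma kernel_mean_coord j : kernel_mean (fun t => t ord0 j) = (s ord0 j + b) / (1 + b * D).
Proof.
have := kernel_mean_coordX j 1; rewrite big_ord1/= !addr0 mulr1 => <-.
by apply: eq_mean => t _; rewrite expr1.
Qed.

Lemma kernel_mean_coord2 j k : kernel_mean (fun t => t ord0 j * t ord0 k) =
  (s ord0 j + b) * (s ord0 k + b + b * (j == k)%:R) / ((1 + b * D) * (1 + b * (D + 1))).
Proof.
rewrite /kernel_mean mean_coordM//; last exact: bm_coord.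
have a'0 i : 0 < (kernel_alpha + delta_mx ord0 j) ord0 i by rewrite [X in _ < X]mxE ltr_wpDr// mxE ler0n.
transitivity (kernel_alpha ord0 j / (\sum_i kernel_alpha ord0 i + kernel_beta) *
    dirichlet_mean (kernel_alpha + delta_mx ord0 j) kernel_beta (fun t => t ord0 k ^+ 1)).
  by congr (_ * _); apply: eq_mean => t _; rewrite expr1.
rewrite mean_coordX// big_ord1/= !addr0.
have -> : \sum_i (kernel_alpha + delta_mx ord0 j) ord0 i = \sum_i kernel_alpha ord0 i + 1.
  by rewrite -(sum_delta_mx j) -big_split/=; apply: eq_bigr => i _; rewrite mxE.
have a'k : (kernel_alpha + delta_mx ord0 j) ord0 k = s ord0 k / b + 1 + (j == k)%:R.
  by rewrite mxE kernel_alphaE mxE eqxx/= eq_sym.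
rewrite [_ + 1 + kernel_beta]addrAC kernel_sum kernel_alphaE.
rewrite a'k.
have := q_gt0 0; have := q_gt0 1; rewrite addr0.
move: (d%:R : R) (s ord0 j) (s ord0 k) ((j == k)%:R : R) => y z w e q0 q1; field.
by rewrite !lt0r_neq0//=; move: q0; congr (0 < _); ring.
Qed.

Local Notation bm := (@bounded_measurable R d).

(** To first order in [b], this is the coefficient of the gradient in [g_fun]. *)
Lemma kernel_mean_bias j : kernel_mean (fun t => t ord0 j - s ord0 j) =
  b * (1 - D * s ord0 j) / (1 + b * D).
Proof.
rewrite /kernel_mean (@meanD _ _ _ _ ka0 kb0 (fun t => t ord0 j) (fun=> - s ord0 j)); last 2 first.
- exact: bm_coord.
- exact: bm_cst.
rewrite mean_cst// -/(kernel_mean _) kernel_mean_coord.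
have := q_gt0 0; rewrite addr0 => q0; field; exact: lt0r_neq0.
Qed.

(** Centred at [s] and not at the mean of the kernel, as the Taylor expansion requires. The leading
    coefficient is the one of the Hessian in [g_fun]. *)
Lemma kernel_mean_cov j k :
  kernel_mean (fun t => (t ord0 j - s ord0 j) * (t ord0 k - s ord0 k)) =
  b * (s ord0 j * ((j == k)%:R - s ord0 k) + b *
    (s ord0 j * s ord0 k * D * (D + 1) - (s ord0 j + s ord0 k) * (D + 1) + 1 + (j == k)%:R)) /
  ((1 + b * D) * (1 + b * (D + 1))).
Proof.
transitivity (kernel_mean (fun t => (t ord0 j * t ord0 k + - s ord0 k * t ord0 j) +
    (- s ord0 j * t ord0 k + s ord0 j * s ord0 k))).
  by apply: eq_mean => t _; ring.
rewrite /kernel_mean !meanD//; try by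
  [exact: bmM (bm_coord _) (bm_coord _) | exact: bmZ (bm_coord _) | exact: bm_cst
  | exact: bmD (bmM (bm_coord _) (bm_coord _)) (bmZ _ (bm_coord _))
  | exact: bmD (bmZ _ (bm_coord _)) (bm_cst _)].
rewrite !meanZ//; try exact: bm_coord.
rewrite mean_cst// -!/(kernel_mean _) kernel_mean_coord2 !kernel_mean_coord.
have := q_gt0 0; have := q_gt0 1; rewrite addr0.
have ee : (j == k)%:R * (s ord0 j) = (j == k)%:R * s ord0 k.
  by case: eqP => [->//|_]; rewrite !mul0r.
move: (d%:R : R) (s ord0 j) (s ord0 k) ((j == k)%:R : R) ee => y z w e ee q0 q1.
- field.
  by rewrite !lt0r_neq0.
- exact: bm_cst.
- apply: (@bmD R d (fun t => - s ord0 j * t ord0 k) (fun=> s ord0 j * s ord0 k)).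
    by apply: bmZ; exact: bm_coord.
  exact: bm_cst.
Qed.

(** Only the factor [b ^+ 2] matters later: with the bracket and the denominator convergent as [b]
    tends to 0, it makes the fourth moment [o(b)]. *)
Lemma kernel_mean_4th j : let x := s ord0 j in
  kernel_mean (fun t => (t ord0 j - x) ^+ 4) =
  b ^+ 2 * (3 * x ^+ 2 - 6 * x ^+ 3 + 3 * x ^+ 4
    + b * (26 * x - 72 * x ^+ 2 - 20 * x ^+ 2 * D + 64 * x ^+ 3 + 42 * x ^+ 3 * D + 6 * x ^+ 3 * D ^+ 2
           - 18 * x ^+ 4 - 22 * x ^+ 4 * D - 6 * x ^+ 4 * D ^+ 2)
    + b ^+ 2 * (24 - 72 * x - 24 * x * D + 72 * x ^+ 2 + 60 * x ^+ 2 * D + 12 * x ^+ 2 * D ^+ 2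
           - 24 * x ^+ 3 - 44 * x ^+ 3 * D - 24 * x ^+ 3 * D ^+ 2 - 4 * x ^+ 3 * D ^+ 3
           + 6 * x ^+ 4 * D + 11 * x ^+ 4 * D ^+ 2 + 6 * x ^+ 4 * D ^+ 3 + x ^+ 4 * D ^+ 4)) /
  ((1 + b * D) * (1 + b * (D + 1)) * (1 + b * (D + 2)) * (1 + b * (D + 3))).
Proof.
(* Coefficients of [(T - x)^4], lowest degree first. *)
move=> x; pose c := [:: x ^+ 4; - 4 * x ^+ 3; 6 * x ^+ 2; - 4 * x; 1].
transitivity (kernel_mean (fun t => \sum_(i < 5) c`_i * t ord0 j ^+ i)).
  by apply: eq_mean => t _; rewrite !big_ord_recr big_ord0/= /c/=; ring.
rewrite /kernel_mean mean_sum//; last by move=> i; exact/bmZ/bmX/bm_coord.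
rewrite (eq_bigr (fun i : 'I_5 => c`_i *
    \prod_(k < i) ((x + b * (1 + k%:R)) / (1 + b * (D + k%:R))))); last first.
  move=> i _; rewrite -kernel_mean_coordX.
  by apply: meanZ => //; exact/bmX/bm_coord.
rewrite !big_ord_recr !big_ord0/= /c/= -/x; clear c.
have := q_gt0 0; have := q_gt0 1; have := q_gt0 2; have := q_gt0 3; rewrite !addr0.
move: (d%:R : R) x => y z q0 q1 q2 q3.
field.
by rewrite !lt0r_neq0.
Qed.

End kernel_moments.

(** * Square of the Dirichlet kernel *)

Local Opaque Gamma.

Section kernel_square.
Context {R : realType}.

(* [central_binom x] divided by its asymptotic equivalent [1 / sqrt (pi x)]. *)
Definition binom_ratio (x : R) : R := central_binom x * Num.sqrt (pi * x).

Lemma binom_ratio_gt0 x : 0 < x -> 0 < binom_ratio x.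
Proof.
by move=> x0; rewrite mulr_gt0 ?central_binom_gt0// sqrtr_gt0 mulr_gt0 ?pi_gt0.
Qed.

Lemma binom_ratio_le1 x : 0 < x -> binom_ratio x <= 1.
Proof.
move=> x0; have q0 : 0 < Num.sqrt (pi * x) by rewrite sqrtr_gt0 mulr_gt0 ?pi_gt0.
by rewrite -ler_pdivlMr// div1r central_binom_le.
Qed.

(** [central_binom_ge] gives the square root of this quotient, which exceeds the quotient because
    the latter is at most 1. *)
Lemma binom_ratio_ge x : 0 < x -> x / (x + 2^-1) <= binom_ratio x.
Proof.
move=> x0; have y0 : 0 < x + 2^-1 by rewrite addr_gt0// invr_gt0.
have q0 : 0 < Num.sqrt (pi * x) by rewrite sqrtr_gt0 mulr_gt0 ?pi_gt0.
apply: (@le_trans _ _ ((Num.sqrt (pi * (x + 2^-1)))^-1 * Num.sqrt (pi * x))); last first.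
  by rewrite ler_pM2r// central_binom_ge.
rewrite !sqrtrM ?pi_ge0// invfM mulrACA mulVf ?mul1r; last by rewrite gt_eqF// sqrtr_gt0 pi_gt0.
have -> : (Num.sqrt (x + 2^-1))^-1 * Num.sqrt x = Num.sqrt (x / (x + 2^-1)).
  by rewrite mulrC sqrtrM ?ltW// sqrtrV ?ltW.
have r0 : 0 < x / (x + 2^-1) by rewrite divr_gt0.
have r1 : x / (x + 2^-1) <= 1 by rewrite ler_pdivrMr// mul1r lerDl invr_ge0.
move: (x / _) r0 r1 => r r0 r1.
have h : r ^+ 2 <= r by rewrite expr2; apply: ler_piMr => //; exact: ltW.
by apply: le_trans (ler_wsqrtr h); rewrite sqrtr_sqr ler_norm.
Qed.

Lemma binom_ratio_cvg (y : R) : 0 < y -> binom_ratio (y / b) @[b --> 0^'+] --> (1 : R).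
Proof.
move=> y0; apply: (@squeeze_cvgr _ _ _ _ (fun b => y / (y + b / 2)) (fun=> 1)).
- near=> b; have b0 : 0 < b by near: b; exact: nbhs_right_gt.
  have yb0 : 0 < y / b by rewrite divr_gt0.
  rewrite binom_ratio_le1// andbT; apply: le_trans (binom_ratio_ge yb0).
  rewrite le_eqVlt; apply/orP; left; apply/eqP; field.
  by rewrite !gt_eqF//= ?addr_gt0 ?mulr_gt0.
- rewrite -[X in _ --> X](@divff _ y) ?gt_eqF//.
  apply: cvgM; first exact: cvg_cst.
  apply: cvgV; first by rewrite gt_eqF.
  rewrite -[X in _ --> X]addr0; apply: cvgD; first exact: cvg_cst.
  rewrite -[X in _ --> X](mul0r 2^-1); apply: cvgMl.
  exact/cvg_at_right_filter/cvg_id.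
- exact: cvg_cst.
Unshelve. all: end_near. Qed.

Variable d : nat.
Local Notation leb := (@lebesgue_rV R d).
Local Notation S := (@simplex R d).
Local Notation O := (@open_simplex R d).
Implicit Types (s t : 'rV[R]_d) (b : R).

Lemma kappaE s b t : S s -> 0 < b -> O t ->
  kappa s b t = dirichlet_norm (kernel_alpha s b) (kernel_beta s b) *
    dirichlet_weight (kernel_alpha s b) (kernel_beta s b) 1 t.
Proof.
move=> Ss b0 Ot; rewrite /kappa -[X in dirichlet_pdf X]/(kernel_alpha s b) dirichlet_pdfE// => j.
exact/ltW/kernel_alpha_gt0.
Qed.

(** Since [kappa s (b / 2)] is a probability density, [kappa_sqr] identifies this constant with the
    squared L^2 norm of [kappa s b]. *)
Definition kernel_sq_norm s b : R :=
  dirichlet_norm (kernel_alpha s b) (kernel_beta s b) ^+ 2 /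
  dirichlet_norm (kernel_alpha s (b / 2)) (kernel_beta s (b / 2)).

(** The exponents of the kernel are [s_j / b] and [(1 - l1norm s) / b], without additive constants,
    so doubling them is the same as halving [b]. *)
Lemma kappa_sqr s b t : S s -> 0 < b -> O t ->
  kappa s b t ^+ 2 = kernel_sq_norm s b * kappa s (b / 2) t.
Proof.
move=> Ss b0 Ot; have b20 : 0 < b / 2 by rewrite divr_gt0.
rewrite !kappaE// /kernel_sq_norm exprMn.
have c0 := dirichlet_norm_gt0 (kernel_alpha_gt0 Ss b20) (kernel_beta_gt0 Ss b20).
rewrite mulrA divfK ?gt_eqF//; congr (_ * _).
have pp (y x : R) : pos_pow (y / b + 1) x ^+ 2 = pos_pow (y / (b / 2) + 1) x.
  rewrite /pos_pow; case: ifPn => _; last by rewrite expr0n.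
  have yb : y / b + y / b = y / (b / 2) by field; rewrite gt_eqF.
  by rewrite expr2 -expRD !addrK -mulrDl yb.
rewrite /dirichlet_weight exprMn -prodrXl; congr (_ * _); last exact: pp.
by apply: eq_bigr => j _; rewrite !kernel_alphaE pp.
Qed.

Lemma Gamma_shift (x : R) n : 0 < x -> Gamma (x + n%:R) = \prod_(i < n) (x + i%:R) * Gamma x.
Proof.
move=> x0; elim: n => [|n IH]; first by rewrite big_ord0 addr0 mul1r.
have xn0 : 0 < x + n%:R by apply: ltr_wpDr.
by rewrite -natr1 addrA (GammaS xn0) IH big_ord_recr /= mulrCA mulrA.
Qed.

(** The quotient of [b^(d/2) * kernel_sq_norm s b] by [psi0 s]. Each factor of the product over [i]
    tends to 1/2, which [2 ^+ d] compensates, and every binomial ratio tends to 1. *)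
Definition sq_norm_ratio s b : R :=
  2 ^+ d * \prod_(i < d) ((1 + b * (1 + i%:R)) ^+ 2 / (2 + b * (1 + i%:R))) *
  (binom_ratio ((1 - l1norm s) / b) * \prod_j binom_ratio (s ord0 j / b)) / binom_ratio b^-1.

Lemma psi0E s : O s -> psi0 s =
  (Num.sqrt ((4 * pi) ^+ d * (1 - l1norm s) * \prod_(j < d) s ord0 j))^-1.
Proof.
move=> [s01 s1]; rewrite /psi0 powRN powR12_sqrt//.
apply: mulr_ge0; last by apply: prodr_ge0 => j _; have /andP[/ltW] := s01 j.
apply: mulr_ge0; first by apply: exprn_ge0; apply: mulr_ge0 => //; exact: pi_ge0.
by rewrite subr_ge0 ltW.
Qed.

Lemma central_binom_ratio (y b : R) : 0 < y -> 0 < b ->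
  central_binom (y / b) = binom_ratio (y / b) * Num.sqrt b / Num.sqrt (pi * y).
Proof.
move=> y0 b0; rewrite /binom_ratio.
have p0 : 0 < Num.sqrt (pi * y) by rewrite sqrtr_gt0 mulr_gt0 ?pi_gt0.
have q0 : 0 < Num.sqrt b by rewrite sqrtr_gt0.
have -> : Num.sqrt (pi * (y / b)) = Num.sqrt (pi * y) / Num.sqrt b.
  by rewrite mulrA sqrtrM ?sqrtrV ?ltW ?mulr_gt0 ?pi_gt0.
by field; rewrite !gt_eqF.
Qed.

Lemma Gamma_double (x : R) : 0 < x ->
  Gamma (2 * x + 1) = central_binom x * expR (x * ln 4) * Gamma (x + 1) ^+ 2.
Proof.
move=> x0; rewrite /central_binom.
have g0 : 0 < Gamma (x + 1) by rewrite Gamma_gt0 ?addr_gt0.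
have e0 := expR_gt0 (x * ln 4).
by rewrite -mulrA divfK// gt_eqF// mulr_gt0// exprn_gt0.
Qed.

Local Opaque central_binom.

(** [N] is a variable of its own so that the formula serves both [b] and [b / 2], with [N] and
    [2 * N]. *)
Lemma dirichlet_norm_kernel s b (N : R) : S s -> 0 < b -> b^-1 = N ->
  dirichlet_norm (kernel_alpha s b) (kernel_beta s b) =
  Gamma (N + 1 + d%:R) / (Gamma (N * (1 - l1norm s) + 1) * \prod_j Gamma (N * s ord0 j + 1)).
Proof.
move=> Ss b0 bN; rewrite /dirichlet_norm (kernel_sum Ss b0) /kernel_beta -bN.
have -> : (1 + b * (d%:R + 1)) / b = b^-1 + 1 + d%:R by field; rewrite gt_eqF.
rewrite [(1 - _) / b]mulrC.
have -> : \prod_j Gamma (kernel_alpha s b ord0 j) = \prod_j Gamma (b^-1 * s ord0 j + 1).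
  by apply: eq_bigr => j _; rewrite kernel_alphaE mulrC.
by [].
Qed.

Lemma prod_Gamma_double (I : finType) (f : I -> R) (G : R) : (forall i, 0 < f i) ->
  \prod_i Gamma (f i + 1) = G ->
  \prod_i Gamma (2 * f i + 1) =
  \prod_i central_binom (f i) * \prod_i expR (f i * ln 4) * G ^+ 2.
Proof.
move=> f0 <-.
transitivity (\prod_i (central_binom (f i) * expR (f i * ln 4) * Gamma (f i + 1) ^+ 2)).
  by apply: eq_bigr => i _; exact: Gamma_double.
by rewrite big_split big_split prodrXl.
Qed.

(** At [b / 2] the Gamma arguments are [2 y + 1] where at [b] they are [y + 1]; [Gamma_double] turns
    each quotient into a central binomial. The shift by [d] in the numerators leaves the rational
    product. *)
Lemma kernel_sq_norm_central_binom s b : O s -> 0 < b ->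
  kernel_sq_norm s b =
  \prod_(i < d) ((b^-1 + 1 + i%:R) ^+ 2 / (2 * b^-1 + 1 + i%:R)) *
  (central_binom ((1 - l1norm s) / b) * \prod_j central_binom (s ord0 j / b)) / central_binom b^-1.
Proof.
move=> Os b0; have [s01 s1] := Os; have Ss := open_simplex_sub Os.
have b20 : 0 < b / 2 by rewrite divr_gt0.
have s0 j : 0 < s ord0 j by have /andP[] := s01 j.
have r0 : 0 < 1 - l1norm s by rewrite subr_gt0.
have [N NE] : exists N, N = b^-1 by eexists.
have N0 : 0 < N by rewrite NE invr_gt0.
have N2 : (b / 2)^-1 = 2 * N by rewrite invf_div NE.
rewrite -[(1 - l1norm s) / b]mulrC -NE.
have -> : \prod_j central_binom (s ord0 j * N) = \prod_j central_binom (N * s ord0 j).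
  by apply: eq_bigr => j _; rewrite mulrC.
have Nr0 : 0 < N * (1 - l1norm s) by rewrite mulr_gt0.
have Ns0 j : 0 < N * s ord0 j by rewrite mulr_gt0.
have [G GE] : exists G, \prod_j Gamma (N * s ord0 j + 1) = G by eexists.
have G0 : 0 < G by rewrite -GE; apply: prodr_gt0 => j _; apply: Gamma_gt0; rewrite addr_gt0.
have [p1 p1E] : exists p, \prod_(i < d) (N + 1 + i%:R) = p by eexists.
have [p2 p2E] : exists p, \prod_(i < d) (2 * N + 1 + i%:R) = p by eexists.
have p20 : 0 < p2 by rewrite -p2E; apply: prodr_gt0 => i _; rewrite ltr_wpDr// addr_gt0// mulr_gt0.
have n1 : dirichlet_norm (kernel_alpha s b) (kernel_beta s b) =
    p1 * Gamma (N + 1) / (Gamma (N * (1 - l1norm s) + 1) * G).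
  by rewrite (dirichlet_norm_kernel Ss b0 (esym NE)) GE Gamma_shift ?addr_gt0// p1E.
have [cs csE] : exists c, \prod_j central_binom (N * s ord0 j) = c by eexists.
have cs0 : 0 < cs by rewrite -csE; apply: prodr_gt0 => j _; exact: central_binom_gt0.
have [e eE] : exists c, \prod_j expR (N * s ord0 j * ln 4) = c by eexists.
have e0 : 0 < e by rewrite -eE; apply: prodr_gt0 => j _; exact: expR_gt0.
have n2 : dirichlet_norm (kernel_alpha s (b / 2)) (kernel_beta s (b / 2)) =
    p2 * Gamma (2 * N + 1) / (Gamma (2 * (N * (1 - l1norm s)) + 1) * (cs * e * G ^+ 2)).
  rewrite (dirichlet_norm_kernel Ss b20 N2) Gamma_shift ?addr_gt0 ?mulr_gt0// p2E.
  have gd : \prod_j Gamma (2 * (N * s ord0 j) + 1) = cs * e * G ^+ 2.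
    by rewrite (prod_Gamma_double Ns0 GE) -csE -eE.
  have -> : \prod_j Gamma (2 * N * s ord0 j + 1) = \prod_j Gamma (2 * (N * s ord0 j) + 1).
    by apply: eq_bigr => j _; rewrite mulrA.
  by rewrite gd -[2 * N * (1 - _)]mulrA.
(* The powers of 4 cancel because the barycentric coordinates of [s] sum to 1. *)
have E4 : expR (N * ln 4) = expR (N * (1 - l1norm s) * ln 4) * e.
  rewrite -eE -expR_sum -expRD; congr expR.
  rewrite -mulr_suml -mulr_sumr -mulrDl -mulrDr -l1norm_ge0E ?subrK ?mulr1// => j.
  exact: ltW.
rewrite /kernel_sq_norm n1 n2 (Gamma_double N0) (Gamma_double Nr0) E4 csE.
have -> : \prod_(i < d) ((N + 1 + i%:R) ^+ 2 / (2 * N + 1 + i%:R)) = p1 ^+ 2 / p2.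
  by rewrite prodf_div prodrXl p1E p2E.
have := expR_gt0 (N * (1 - l1norm s) * ln 4).
have := central_binom_gt0 Nr0.
have : 0 < Gamma (N * (1 - l1norm s) + 1) by rewrite Gamma_gt0// addr_gt0.
have : 0 < Gamma (N + 1) by rewrite Gamma_gt0// addr_gt0.
have := central_binom_gt0 N0.
clear -p20 G0 cs0 e0.
move: (central_binom (N * (1 - l1norm s))) (Gamma (N * (1 - l1norm s) + 1)) (expR _) => x1 x2 x3.
move: (central_binom N) (Gamma (N + 1)) => x4 x5 *.
by field; rewrite !gt_eqF.
Qed.

Lemma powR_half_nat (b : R) n : 0 < b -> b `^ (n%:R / 2) = Num.sqrt b ^+ n.
Proof.
by move=> b0; rewrite mulrC powRrM powR12_sqrt ?ltW// powR_mulrn// sqrtr_ge0.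
Qed.

Lemma sqrtrX (x : R) n : 0 <= x -> Num.sqrt (x ^+ n) = Num.sqrt x ^+ n.
Proof.
move=> x0; elim: n => [|n IH]; first by rewrite !expr0 sqrtr1.
by rewrite !exprS sqrtrM// IH.
Qed.

Lemma sqrtr_prod (I : finType) (F : I -> R) : (forall i, 0 <= F i) ->
  \prod_i Num.sqrt (F i) = Num.sqrt (\prod_i F i).
Proof.
move=> F0; suff [] : 0 <= \prod_i F i /\ \prod_i Num.sqrt (F i) = Num.sqrt (\prod_i F i) by [].
apply: (big_ind2 (fun x y => 0 <= x /\ y = Num.sqrt x)).
- by rewrite sqrtr1.
- by move=> x1 y1 x2 y2 [x0 ->] [x20 ->]; split; [exact: mulr_ge0 | rewrite sqrtrM].
- by move=> i _.
Qed.

(** Power count: [d + 1] central binomials above and one below give [b^(d/2)], the rational product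
    gives [b^(-d)], and the net order [b^(-d/2)] is removed by the prefactor. *)
Lemma kernel_sq_normE s b : O s -> 0 < b ->
  b `^ (d%:R / 2) * kernel_sq_norm s b = psi0 s * sq_norm_ratio s b.
Proof.
move=> Os b0; have [s01 s1] := Os.
have s0 j : 0 < s ord0 j by have /andP[] := s01 j.
have r0 : 0 < 1 - l1norm s by rewrite subr_gt0.
have P0 : 0 <= \prod_j s ord0 j by apply: prodr_ge0 => j _; exact: ltW.
rewrite (psi0E Os).
rewrite powR_half_nat// kernel_sq_norm_central_binom//.
have cj : \prod_j central_binom (s ord0 j / b) = \prod_j binom_ratio (s ord0 j / b) * Num.sqrt b ^+ d /
    (Num.sqrt pi ^+ d * Num.sqrt (\prod_j s ord0 j)).
  rewrite -sqrtr_prod; last by move=> j; exact: ltW.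
  have -> : Num.sqrt b ^+ d = \prod_(j < d) Num.sqrt b by rewrite prodr_const card_ord.
  have -> : Num.sqrt pi ^+ d = \prod_(j < d) Num.sqrt pi :> R by rewrite prodr_const card_ord.
  rewrite -!big_split -prodf_div; apply: eq_bigr => j _.
  by rewrite central_binom_ratio// [Num.sqrt (pi * _)]sqrtrM// pi_ge0.
have c1 := central_binom_ratio (@ltr01 R) b0; rewrite div1r mulr1 in c1.
rewrite c1 cj (central_binom_ratio r0 b0).
have pE : \prod_(i < d) ((b^-1 + 1 + i%:R) ^+ 2 / (2 * b^-1 + 1 + i%:R)) =
   \prod_(i < d) ((1 + b * (1 + i%:R)) ^+ 2 / (2 + b * (1 + i%:R))) / b ^+ d.
  have -> : b ^+ d = \prod_(i < d) b by rewrite prodr_const card_ord.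
  rewrite -prodf_div; apply: eq_bigr => i _.
  have h0 : 0 <= b * i%:R by rewrite mulr_ge0// ltW.
  have h1 : b^-1 + 1 + i%:R = (1 + b * (1 + i%:R)) / b by field; rewrite gt_eqF.
  have h2 : 2 * b^-1 + 1 + i%:R = (2 + b * (1 + i%:R)) / b by field; rewrite gt_eqF.
  have z0 : 0 < 2 + b * (1 + i%:R) by rewrite ltr_wpDr// mulr_ge0// ltW.
  rewrite h1 h2; move: (1 + b * _) (2 + b * _) z0 => y z z0.
  by field; rewrite !gt_eqF.
rewrite pE /sq_norm_ratio.
have bb : b = Num.sqrt b ^+ 2 by rewrite sqr_sqrtr// ltW.
have q0 : 0 < Num.sqrt b by rewrite sqrtr_gt0.
have p0 : 0 < Num.sqrt pi :> R by rewrite sqrtr_gt0 pi_gt0.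
have : 0 < Num.sqrt (\prod_j s ord0 j) by rewrite sqrtr_gt0; apply: prodr_gt0 => j _.
have : 0 < Num.sqrt (1 - l1norm s) by rewrite sqrtr_gt0.
have : 0 < binom_ratio b^-1 by rewrite binom_ratio_gt0 ?invr_gt0.
have E4 : Num.sqrt 4 = 2 :> R.
  by rewrite (_ : 4 = 2 ^+ 2) ?sqrtr_sqr ?ger0_norm// expr2 -natrM.
have fp0 : 0 <= 4 * pi :> R by rewrite mulr_ge0 ?pi_ge0.
have A0 : 0 <= (4 * pi) ^+ d :> R by exact: exprn_ge0.
have -> : Num.sqrt ((4 * pi) ^+ d * (1 - l1norm s) * \prod_j s ord0 j) =
    (2 * Num.sqrt pi) ^+ d * Num.sqrt (1 - l1norm s) * Num.sqrt (\prod_j s ord0 j).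
  rewrite sqrtrM; last by apply: mulr_ge0 => //; exact: ltW.
  by rewrite sqrtrM// sqrtrX// sqrtrM// E4.
rewrite [Num.sqrt (pi * (1 - _))]sqrtrM ?pi_ge0//.
have -> : b ^+ d = Num.sqrt b ^+ d * Num.sqrt b ^+ d by rewrite -exprMn -expr2 -bb.
rewrite exprMn.
have := exprn_gt0 d q0; have := exprn_gt0 d p0.
move: (binom_ratio ((1 - l1norm s) / b)) (binom_ratio b^-1) (\prod_j binom_ratio (s ord0 j / b)).
move: (\prod_(i < d) ((1 + b * (1 + i%:R)) ^+ 2 / (2 + b * (1 + i%:R)))).
move: q0 p0; move: (Num.sqrt b ^+ d) (Num.sqrt pi ^+ d); move: (Num.sqrt b) (Num.sqrt pi).
move: (Num.sqrt (1 - l1norm s)) (Num.sqrt (\prod_j s ord0 j)) => *.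
have t0 : 0 < (2:R) ^+ d by rewrite exprn_gt0.
by field; rewrite !gt_eqF.
Qed.

Lemma sq_norm_ratio_ge0 s b : O s -> 0 < b -> 0 <= sq_norm_ratio s b.
Proof.
move=> Os b0; have [s01 s1] := Os.
apply: divr_ge0; last by apply/ltW/binom_ratio_gt0; rewrite invr_gt0.
have dd (i : nat) : 0 <= b * (1 + i%:R) by rewrite mulr_ge0 ?ltW.
apply: mulr_ge0.
  apply: mulr_ge0; first exact: exprn_ge0.
  by apply: prodr_ge0 => i _; rewrite divr_ge0 ?sqr_ge0 ?addr_ge0.
apply: mulr_ge0; first by apply/ltW/binom_ratio_gt0; rewrite divr_gt0// subr_gt0.
by apply: prodr_ge0 => j _; apply/ltW/binom_ratio_gt0; rewrite divr_gt0//; have /andP[] := s01 j.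
Qed.

Lemma prod_le1 (I : finType) (F : I -> R) : (forall i, 0 <= F i <= 1) -> \prod_i F i <= 1.
Proof.
move=> h; have : \prod_i F i <= \prod_(i : I) 1 by apply: ler_prod => i _; exact: h.
by rewrite big1_eq.
Qed.

(** The bound does not depend on [s], so [psi0] dominates. The factor 2 bounds the inverse of
    [binom_ratio b^-1], using [b <= 1]; [(d + 2)^2] bounds each rational factor; the other ratios
    are at most 1. *)
Lemma sq_norm_ratio_le s b : O s -> 0 < b <= 1 ->
  sq_norm_ratio s b <= 2 * 2 ^+ d * (d%:R + 2) ^+ (2 * d).
Proof.
move=> Os /andP[b0 b1]; have [s01 s1] := Os.
have dd (i : nat) : 0 <= b * (1 + i%:R) by rewrite mulr_ge0 ?ltW.
have u0 : 0 < binom_ratio b^-1 by apply: binom_ratio_gt0; rewrite invr_gt0.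
have u2 : (binom_ratio b^-1)^-1 <= 2.
  rewrite -[X in _ <= X]invrK lef_pV2 ?posrE ?invr_gt0//.
  have bi0 : 0 < b^-1 by rewrite invr_gt0.
  apply: le_trans (binom_ratio_ge bi0).
  have bi1 : 1 <= b^-1 by rewrite invf_ge1.
  rewrite ler_pdivlMr ?addr_gt0 ?invr_gt0//.
  by lra.
have h1 : \prod_(i < d) ((1 + b * (1 + i%:R)) ^+ 2 / (2 + b * (1 + i%:R))) <= (d%:R + 2) ^+ (2 * d).
  rewrite exprM -[X in _ ^+ X]card_ord -prodr_const; apply: ler_prod => i _.
  rewrite divr_ge0 ?sqr_ge0 ?addr_ge0//=.
  rewrite ler_pdivrMr ?ltr_wpDr//.
  have : b * (1 + i%:R) <= d%:R + 1.
    apply: (@le_trans _ _ (1 * (1 + i%:R))); first by rewrite ler_wpM2r.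
    rewrite mul1r addrC lerD2r ler_nat; exact/ltnW.
  have := dd i; move: (b * _) => z z0 zd.
  apply: (@le_trans _ _ ((d%:R + 2) ^+ 2)).
    by rewrite ler_sqr ?nnegrE ?addr_ge0//; lra.
  by rewrite ler_peMr ?sqr_ge0//; lra.
have h2 : binom_ratio ((1 - l1norm s) / b) * \prod_j binom_ratio (s ord0 j / b) <= 1.
  rewrite -[X in _ <= X]mulr1; apply: ler_pM.
  - by apply/ltW/binom_ratio_gt0; rewrite divr_gt0// subr_gt0.
  - by apply: prodr_ge0 => j _; apply/ltW/binom_ratio_gt0; rewrite divr_gt0//; have /andP[] := s01 j.
  - by apply/binom_ratio_le1; rewrite divr_gt0// subr_gt0.
  - apply: prod_le1 => j; have sj : 0 < s ord0 j / b by rewrite divr_gt0//; have /andP[] := s01 j.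
    by rewrite binom_ratio_le1// andbT ltW// binom_ratio_gt0.
have P0 : 0 <= \prod_(i < d) ((1 + b * (1 + i%:R)) ^+ 2 / (2 + b * (1 + i%:R))).
  by apply: prodr_ge0 => i _; rewrite divr_ge0 ?sqr_ge0 ?addr_ge0.
have U0 : 0 <= binom_ratio ((1 - l1norm s) / b) * \prod_j binom_ratio (s ord0 j / b).
  apply: mulr_ge0; first by apply/ltW/binom_ratio_gt0; rewrite divr_gt0// subr_gt0.
  by apply: prodr_ge0 => j _; apply/ltW/binom_ratio_gt0; rewrite divr_gt0//; have /andP[] := s01 j.
have v0 : 0 <= (binom_ratio b^-1)^-1 by rewrite invr_ge0 ltW.
rewrite /sq_norm_ratio; move: (\prod_(i < d) _) (binom_ratio _ * _) (binom_ratio b^-1)^-1 h1 h2 u2 P0 U0 v0.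
move=> P U v PD U1 v2 P0 U0 v0.
have t0 : 0 <= (2:R) ^+ d by exact: exprn_ge0.
rewrite [2 * 2 ^+ d]mulrC -!mulrA; apply: ler_pM => //; first by rewrite !mulr_ge0.
rewrite mulrA mulrC; apply: ler_pM => //; first exact: mulr_ge0.
by rewrite -[X in _ <= X]mulr1; apply: ler_pM.
Qed.

Lemma cvg_prod_seq (I : Type) (r : seq I) (T : Type) (F : set_system T) (FF : Filter F)
  (f : I -> T -> R) (l : I -> R) :
  (forall i, f i x @[x --> F] --> l i) -> \prod_(i <- r) f i x @[x --> F] --> \prod_(i <- r) l i.
Proof.
move=> h; elim: r => [|i r IH].
  by under eq_fun do rewrite big_nil; rewrite big_nil; exact: cvg_cst.
by under eq_fun do rewrite big_cons; rewrite big_cons; apply: cvgM.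
Qed.

Lemma sq_norm_ratio_cvg s : O s -> sq_norm_ratio s b @[b --> 0^'+] --> (1 : R).
Proof.
move=> Os; have [s01 s1] := Os.
have idb : (fun b : R => b) @ 0^'+ --> (0:R) by exact/cvg_at_right_filter/cvg_id.
have e : (1:R) = 2 ^+ d * \prod_(i < d) (1 ^+ 2 / 2) * (1 * \prod_(j < d) 1) / 1.
  have -> : 2 ^+ d * \prod_(i < d) (1 ^+ 2 / 2) = 1 :> R.
    by rewrite prodr_const card_ord -exprMn expr1n div1r divff ?expr1n// pnatr_eq0.
  by rewrite big1_eq !mulr1 divr1.
rewrite [X in _ --> X]e; apply: cvgM; first apply: cvgM; first apply: cvgM.
- exact: cvg_cst.
- apply: cvg_prod_seq => i.
  have h (c : R) : c + b * (1 + i%:R) @[b --> 0^'+] --> c.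
    rewrite -[X in _ --> X]addr0; apply: cvgD; first exact: cvg_cst.
    by rewrite -[X in _ --> X](mul0r (1 + i%:R)); apply: cvgMl.
  apply: cvgM; first by rewrite expr2; under eq_fun do rewrite expr2; apply: cvgM; exact: h.
  by apply: cvgV => //; exact: h.
- apply: cvgM; first by apply: binom_ratio_cvg; rewrite subr_gt0.
  by apply: cvg_prod_seq => j; apply: binom_ratio_cvg; have /andP[] := s01 j.
- apply: cvgV => //.
  by under eq_fun do rewrite -[_^-1]mul1r; exact: binom_ratio_cvg.
Qed.

End kernel_square.

Lemma cvg_sumr (R : realType) (I : Type) (r : seq I) (T : Type) (F : set_system T) (FF : Filter F)
  (f : I -> T -> R) (l : I -> R) :
  (forall i, f i x @[x --> F] --> l i) -> \sum_(i <- r) f i x @[x --> F] --> \sum_(i <- r) l i.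
Proof.
move=> h; elim: r => [|i r IH].
  by under eq_fun do rewrite big_nil; rewrite big_nil; exact: cvg_cst.
by under eq_fun do rewrite big_cons; rewrite big_cons; apply: cvgD.
Qed.

(** * Concentration of the kernel around the smoothing point *)

Section kernel_concentration.
Context {R : realType} (d : nat).
Local Notation leb := (@lebesgue_rV R d).
Local Notation S := (@simplex R d).
Local Notation O := (@open_simplex R d).
Local Notation D := (d%:R + 1 : R).
Implicit Types (s t : 'rV[R]_d) (b : R).

Definition sqdist s t : R := \sum_j (t ord0 j - s ord0 j) ^+ 2.

Lemma sqdist_ge0 s t : 0 <= sqdist s t.
Proof. by apply: sumr_ge0 => j _; exact: sqr_ge0. Qed.

Lemma bm_sub_coord s j : bounded_measurable (fun t => t ord0 j - s ord0 j).
Proof.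
apply: (@bmD _ _ (fun t => t ord0 j) (fun=> - s ord0 j)); first exact: bm_coord.
exact: bm_cst.
Qed.

Lemma bm_sqdist s : bounded_measurable (sqdist s).
Proof. by apply: bm_sum => j; apply: bmX; exact: bm_sub_coord. Qed.

Lemma kernel_mean_bias_le s b j : S s -> 0 < b ->
  `|kernel_mean s b (fun t => t ord0 j - s ord0 j)| <= D * b.
Proof.
move=> Ss b0; have /andP[s0 s1] := simplex_coord01 Ss j.
have D1 : 1 <= D by rewrite lerDr.
have q1 : 1 <= 1 + b * D by rewrite lerDl mulr_ge0// ltW.
rewrite kernel_mean_bias// !normrM normfV (gtr0_norm b0) (ger0_norm (le_trans ler01 q1)).
rewrite ler_pdivrMr ?(lt_le_trans ltr01)//.
apply: (@le_trans _ _ (D * b)); last by rewrite ler_peMr// mulr_ge0// ltW.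
rewrite mulrC; apply: ler_wpM2r; first exact: ltW.
have h0 : 0 <= D * s ord0 j by rewrite mulr_ge0// (le_trans ler01).
have h1 : D * s ord0 j <= D by rewrite ler_piMr// (le_trans ler01).
by rewrite ler_norml; apply/andP; split; lra.
Qed.

(** Per coordinate, the second moment divided by [b] is at most [1], from [s_j (1 - s_j)], plus
    [D (D + 1) + 2], from the term of next order. *)
Definition sqdist_const : R := d%:R * (D * (D + 1) + 3).

Lemma kernel_mean_sqdist_le s b : S s -> 0 < b <= 1 ->
  kernel_mean s b (sqdist s) <= sqdist_const * b.
Proof.
move=> Ss /andP[b0 b1].
rewrite /kernel_mean /sqdist mean_sum; last 3 first.
- exact: kernel_alpha_gt0.
- exact: kernel_beta_gt0.
- by move=> j; apply: bmX; exact: bm_sub_coord.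
rewrite /sqdist_const -mulrA -[d in d%:R * (_ * b)](card_ord d) mulr_natl -sumr_const.
apply: ler_sum => j _; have /andP[s0 s1] := simplex_coord01 Ss j.
have -> : dirichlet_mean (kernel_alpha s b) (kernel_beta s b) (fun t => (t ord0 j - s ord0 j) ^+ 2) =
    kernel_mean s b (fun t => (t ord0 j - s ord0 j) * (t ord0 j - s ord0 j)).
  by apply: eq_mean => t _; rewrite expr2.
rewrite kernel_mean_cov// eqxx/=.
have D0 : 0 <= (d%:R : R) by [].
move: (d%:R : R) D0 (s ord0 j) s0 s1 => e e0 x x0 x1.
have q0 : 0 <= b * (e + 1) by rewrite mulr_ge0 ?addr_ge0// ltW.
have q1 : 1 <= (1 + b * (e + 1)) * (1 + b * (e + 1 + 1)).
  rewrite -[X in X <= _]mulr1; apply: ler_pM => //; rewrite lerDl ?mulr_ge0 ?addr_ge0// ltW//.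
rewrite ler_pdivrMr ?(lt_le_trans ltr01)//.
apply: (@le_trans _ _ (((e + 1) * (e + 1 + 1) + 3) * b)); last first.
  by rewrite ler_peMr// mulr_ge0 ?addr_ge0 ?mulr_ge0 ?addr_ge0// ltW.
rewrite mulrC; apply: ler_wpM2r; first exact: ltW.
have xx1 : x * x <= 1 by rewrite mulr_ile1.
have xx0 : 0 <= x * x by rewrite mulr_ge0.
have h1 : x * (1 - x) <= 1 by nra.
have h2 : b * (x * x * (e + 1) * (e + 1 + 1) - (x + x) * (e + 1 + 1) + 1 + 1) <= (e + 1) * (e + 1 + 1) + 2.
  have z1 : x * x * (e + 1) * (e + 1 + 1) - (x + x) * (e + 1 + 1) + 1 + 1 <= (e + 1) * (e + 1 + 1) + 2.
    have : x * x * ((e + 1) * (e + 1 + 1)) <= 1 * ((e + 1) * (e + 1 + 1)).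
      by rewrite ler_wpM2r// mulr_ge0 ?addr_ge0.
    have : 0 <= (x + x) * (e + 1 + 1) by rewrite mulr_ge0 ?addr_ge0.
    by lra.
  have z2 : 0 <= (e + 1) * (e + 1 + 1) + 2 by rewrite addr_ge0 ?mulr_ge0 ?addr_ge0.
  apply: (@le_trans _ _ (b * ((e + 1) * (e + 1 + 1) + 2))); first by rewrite ler_wpM2l// ltW.
  by rewrite ler_piMl.
by lra.
Qed.

(** Cauchy-Schwarz against the constant vector; [h] is Lagrange's identity. *)
Lemma sqr_sum_le (a : 'I_d -> R) : (\sum_j a j) ^+ 2 <= d%:R * \sum_j a j ^+ 2.
Proof.
have h : \sum_j \sum_k (a j - a k) ^+ 2 = 2 * (d%:R * \sum_j a j ^+ 2 - (\sum_j a j) ^+ 2).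
  transitivity (\sum_j (d%:R * a j ^+ 2 + \sum_k a k ^+ 2 - 2 * a j * \sum_k a k)).
    apply: eq_bigr => j _.
    transitivity (\sum_k (a j ^+ 2 + a k ^+ 2 - 2 * a j * a k)).
      by apply: eq_bigr => k _; ring.
    rewrite big_split/= big_split/= sumr_const card_ord sumrN -mulr_sumr.
    by rewrite [d%:R * _]mulr_natl.
  rewrite big_split/= big_split/= sumrN -mulr_suml -!mulr_sumr sumr_const card_ord.
  by rewrite -[_ *+ d]mulr_natl; ring.
have : 0 <= \sum_j \sum_k (a j - a k) ^+ 2.
  by apply: sumr_ge0 => j _; apply: sumr_ge0 => k _; exact: sqr_ge0.
by rewrite h pmulr_rge0// subr_ge0.
Qed.

Lemma sqdist_sqr_le s t : sqdist s t ^+ 2 <= d%:R * \sum_j (t ord0 j - s ord0 j) ^+ 4.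
Proof.
apply: le_trans (sqr_sum_le _) _; rewrite le_eqVlt; apply/orP; left; apply/eqP.
by congr (_ * _); apply: eq_bigr => j _; rewrite -exprM.
Qed.

Let id0 : (fun b : R => b) @ 0^'+ --> (0 : R).
Proof. exact/cvg_at_right_filter/cvg_id. Qed.

Let cvg_affine (c e : R) : c + b * e @[b --> 0^'+] --> c.
Proof.
rewrite -[X in _ --> X]addr0; apply: cvgD; first exact: cvg_cst.
by rewrite -[X in _ --> X](mul0r e); apply: cvgMl; exact: id0.
Qed.

Lemma kernel_mean_bias_cvg s j : S s ->
  kernel_mean s b (fun t => t ord0 j - s ord0 j) / b @[b --> 0^'+] --> 1 - D * s ord0 j.
Proof.
move=> Ss; have : (1 - D * s ord0 j) / (1 + b * D) @[b --> 0^'+] --> (1 - D * s ord0 j) / 1.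
  by apply: cvgM; [exact: cvg_cst | apply: cvgV => //; exact: cvg_affine].
rewrite divr1; apply: cvg_trans; apply: near_eq_cvg; near=> b.
have b0 : 0 < b by near: b; exact: nbhs_right_gt.
have q0 : 0 < 1 + b * D by rewrite addr_gt0// mulr_gt0// ltr_wpDl.
by rewrite kernel_mean_bias//; field; rewrite !gt_eqF.
Unshelve. all: end_near. Qed.

Lemma kernel_mean_cov_cvg s j k : S s ->
  kernel_mean s b (fun t => (t ord0 j - s ord0 j) * (t ord0 k - s ord0 k)) / b @[b --> 0^'+] -->
  s ord0 j * ((j == k)%:R - s ord0 k).
Proof.
move=> Ss; set u := s ord0 j * _.
pose w := s ord0 j * s ord0 k * D * (D + 1) - (s ord0 j + s ord0 k) * (D + 1) + 1 + (j == k)%:R.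
have : (u + b * w) / ((1 + b * D) * (1 + b * (D + 1))) @[b --> 0^'+] --> u / (1 * 1).
  apply: cvgM; first exact: cvg_affine.
  by apply: cvgV; [rewrite mulr1 | apply: cvgM; exact: cvg_affine].
rewrite mulr1 divr1; apply: cvg_trans; apply: near_eq_cvg; near=> b.
have b0 : 0 < b by near: b; exact: nbhs_right_gt.
have q0 : 0 < 1 + b * D by rewrite addr_gt0// mulr_gt0// ltr_wpDl.
have q1 : 0 < 1 + b * (D + 1) by rewrite addr_gt0// mulr_gt0// ltr_wpDl.
rewrite kernel_mean_cov// -/w -/u; move: q0 q1; move: (1 + b * D) (1 + b * (D + 1)) => x y x0 y0.
by field; rewrite !gt_eqF.
Unshelve. all: end_near. Qed.

(** Controls the Taylor remainder far from [s]: beyond distance [r], [sqdist] is at most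
    [sqdist ^+ 2 / r ^+ 2], whose mean is therefore [o(b)]. *)
Lemma kernel_mean_sqdist2_cvg s : S s ->
  kernel_mean s b (fun t => sqdist s t ^+ 2) / b @[b --> 0^'+] --> (0 : R).
Proof.
move=> Ss.
have c4 j : kernel_mean s b (fun t => (t ord0 j - s ord0 j) ^+ 4) / b @[b --> 0^'+] --> (0 : R).
  pose x := s ord0 j.
  pose z0 := 3 * x ^+ 2 - 6 * x ^+ 3 + 3 * x ^+ 4.
  pose z1 := 26 * x - 72 * x ^+ 2 - 20 * x ^+ 2 * D + 64 * x ^+ 3 + 42 * x ^+ 3 * D + 6 * x ^+ 3 * D ^+ 2
           - 18 * x ^+ 4 - 22 * x ^+ 4 * D - 6 * x ^+ 4 * D ^+ 2.
  pose z2 := 24 - 72 * x - 24 * x * D + 72 * x ^+ 2 + 60 * x ^+ 2 * D + 12 * x ^+ 2 * D ^+ 2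
           - 24 * x ^+ 3 - 44 * x ^+ 3 * D - 24 * x ^+ 3 * D ^+ 2 - 4 * x ^+ 3 * D ^+ 3
           + 6 * x ^+ 4 * D + 11 * x ^+ 4 * D ^+ 2 + 6 * x ^+ 4 * D ^+ 3 + x ^+ 4 * D ^+ 4.
  have : b * (z0 + b * z1 + b * (b * z2)) / ((1 + b * D) * (1 + b * (D + 1)) * (1 + b * (D + 2)) * (1 + b * (D + 3)))
      @[b --> 0^'+] --> 0 * (z0 + 0 * (0 * z2)) / (1 * 1 * 1 * 1).
    apply: cvgM.
      apply: cvgM; first exact: id0.
      apply: cvgD; first exact: cvg_affine.
      by apply: cvgM; [exact: id0 | apply: cvgMl; exact: id0].
    apply: cvgV; first by rewrite !mulr1.
    by apply: cvgM; [apply: cvgM; [apply: cvgM|]|]; exact: cvg_affine.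
  rewrite !mul0r; apply: cvg_trans; apply: near_eq_cvg; near=> b.
  have b0 : 0 < b by near: b; exact: nbhs_right_gt.
  have q (c : R) : 0 <= c -> 0 < 1 + b * (D + c).
    by move=> c0; rewrite addr_gt0// mulr_gt0// ltr_wpDr// ltr_wpDl.
  rewrite kernel_mean_4th// -/x -/z0 -/z1 -/z2.
  have := q 0 (lexx _); have := q 1 ler01; have := q 2 (ler0n _ _); have := q 3 (ler0n _ _).
  rewrite addr0; move: (1 + b * D) (1 + b * (D + 1)) (1 + b * (D + 2)) (1 + b * (D + 3)) z0 z1 z2.
  by move=> y0 y1 y2 y3 z0 z1 z2 *; field; rewrite !gt_eqF.
have c4s : d%:R * (\sum_j kernel_mean s b (fun t => (t ord0 j - s ord0 j) ^+ 4) / b) @[b --> 0^'+] --> (0 : R).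
  rewrite -[X in _ --> X](mulr0 d%:R); apply: cvgMr.
  rewrite [X in _ --> X](_ : 0 = \sum_(j < d) 0); last by rewrite big1.
  by apply: cvg_sumr => j; exact: c4.
apply: (@squeeze_cvgr _ _ _ _ (fun=> 0) _ _ _ _ (cvg_cst _) c4s).
near=> b; have b0 : 0 < b by near: b; exact: nbhs_right_gt.
have ka := kernel_alpha_gt0 Ss b0; have kb := kernel_beta_gt0 Ss b0.
apply/andP; split.
  rewrite /=; by apply: divr_ge0; [apply: (mean_ge0 ka kb) => t _; exact: sqr_ge0 | exact: ltW].
rewrite -mulr_suml mulrA; apply: ler_wpM2r; first by rewrite invr_ge0 ltW.
have b4 j : bounded_measurable (fun t => (t ord0 j - s ord0 j) ^+ 4) by apply: bmX; exact: bm_sub_coord.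
rewrite /kernel_mean -mean_sum// -meanZ//; last exact: bm_sum.
apply: le_mean => //.
- by apply: bmX; exact: bm_sqdist.
- by apply: bmZ; exact: bm_sum.
- by move=> t _; exact: sqdist_sqr_le.
Unshelve. all: end_near. Qed.

End kernel_concentration.

(** * Cells of a partition of the simplex *)

Section rV_topology.
Context {R : realType} (n : nat).
Implicit Types (v s t : 'rV[R]_n) (A : set 'rV[R]_n).

Lemma coord_le_norm v j : `|v ord0 j| <= `|v|.
Proof.
rewrite [X in _ <= X]/Num.norm/= mx_normrE.
exact: (le_bigmax _ (fun i : 'I_1 * 'I_n => `|v i.1 i.2|) (ord0, j)).
Qed.

Lemma norm_le_coord v e : 0 <= e -> (forall j, `|v ord0 j| <= e) -> `|v| <= e.
Proof.
move=> e0 h; rewrite [X in X <= _]/Num.norm/= mx_normrE.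
by apply: bigmax_le => // -[i j] _; rewrite /= ord1.
Qed.

Lemma norm_sqr_le_sqdist s t : `|t - s| ^+ 2 <= sqdist s t.
Proof.
rewrite -[X in _ <= X]sqr_sqrtr ?sqdist_ge0// ler_sqr ?nnegrE ?sqrtr_ge0//.
apply: norm_le_coord; first exact: sqrtr_ge0.
move=> j; rewrite !mxE -sqrtr_sqr ler_wsqrtr// /sqdist (bigD1 j)//= lerDl.
by apply: sumr_ge0 => k _; exact: sqr_ge0.
Qed.

Lemma open_measurable_rV A : open A -> measurable A.
Proof. by move=> oA; rewrite measurable_rVE; exact: sub_sigma_algebra. Qed.

Lemma closed_measurable_rV A : closed A -> measurable A.
Proof.
move=> cA; rewrite -[A]setCK; apply: measurableC; apply: open_measurable_rV.
exact: closed_openC.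
Qed.

Lemma compact_measurable_rV A : compact A -> measurable A.
Proof.
by move=> cA; apply: closed_measurable_rV; apply: compact_closed => //; exact: norm_hausdorff.
Qed.

(** Boundedness ensures that the [sup] in [diam] is a genuine supremum and not a default value. *)
Lemma diam_ge A s t : bounded_set A -> A s -> A t -> `|s - t| <= diam A.
Proof.
move=> [M [Mr hM]] As At; apply: ub_le_sup; last by exists (s, t).
have M1 : M < M + 1 by rewrite ltrDl.
exists (M + 1 + (M + 1)) => _ [[u v] [/= Au Av] <-].
by apply: (le_trans (ler_normB _ _)); apply: lerD; apply: hM.
Qed.

End rV_topology.

Section cells_theory.
Context {R : realType} (d : nat).
Hypothesis d_gt0 : (0 < d)%N.
Local Notation leb := (@lebesgue_rV R d).
Local Notation S := (@simplex R d).
Local Notation O := (@open_simplex R d).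
Implicit Types (s t : 'rV[R]_d) (b : R) (A : set 'rV[R]_d).

Lemma bm_indic A : measurable A -> bounded_measurable (\1_A : 'rV[R]_d -> R).
Proof.
move=> mA; split; first by apply: measurable_funTS; exact: measurable_indic.
by exists 1 => t _; rewrite indicE; case: (_ \in _); rewrite /= ?normr1 ?normr0.
Qed.

(** With all parameters equal to 1 the Dirichlet weight is 1 on the open simplex, so the volume is
    one of the finite Dirichlet integrals. *)
Lemma lebesgue_open_simplex_lty : (leb O < +oo)%E.
Proof.
pose a : 'rV[R]_d := const_mx 1.
have a0 j : 0 < a ord0 j by rewrite mxE.
have := integral_dirichlet_weight_open a0 (@ltr01 R).
rewrite (_ : (\int[leb]_(t in O) (dirichlet_weight a 1 1 t)%:E = leb O)%E); first by move=> ->; exact: ltry.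
transitivity (\int[leb]_(t in O) (1%:E : \bar R))%E; last first.
  by rewrite integral_cst ?mul1e//; exact: measurable_open_simplex.
apply: eq_integral => t; rewrite inE => Ot; have /open_simplexP[t0 t1] := Ot.
rewrite /dirichlet_weight pos_pow1 subr_gt0 t1 mulr1 big1// => j _.
by rewrite mxE pos_pow1 t0.
Qed.

Lemma bm_integrable_open phi : bounded_measurable phi -> leb.-integrable O (EFin \o phi).
Proof.
move=> [mphi [C hC]]; apply: measurable_bounded_integrable => //.
- exact: measurable_open_simplex.
- exact: lebesgue_open_simplex_lty.
exists C; split; first exact: num_real.
move=> M CM t Ot; apply: (le_trans (hC t Ot)); exact: ltW.
Qed.

Definition open_integral phi : R := \int[leb]_(t in O) phi t.

Lemma kappa_integrable s b : S s -> 0 < b -> leb.-integrable O (EFin \o kappa s b).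
Proof.
move=> Ss b0.
exact: integrable_dirichlet_pdf (kernel_alpha_gt0 Ss b0) (kernel_beta_gt0 Ss b0).
Qed.

Lemma kappa_ge0 s b t : S s -> 0 < b -> 0 <= kappa s b t.
Proof.
move=> Ss b0.
exact: dirichlet_pdf_ge0 (kernel_alpha_gt0 Ss b0) (kernel_beta_gt0 Ss b0).
Qed.

(** Cells may touch the boundary of the simplex. Moving the cell into an indicator over the open
    simplex makes kernel weights instances of [kernel_mean]. *)
Lemma Rintegral_cell A (h : 'rV[R]_d -> R) : measurable A -> A `<=` S ->
  measurable_fun S h -> leb.-integrable O (EFin \o h) ->
  \int[leb]_(t in A) h t = open_integral (fun t => \1_A t * h t).
Proof.
move=> mA AS mh ih.
have mf : measurable_fun S (fun t => \1_A t * h t).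
  by apply: measurable_funM => //; exact: measurable_indic.
have iAf : leb.-integrable O (EFin \o (fun t => \1_A t * h t)).
  apply: (le_integrable (@measurable_open_simplex R d) _ _ ih).
    apply/measurable_EFinP; apply: measurable_funS mf => //; first exact: measurable_simplex.
    exact: open_simplex_sub.
  move=> t _; rewrite /= lee_fin normrM indicE ler_piMl//.
  by case: (_ \in _); rewrite /= ?normr1 ?normr0.
rewrite /open_integral; have [_ <-] := Rintegral_simplex_open d_gt0 mf iAf.
rewrite [LHS]Rintegral_mkcond [RHS]Rintegral_mkcond; apply: eq_Rintegral => t _.
rewrite !patchE indicE; case: (boolP (t \in A)) => tA.
  by rewrite (_ : t \in S) ?mul1r// inE; apply: AS; rewrite -inE.
by rewrite mul0r; case: ifP.
Qed.

Lemma kernel_cell_weight A s b : measurable A -> A `<=` S -> S s -> 0 < b ->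
  \int[leb]_(t in A) kappa s b t = kernel_mean s b \1_A.
Proof.
move=> mA AS Ss b0; rewrite Rintegral_cell//; last exact: kappa_integrable.
by apply: measurable_funTS; exact: measurable_dirichlet_pdf.
Qed.

Section one_cell.
Variables (s : 'rV[R]_d) (b : R) (A : set 'rV[R]_d).
Hypotheses (Ss : S s) (b0 : 0 < b) (mA : measurable A).
(** Volume of the cell. With the names below, [kappa_sqr] makes [q * p] the integral of
    [kappa s b ^+ 2] over the cell, while [w] is that of [kappa s b]. *)
Let L := open_integral \1_A.
Let w := kernel_mean s b \1_A.
Let p := kernel_mean s (b / 2) \1_A.
Let q := kernel_sq_norm s b.

Let b20 : 0 < b / 2. Proof. by rewrite divr_gt0. Qed.

Let mO := @measurable_open_simplex R d.

Let i1 : leb.-integrable O (EFin \o (\1_A : 'rV[R]_d -> R)).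
Proof. exact/bm_integrable_open/bm_indic. Qed.

Let iw : leb.-integrable O (EFin \o (fun t => \1_A t * kappa s b t)).
Proof. exact: bm_integrable (kernel_alpha_gt0 Ss b0) (kernel_beta_gt0 Ss b0) (bm_indic mA). Qed.

Let ip : leb.-integrable O (EFin \o (fun t => \1_A t * kappa s (b / 2) t)).
Proof. exact: bm_integrable (kernel_alpha_gt0 Ss b20) (kernel_beta_gt0 Ss b20) (bm_indic mA). Qed.

Let iZ (c : R) h : leb.-integrable O (EFin \o h) -> leb.-integrable O (EFin \o (fun t => c * h t)).
Proof. by move=> ih; exact: (integrableZl mO c ih). Qed.

Lemma kernel_sq_norm_gt0 : 0 < q.
Proof.
apply: divr_gt0; first apply: exprn_gt0.
  exact: dirichlet_norm_gt0 (kernel_alpha_gt0 Ss b0) (kernel_beta_gt0 Ss b0).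
exact: dirichlet_norm_gt0 (kernel_alpha_gt0 Ss b20) (kernel_beta_gt0 Ss b20).
Qed.

Lemma cell_length_ge0 : 0 <= L.
Proof. by apply: Rintegral_ge0 => t _; rewrite indicE. Qed.

Lemma kernel_mean_indic_ge0 : 0 <= w.
Proof.
apply: (mean_ge0 (kernel_alpha_gt0 Ss b0) (kernel_beta_gt0 Ss b0)) => t _.
by rewrite indicE.
Qed.

(* Integrate [(kappa - c)^2] over the cell. *)
Lemma cell_quadratic_ge0 c : 0 <= q * p - 2 * c * w + c ^+ 2 * L.
Proof.
have -> : q * p - 2 * c * w + c ^+ 2 * L = open_integral (fun t =>
    (q * (\1_A t * kappa s (b / 2) t) + - (2 * c) * (\1_A t * kappa s b t)) + c ^+ 2 * \1_A t).
  rewrite /open_integral RintegralD//; last 2 first.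
  - exact: (@integrableD _ _ _ _ _ mO _ _ (iZ q ip) (iZ (- (2 * c)) iw)).
  - exact: iZ.
  rewrite RintegralD//; [|exact: iZ|exact: iZ].
  by rewrite !RintegralZl// mulNr.
apply: Rintegral_ge0 => t Ot.
rewrite mulrCA -(kappa_sqr Ss b0 Ot).
rewrite (_ : _ + _ + _ = \1_A t * (kappa s b t - c) ^+ 2); last by ring.
by apply: mulr_ge0; [rewrite indicE | exact: sqr_ge0].
Qed.

(** Cauchy-Schwarz, read off the quadratic polynomial in [c] at its minimizer [w / L], with the case
    of a null cell apart. *)
Lemma cell_weight_sqr_le : w ^+ 2 <= L * (q * p).
Proof.
have L0 := cell_length_ge0; have w0 := kernel_mean_indic_ge0.
have h := cell_quadratic_ge0.
have [L0'|L0'] := eqVneq L 0.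
  have [w00|w00] := eqVneq w 0; first by rewrite w00 L0' expr0n mul0r.
  (* With [L = 0] the polynomial is affine in [c]; at this [c] it would equal -1. *)
  have := h ((q * p + 1) / (2 * w)).
  rewrite L0' mulr0 addr0 (_ : 2 * ((q * p + 1) / (2 * w)) * w = q * p + 1); last by field.
  by rewrite opprD addrA subrr sub0r oppr_ge0 ler10.
have Lp : 0 < L by rewrite lt_neqAle eq_sym L0'.
have := h (w / L).
rewrite (_ : _ + _ = q * p - w ^+ 2 / L); last by field.
by rewrite subr_ge0 ler_pdivrMr// mulrC.
Qed.

(** A reverse Cauchy-Schwarz inequality: integrating the hypothesis over the cell gives
    [c * kappa s b t * L <= w] for each [t] of the cell; multiplying by [kappa s b t] and
    integrating again gives the claim. *)
Lemma cell_weight_sqr_ge c : 0 <= c ->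
  (forall t u, O t -> O u -> A t -> A u -> c * kappa s b t <= kappa s b u) ->
  c * (L * (q * p)) <= w ^+ 2.
Proof.
move=> c0 h.
have h1 t : O t -> A t -> c * kappa s b t * L <= w.
  move=> Ot At; rewrite /L /w /kernel_mean /dirichlet_mean /open_integral -RintegralZl//.
  apply: le_Rintegral => //; first exact: iZ.
  move=> u Ou; rewrite indicE; case: (boolP (u \in A)) => uA; last by rewrite mulr0 mul0r.
  by rewrite mulr1 mul1r; apply: h => //; rewrite -inE.
have -> : c * (L * (q * p)) = open_integral (fun t => (c * L * q) * (\1_A t * kappa s (b / 2) t)).
  by rewrite /open_integral RintegralZl// !mulrA.
have -> : w ^+ 2 = open_integral (fun t => w * (\1_A t * kappa s b t)).
  by rewrite /open_integral RintegralZl// expr2.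
apply: le_Rintegral => //; [exact: iZ | exact: iZ |].
move=> t Ot; rewrite indicE; case: (boolP (t \in A)) => tA; last by rewrite !mul0r !mulr0.
rewrite !mul1r -[c * L * q * _]mulrA -kappa_sqr// expr2.
rewrite (_ : c * L * _ = c * kappa s b t * L * kappa s b t); last by ring.
by apply: ler_wpM2r; [exact: kappa_ge0 | apply: h1 => //; rewrite -inE].
Qed.

End one_cell.

Section partition.
Variables (n : nat) (B : 'I_n -> set 'rV[R]_d).
Hypotheses (cB : forall i, compact (B i)) (BS : forall i, B i `<=` S)
  (disj : forall i j, i != j -> (B i)° `&` (B j)° = set0)
  (cover : \bigcup_i B i = S) (fr : forall i, leb (frontier (B i)) = 0%E).

Let mB i : measurable (B i). Proof. exact: compact_measurable_rV. Qed.

Lemma measurable_frontier i : measurable (frontier (B i)).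
Proof.
apply: measurableD.
  by apply: closed_measurable_rV; exact: closed_closure.
by apply: open_measurable_rV; exact: open_interior.
Qed.

(** A point on no frontier is interior to every cell that contains it, and interiors are disjoint.
    The frontiers together are null. *)
Lemma sum_indic_cells : exists N, [/\ measurable N, leb N = 0%E &
  forall t, S t -> ~ N t -> \sum_i \1_(B i) t = 1 :> R].
Proof.
exists (\big[setU/set0]_i frontier (B i)).
have [mN N0] : measurable (\big[setU/set0]_i frontier (B i)) /\ leb (\big[setU/set0]_i frontier (B i)) = 0%E.
  apply: (@big_ind _ (fun A => measurable A /\ leb A = 0%E)).
  - by split; [exact: measurable0 | exact: measure0].
  - move=> A1 A2 [mA1 A10] [mA2 A20]; split; first exact: measurableU.
    by rewrite measureU0.
  - by move=> j _; split; [exact: measurable_frontier | exact: fr].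
split=> // t St nN.
have int i : B i t -> (B i)° t.
  move=> Bt; apply: contrapT => nI; apply: nN; rewrite -bigcup_seq.
  by exists i; [rewrite /= mem_index_enum | split => //; exact: subset_closure].
have [i _ Bit] : (\bigcup_i B i) t by rewrite cover.
rewrite (bigD1 i)//= indicE mem_set//= big1 ?addr0// => j ji.
rewrite indicE memNset// => Bjt.
by have : ((B j)° `&` (B i)°) t; [split; exact: int | rewrite disj].
Qed.

Lemma sum_kernel_mean_cells s b phi : S s -> 0 < b -> bounded_measurable phi ->
  \sum_i kernel_mean s b (fun t => phi t * \1_(B i) t) = kernel_mean s b phi.
Proof.
move=> Ss b0 bphi.
have ka := kernel_alpha_gt0 Ss b0; have kb := kernel_beta_gt0 Ss b0.
have bi i : bounded_measurable (fun t => phi t * \1_(B i) t) by apply: bmM => //; exact: bm_indic.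
rewrite /kernel_mean -mean_sum// /dirichlet_mean /Rintegral; congr fine.
have [N [mN N0 hN]] := sum_indic_cells.
apply: ae_eq_integral.
- exact: measurable_open_simplex.
- by have /integrableP[] := bm_integrable ka kb (bm_sum bi).
- by have /integrableP[] := bm_integrable ka kb bphi.
exists N; split => // t /=; apply: contra_notP => nN Ot.
by rewrite -mulr_sumr hN ?mulr1//; exact: open_simplex_sub.
Qed.

End partition.

End cells_theory.

(** * Measurability in the smoothing point *)

(** The MISE integrates over [s], which enters the kernel through Gamma parameters. Measurability in
    a parameter comes from Tonelli, since the integrand is jointly measurable. *)
Lemma measurable_egamma (R : realType) : measurable_fun setT (@egamma R).
Proof.
have := @measurable_fun_fubini_tonelli_F _ _ (measurableTypeR R) (measurableTypeR R) R (@lebesgue_measure R)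
  (fun p : R * R => (pos_pow p.1 p.2 * expR (- p.2))%:E).
apply.
  apply/measurable_EFinP; apply: measurable_funM.
    by apply: measurable_pos_pow2; [exact: measurable_fst|exact: measurable_snd].
  apply: measurableT_comp; first exact: measurable_expR.
  by apply: measurableT_comp => //; exact: measurable_snd.
by move=> p; rewrite lee_fin mulr_ge0 ?pos_pow_ge0 ?expR_ge0.
Qed.

Lemma measurable_Gamma (R : realType) : measurable_fun setT (@Gamma R).
Proof.
rewrite (_ : @Gamma R = fine \o egamma); last by apply/funext => a; rewrite /= GammaE.
by apply: (measurableT_comp (f := fine)); [exact: fine_measurable|exact: measurable_egamma].
Qed.

Lemma Gamma_ge0 (R : realType) (a : R) : 0 <= Gamma a.
Proof.
rewrite GammaE fine_ge0//; apply: integral_ge0 => u _.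
by rewrite lee_fin mulr_ge0 ?pos_pow_ge0 ?expR_ge0.
Qed.

Section cell_weight_measurable.
Context {R : realType} (d : nat).
Hypothesis d_gt0 : (0 < d)%N.
Local Notation leb := (lebesgue_rV d : measure _ R).
Local Notation S := (@simplex R d).
Local Notation O := (@open_simplex R d).
Implicit Types (s t : 'rV[R]_d).

Lemma measurable_kernel_alpha b j : measurable_fun setT (fun s : 'rV[R]_d => kernel_alpha s b ord0 j).
Proof.
under eq_fun do rewrite !mxE.
by apply: measurable_funD => //; apply: measurable_funM => //; exact: measurable_coord.
Qed.

Lemma measurable_kernel_beta b : measurable_fun setT (fun s : 'rV[R]_d => kernel_beta s b).
Proof.
apply: measurable_funD => //; apply: measurable_funM => //; apply: measurable_funB => //.
apply: measurable_sum => j; apply: measurableT_comp; first exact: normr_measurable.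
exact: measurable_coord.
Qed.

Lemma measurable_kernel_norm b :
  measurable_fun setT (fun s : 'rV[R]_d => dirichlet_norm (kernel_alpha s b) (kernel_beta s b)).
Proof.
have ma := measurable_kernel_alpha b; have mb := measurable_kernel_beta b.
have mG (h : 'rV[R]_d -> R) : measurable_fun setT h -> measurable_fun setT (fun s => Gamma (h s)).
  by move=> mh; apply: measurableT_comp => //; exact: measurable_Gamma.
apply: measurable_funM.
  by apply: (mG (fun s => \sum_j kernel_alpha s b ord0 j + kernel_beta s b)); apply: measurable_funD => //; exact: measurable_sum.
(* The inverse is expressed by [powR] with exponent -1, a measurable function; the two agree because
   [den] is nonnegative. *)
pose den s := Gamma (kernel_beta s b) * \prod_j Gamma (kernel_alpha s b ord0 j).
rewrite (_ : (fun s => _) = (fun s => den s `^ (-1))); last first.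
  apply/funext => s; rewrite powR_inv1//; apply: mulr_ge0; first exact: Gamma_ge0.
  by apply: prodr_ge0 => j _; exact: Gamma_ge0.
apply: (measurableT_comp (measurable_powR (-1))).
apply: measurable_funM; first exact: mG.
by apply: measurable_prod => j _; exact: mG.
Qed.

(** The normalizing constant comes out of the integral, and the remaining weight is jointly
    measurable and nonnegative everywhere, so Tonelli applies. The identification with the kernel
    holds for [s] in the simplex only. *)
Lemma measurable_cell_weight A b : measurable A -> A `<=` S -> 0 < b ->
  measurable_fun S (fun s => \int[leb]_(t in A) kappa s b t).
Proof.
move=> mA AS b0.
pose W s t := dirichlet_weight (kernel_alpha s b) (kernel_beta s b) 1 t.
pose H (p : 'rV[R]_d * 'rV[R]_d) : \bar R := (\1_O p.2 * (\1_A p.2 * W p.1 p.2))%:E.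
have mO := @measurable_open_simplex R d.
have mind (C : set 'rV[R]_d) : measurable C -> measurable_fun setT (fun p : 'rV[R]_d * 'rV[R]_d => \1_C p.2 : R).
  by move=> mC; apply: (measurableT_comp _ measurable_snd); exact: measurable_indic.
have mH : measurable_fun setT H.
  apply/measurable_EFinP; apply: measurable_funM; first exact: mind.
  apply: measurable_funM; first exact: mind.
  apply: measurable_funM.
    apply: measurable_prod => j _; apply: measurable_pos_pow2.
      exact: (measurableT_comp (measurable_kernel_alpha b j) measurable_fst).
    exact: (measurableT_comp (@measurable_coord R d j) measurable_snd).
  apply: measurable_pos_pow2.
    exact: (measurableT_comp (measurable_kernel_beta b) measurable_fst).
  apply: measurable_funB => //.
  exact: (measurableT_comp (@measurable_sum_coord R d) measurable_snd).
have W0 s t : 0 <= W s t.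
  by rewrite mulr_ge0 ?pos_pow_ge0//; apply: prodr_ge0 => j _; exact: pos_pow_ge0.
have H0 p : (0 <= H p)%E.
  rewrite lee_fin; apply: mulr_ge0; first by rewrite indicE.
  by apply: mulr_ge0; [rewrite indicE|exact: W0].
have mF := @measurable_fun_fubini_tonelli_F _ _ _ _ R (lebesgue_rV d) H mH H0.
apply: (@eq_measurable_fun _ _ _ _ S (fun s => dirichlet_norm (kernel_alpha s b) (kernel_beta s b) *
    fine (fubini_F (lebesgue_rV d) H s))).
  move=> s; rewrite inE => Ss.
  rewrite kernel_cell_weight// /kernel_mean /dirichlet_mean /fubini_F.
  have W1 t : \1_A t * dirichlet_pdf (kernel_alpha s b) (kernel_beta s b) t = \1_A t * kappa s b t by [].
  have intW : leb.-integrable O (EFin \o (fun t => \1_A t * W s t)).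
    have ka := kernel_alpha_gt0 Ss b0; have kb := kernel_beta_gt0 Ss b0.
    have N0 := dirichlet_norm_gt0 ka kb.
    have := @integrableZl _ _ _ leb O mO (dirichlet_norm (kernel_alpha s b) (kernel_beta s b))^-1 _ (bm_integrable ka kb (bm_indic mA)).
    apply: eq_integrable => // t; rewrite inE => Ot /=; rewrite W1 kappaE//.
    by congr (_%:E); rewrite mulrCA mulKf// gt_eqF.
  transitivity (\int[leb]_(t in O) (dirichlet_norm (kernel_alpha s b) (kernel_beta s b) * (\1_A t * W s t))).
    rewrite RintegralZl//; congr (_ * fine _).
    rewrite [RHS]integral_mkcond; apply: eq_integral => t _; rewrite /H patchE/= indicE.
    by case: ifP => _; rewrite ?mul1r ?mul0r.
  by apply: eq_Rintegral => t; rewrite inE => Ot; rewrite W1 kappaE// mulrCA.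
apply: measurable_funM; first by apply: measurable_funTS; exact: measurable_kernel_norm.
by apply: measurable_funTS; apply: (measurableT_comp (f := fine)); [exact: fine_measurable|exact: mF].
Qed.

End cell_weight_measurable.

(** * Integrability of [psi0] and dominated convergence *)

Section integral_limits.
Context {R : realType} (d : nat).
Hypothesis d_gt0 : (0 < d)%N.
Local Notation leb := (lebesgue_rV d : measure _ R).
Local Notation S := (@simplex R d).
Local Notation O := (@open_simplex R d).
Implicit Types (s t v : 'rV[R]_d) (h : 'rV[R]_d -> R).

Lemma powR_prod (I : Type) (r : seq I) (F : I -> R) (p : R) : (forall i, 0 <= F i) ->
  (\prod_(i <- r) F i) `^ p = \prod_(i <- r) F i `^ p.
Proof.
move=> F0; elim: r => [|i r IH]; first by rewrite !big_nil powR1.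
by rewrite !big_cons powRM ?IH//; apply: prodr_ge0.
Qed.

(* [psi0] is proportional to the Dirichlet(1/2, ..., 1/2) density. *)
Lemma psi0_integrable : leb.-integrable O (EFin \o @psi0 R d).
Proof.
pose a : 'rV[R]_d := const_mx 2^-1.
have h0 : 0 < 2^-1 :> R by rewrite invr_gt0.
have a0 j : 0 < a ord0 j by rewrite mxE.
pose N : R := Gamma (l1norm a + 2^-1) / (Gamma 2^-1 * \prod_(j < d) Gamma (a ord0 j)).
have N0 : N != 0.
  have := dirichlet_norm_gt0 a0 h0; rewrite /dirichlet_norm -l1norm_ge0E => [/lt0r_neq0//|].
  by move=> j; exact: ltW.
have := @integrableZl _ _ _ leb O (@measurable_open_simplex R d) (((4 * pi) ^+ d) `^ (- 2^-1) / N) _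
  (integrable_dirichlet_pdf a0 h0).
apply: eq_integrable; first exact: measurable_open_simplex.
move=> s; rewrite inE => -[s01 s1]; rewrite /= /psi0 /dirichlet_pdf -/N; congr (_%:E).
have sj0 j : 0 <= s ord0 j by have /andP[/ltW] := s01 j.
have p0 : 0 <= (4 * pi) ^+ d :> R by apply: exprn_ge0; apply: mulr_ge0 => //; exact: pi_ge0.
have l0 : 0 <= 1 - l1norm s by rewrite subr_ge0 ltW.
rewrite powRM ?mulr_ge0 ?prodr_ge0// powRM// (_ : 2^-1 - 1 = - 2^-1); last by lra.
rewrite (_ : \prod_(j < d) s ord0 j `^ (a ord0 j - 1) = (\prod_(j < d) s ord0 j) `^ (- 2^-1)); last first.
  by rewrite powR_prod//; apply: eq_bigr => j _; rewrite mxE; congr (_ `^ _); lra.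
by clearbody N; rewrite !mulrA divfK.
Qed.

(** The hypotheses on the cells hold for large [n] only, so the domination is assumed eventually and
    the sequence is shifted to its threshold. *)
Lemma dominated_Rintegral_cvg (h : nat -> 'rV[R]_d -> R) (l g : 'rV[R]_d -> R) :
  (\forall n \near \oo, measurable_fun O (h n) /\ forall s, O s -> `|h n s| <= g s) ->
  (forall s, O s -> h n s @[n --> \oo] --> l s) ->
  leb.-integrable O (EFin \o g) ->
  leb.-integrable O (EFin \o l) /\
  \int[leb]_(s in O) h n s @[n --> \oo] --> \int[leb]_(s in O) l s.
Proof.
move=> [N _ hN] hl ig.
have mO := @measurable_open_simplex R d.
pose k n := h (n + N)%N.
have mk n : measurable_fun O (k n) by have [] := hN (n + N)%N (leq_addl _ _).
have kg n s : O s -> `|k n s| <= g s by have [_] := hN (n + N)%N (leq_addl _ _); exact.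
have kl s : O s -> k n s @[n --> \oo] --> l s.
  by move=> Os; have := hl s Os; rewrite -(cvg_shiftn N).
have ml : measurable_fun O l by exact: measurable_fun_cvg mk kl.
have lg s : O s -> `|l s| <= g s.
  move=> Os; apply: (ler_cvg_to (cvg_norm (kl s Os)) (cvg_cst (g s))).
  by apply: nearW => n; exact: kg.
have il : leb.-integrable O (EFin \o l).
  apply: le_integrable ig => //; first exact/measurable_EFinP.
  by move=> s Os; rewrite /= lee_fin (le_trans (lg s Os))// ler_norm.
split=> //; rewrite -(cvg_shiftn N).
have := @dominated_cvg _ _ R leb O mO (fun n s => (k n s)%:E) (EFin \o l) (EFin \o g)
  (fun n => iffRL (measurable_EFinP _ _) (mk n)).
move=> /(_ _ _ ig) H.
have {}H : (\int[leb]_(s in O) (k n s)%:E @[n --> \oo] --> \int[leb]_(s in O) (l s)%:E)%E.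
  apply: H => [s Os|s Os|n s Os]; rewrite ?lee_fin//; last exact: kg.
  by apply/fine_cvgP; split; [exact: nearW|exact: kl].
rewrite -(fineK (integrable_fin_num mO il)) in H.
exact: (fine_cvg H).
Qed.

End integral_limits.

(** * Bias-variance decomposition *)

Section moments.
Context {R : realType} {dO : measure_display} {Omega : measurableType dO}.
Variable P : probability Omega R.
Implicit Types (X Y : Omega -> R) (r : R).

(** Integrability travels with the value, so that linear combinations need no side conditions. *)
Definition has_mean X r :=
  P.-integrable setT (EFin \o X) /\ (\int[P]_w (X w)%:E = r%:E)%E.

Lemma has_mean_cst r : has_mean (fun=> r) r.
Proof.
split; first exact: finite_measure_integrable_cst.
rewrite integral_cst// -[RHS]mule1; congr (_ * _)%E; exact: probability_setT.
Qed.

Lemma has_meanD X Y r1 r2 : has_mean X r1 -> has_mean Y r2 ->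
  has_mean (fun w => X w + Y w) (r1 + r2).
Proof.
move=> [iX eX] [iY eY]; split; first exact: (@integrableD _ _ _ P setT measurableT _ _ iX iY).
under eq_integral do rewrite EFinD.
by rewrite integralD// eX eY.
Qed.

Lemma has_meanZ X r c : has_mean X r -> has_mean (fun w => c * X w) (c * r).
Proof.
move=> [iX eX]; split; first exact: (@integrableZl _ _ _ P setT measurableT c _ iX).
under eq_integral do rewrite EFinM.
by rewrite integralZl// eX.
Qed.

Lemma has_mean_sum (I : Type) (s : seq I) (X : I -> Omega -> R) (r : I -> R) :
  (forall i, has_mean (X i) (r i)) ->
  has_mean (fun w => \sum_(i <- s) X i w) (\sum_(i <- s) r i).
Proof.
move=> h; elim: s => [|i s IH].
  by under [X in has_mean X _]eq_fun do rewrite big_nil; rewrite big_nil; exact: has_mean_cst.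
by under [X in has_mean X _]eq_fun do rewrite big_cons; rewrite big_cons; exact: has_meanD.
Qed.

Let integrable_le X Y : measurable_fun setT X -> P.-integrable setT (EFin \o Y) ->
  (forall w, `|X w| <= Y w) -> P.-integrable setT (EFin \o X).
Proof.
move=> mX iY h; apply: (le_integrable measurableT _ _ iY); first exact/measurable_EFinP.
by move=> w _; rewrite /= lee_fin (le_trans (h w))// ler_norm.
Qed.

Lemma centered_square_mean (X : {RV P >-> R}) c :
  'E_P[X]%E = 0%E -> 'V_P[X]%E = c%:E -> has_mean (fun w => X w * X w) c.
Proof.
move=> EX; rewrite /variance covariance.unlock EX expectation.unlock.
under eq_integral do rewrite /GRing.mul/= !subr0.
move=> h; split => //; apply/integrableP; split.
  by apply/measurable_EFinP; exact: measurable_funM.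
under eq_integral do rewrite /= ger0_norm -?expr2 ?sqr_ge0//.
by under eq_integral do rewrite expr2; rewrite h ltry.
Qed.

(** Integrability of [X] is taken from its second moment, through [|X| <= 1 + X^2]. *)
Lemma centered_mean (X : {RV P >-> R}) c :
  'E_P[X]%E = 0%E -> has_mean (fun w => X w * X w) c -> has_mean X 0.
Proof.
move=> EX hX2; split; last by rewrite expectation.unlock in EX.
apply: (@integrable_le _ (fun w => 1 + X w * X w)) => //.
  by have [] := has_meanD (has_mean_cst 1) hX2.
move=> w; have := sqr_ge0 (`|X w| - 1); rewrite sqrrB expr1n mulr1 real_normK ?num_real// expr2.
have := normr_ge0 (X w); have := sqr_ge0 (X w); rewrite expr2; move: (`|X w|) (X w * X w) => p q; lra.
Qed.

(* The joint law of two independent variables is the product of their laws. *)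
Lemma independent_mean_mul (X Y : {RV P >-> R}) c1 c2 :
  (forall A B, measurable A -> measurable B ->
    P (X @^-1` A `&` Y @^-1` B) = (P (X @^-1` A) * P (Y @^-1` B))%E) ->
  has_mean (fun w => X w * X w) c1 -> has_mean (fun w => Y w * Y w) c2 ->
  has_mean X 0 -> has_mean Y 0 -> has_mean (fun w => X w * Y w) 0.
Proof.
move=> ind h1 h2 [iX eX] [iY eY].
have iXY : P.-integrable setT (EFin \o (fun w => X w * Y w)).
  apply: (@integrable_le _ (fun w => X w * X w + Y w * Y w)).
  - exact: measurable_funM.
  - by have [] := has_meanD h1 h2.
  - move=> w; rewrite normrM -[X w * X w]expr2 -[Y w * Y w]expr2.
    rewrite -(real_normK (num_real (X w))) -(real_normK (num_real (Y w))).
    have := normr_ge0 (X w); have := normr_ge0 (Y w); move: (`|X w|) (`|Y w|) => p q p0 q0.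
    have := sqr_ge0 (p - q); rewrite sqrrB; have := mulr_ge0 p0 q0.
    by rewrite -mulr_natl [p * q]mulrC; move: (q * p) (p ^+ 2) (q ^+ 2) => u v w'; lra.
split=> //.
pose phi (w : Omega) := (X w, Y w).
have mphi : measurable_fun setT phi by apply: measurable_fun_pair.
pose mul2 (p : R * R) := (p.1 * p.2)%:E.
have mmul2 : measurable_fun setT mul2.
  by apply/measurable_EFinP; apply: measurable_funM; [exact: measurable_fst|exact: measurable_snd].
have iphi : P.-integrable (phi @^-1` setT) (mul2 \o phi) by rewrite preimage_setT.
transitivity (\int[pushforward P phi]_(p in setT) mul2 p)%E.
  by rewrite (integral_pushforward mphi mmul2 iphi measurableT) preimage_setT.
have iprod := integrable_pushforward mphi mmul2 iphi measurableT.
pose PX := distribution P X; pose PY := distribution P Y.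
pose m' : {measure set (R * R) -> \bar R} :=
  measure_function_pushforward__canonical__measure_function_Measure P mphi.
have mE A : measurable A -> (PX \x PY)%E A = m' A.
  move=> mA; apply: product_measure_unique mA => C D mC mD.
  by rewrite /= /pushforward -ind.
have intE (g : R * R -> \bar R) : (\int[m']_p g p = \int[(PX \x PY)%E]_p g p)%E.
  by apply: eq_measure_integral => A mA _; apply: esym; exact: mE.
have iprod' : (PX \x PY)%E.-integrable setT mul2.
  have /integrableP[mf fin] := iprod; apply/integrableP; split=> //.
  by rewrite -intE.
transitivity (\int[m']_p mul2 p)%E; first by [].
rewrite intE -integral12_prod_meas1//.
apply: integral0_eq => u _; rewrite /fubini_F /mul2 /=.
under eq_integral do rewrite EFinM.
have mY : measurable_fun setT Y by [].
have mE' : measurable_fun setT (fun y : R => y%:E) by exact/measurable_EFinP.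
have iY' : P.-integrable (Y @^-1` setT) ((fun y : R => y%:E) \o Y) by rewrite preimage_setT.
have iYd : PY.-integrable setT (fun y : R => y%:E).
  exact: (integrable_pushforward mY mE' iY' measurableT).
rewrite integralZl//.
have -> : (\int[PY]_y y%:E = 0)%E.
  by rewrite (integral_pushforward mY mE' iY' measurableT) preimage_setT; exact: eY.
by rewrite mule0.
Qed.

End moments.

Section mean_square_error.
Context {R : realType} (d : nat) {dO : measure_display} {Omega : measurableType dO}.
Variables (P : probability Omega R) (m sigmasq : 'rV[R]_d -> R).
Variables (n : nat) (x : 'I_n -> 'rV[R]_d) (eps : 'I_n -> {RV P >-> R}).
Variables (B : 'I_n -> set 'rV[R]_d) (s : 'rV[R]_d) (b : R).
Hypothesis ind : mutually_independent eps.
Hypothesis mean0 : forall i, 'E_P[eps i]%E = 0%E.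
Hypothesis var : forall i, 'V_P[eps i]%E = (sigmasq (x i))%:E.
Local Notation w i := (\int[lebesgue_rV d]_(t in B i) kappa s b t).

Let mean_mul i j :
  has_mean P (fun u => eps i u * eps j u) ((i == j)%:R * sigmasq (x i)).
Proof.
have sq k := centered_square_mean (mean0 k) (var k).
have [<-|ij] := eqVneq i j; first by rewrite mul1r; exact: sq.
rewrite mul0r.
apply: (@independent_mean_mul _ _ _ _ _ _ (sigmasq (x i)) (sigmasq (x j))) => //; last 2 first.
- exact: centered_mean (sq i).
- exact: centered_mean (sq j).
move=> A C mA mC.
(* Pairwise independence is the case of the index set formed by [i] and [j], with event [A] at [i]
   and [C] elsewhere. *)
have := @ind [set i; j]%SET (fun k => if k == i then A else C) _.
rewrite big_setU1 ?inE//= big_set1 eqxx [j == i]eq_sym (negPf ij) => <-; last by move=> k; case: ifP.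
congr (P _); apply/seteqP; split => u /=.
  by move=> [ui uj] k /=; rewrite !inE => /orP[/eqP ->|/eqP ->]; rewrite ?eqxx// eq_sym (negPf ij).
move=> h; have /= := h i; have /= := h j; rewrite !inE !eqxx orbT eq_sym (negPf ij).
by move=> hj hi; split; [exact: hi|exact: hj].
Qed.

(** The error is the bias [be] plus a weighted sum of noise. In its square the mixed term has mean
    0, and [mean_mul] leaves only the diagonal of the double sum. *)
Lemma MSE_bias_variance : MSE m x eps B b s =
  ((\sum_i m (x i) * w i - m s) ^+ 2 + \sum_i sigmasq (x i) * w i ^+ 2)%:E.
Proof.
have hm i := centered_mean (mean0 i) (centered_square_mean (mean0 i) (var i)).
pose be := \sum_i m (x i) * w i - m s.
have h : has_mean P (fun u => be ^+ 2 + 2 * be * \sum_i w i * eps i u +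
    \sum_i \sum_j w i * w j * (eps i u * eps j u))
    (be ^+ 2 + 2 * be * \sum_i w i * 0 + \sum_i \sum_j w i * w j * ((i == j)%:R * sigmasq (x i))).
  apply: has_meanD; first apply: has_meanD; first exact: has_mean_cst.
    by apply: has_meanZ; apply: has_mean_sum => i; exact: has_meanZ.
  by apply: has_mean_sum => i; apply: has_mean_sum => j; apply: has_meanZ; exact: mean_mul.
rewrite /MSE expectation.unlock.
transitivity (\int[P]_u (be ^+ 2 + 2 * be * \sum_i w i * eps i u +
    \sum_i \sum_j w i * w j * (eps i u * eps j u))%:E)%E.
  apply: eq_integral => u _; congr (_%:E).
  have -> : GM_estimator m x eps B b s u - m s = be + \sum_i w i * eps i u.
    rewrite /GM_estimator /be addrAC -big_split; congr (_ - _); apply: eq_bigr => i _.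
    by rewrite /response mulrDl [eps i u * _]mulrC.
  rewrite sqrrD -mulr_natl mulrA; congr (_ + _).
  rewrite expr2 mulr_suml; apply: eq_bigr => i _; rewrite mulr_sumr; apply: eq_bigr => j _.
  by rewrite mulrACA.
have [_ ->] := h; congr (_%:E).
rewrite [X in _ * X]big1 ?mulr0 ?addr0 => [|i _]; last by rewrite mulr0.
congr (_ + _); apply: eq_bigr => i _.
rewrite (bigD1 i)//= eqxx mul1r big1 ?addr0 => [|j ji]; first by rewrite mulrC expr2.
by rewrite [i == j]eq_sym (negPf ji) mul0r mulr0.
Qed.

End mean_square_error.

(** * Oscillation of the kernel *)

Section kernel_variation.
Context {R : realType} (d : nat).
Hypothesis d_gt0 : (0 < d)%N.
Local Notation leb := (@lebesgue_rV R d).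
Local Notation S := (@simplex R d).
Local Notation O := (@open_simplex R d).
Implicit Types (s t u : 'rV[R]_d) (b : R).

(** The product of all barycentric coordinates lies below each of them, as they are at most 1. *)
Lemma open_simplex_interior s : O s -> exists2 mu, 0 < mu &
  (forall j, mu <= s ord0 j) /\ mu <= 1 - \sum_j s ord0 j.
Proof.
move=> /open_simplexP[s0 s1].
have r0 : 0 < 1 - \sum_j s ord0 j by rewrite subr_gt0.
have ss0 : 0 <= \sum_j s ord0 j by apply: sumr_ge0 => j _; exact: ltW.
have r1 : 1 - \sum_j s ord0 j <= 1 by rewrite lerBlDr lerDl.
have sj1 j : s ord0 j <= 1.
  by apply: le_trans (ltW s1); apply: coord_le_sum => k; exact: ltW.
have P0 : 0 < \prod_j s ord0 j by apply: prodr_gt0 => j _.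
have P1 : \prod_j s ord0 j <= 1 by apply: prod_le1 => j; rewrite sj1 ltW.
exists (\prod_j s ord0 j * (1 - \sum_j s ord0 j)); first exact: mulr_gt0.
split; last by apply: ler_piMl => //; exact: ltW.
move=> j; apply: (@le_trans _ _ (\prod_j s ord0 j)); first by apply: ler_piMr => //; exact: ltW.
rewrite (bigD1 j) /=; last by [].
apply: ler_piMr; first exact: ltW.
have : \prod_(i < d | i != j) s ord0 i <= \prod_(i < d | i != j) 1.
  by apply: ler_prod => i _; rewrite sj1 ltW.
by rewrite big1_eq.
Qed.

Definition kernel_exponent s b t : R :=
  \sum_j (s ord0 j / b) * ln (t ord0 j) + (1 - l1norm s) / b * ln (1 - \sum_j t ord0 j).

Lemma kappa_expR s b t : S s -> 0 < b -> O t ->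
  kappa s b t = dirichlet_norm (kernel_alpha s b) (kernel_beta s b) * expR (kernel_exponent s b t).
Proof.
move=> Ss b0 Ot; rewrite kappaE//; congr (_ * _).
have /open_simplexP[t0 t1] := Ot.
rewrite /dirichlet_weight /kernel_exponent expRD expR_sum; congr (_ * _).
  by apply: eq_bigr => j _; rewrite /pos_pow t0 kernel_alphaE addrK.
by rewrite /pos_pow subr_gt0 t1 /kernel_beta addrK.
Qed.

Lemma lnB_le (x y e h : R) : 0 < e -> e <= y -> 0 < x -> `|x - y| <= h -> ln x - ln y <= h / e.
Proof.
move=> e0 ey x0 xy; have y0 : 0 < y by exact: lt_le_trans ey.
rewrite -ln_div ?posrE//.
have -> : x / y = 1 + (x - y) / y by field; rewrite gt_eqF.
have h0 : 0 <= h by exact: le_trans xy.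
apply: (@le_trans _ _ ((x - y) / y)).
  apply: le_ln1Dx; have z0 : 0 < x / y by exact: divr_gt0.
  rewrite (_ : (x - y) / y = x / y - 1); last by field; rewrite gt_eqF.
  by lra.
apply: (@le_trans _ _ (h / y)).
  by apply: ler_wpM2r; [rewrite invr_ge0 ltW | rewrite (le_trans (ler_norm _))].
by apply: ler_wpM2l => //; rewrite lef_pV2.
Qed.

(** The logarithm of the kernel is, up to a constant, [1 / b] times a convex combination of
    logarithms of barycentric coordinates. Each of these increases from [u] to [t] by at most
    [h / e], the last one by at most [d h / e], since it collects the changes of all coordinates. *)
Lemma kappa_variation s b t u e h : S s -> 0 < b -> O t -> O u -> 0 < e ->
  (forall j, e <= u ord0 j) -> e <= 1 - \sum_j u ord0 j -> `|t - u| <= h ->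
  expR (- (d%:R * h / (e * b))) * kappa s b t <= kappa s b u.
Proof.
move=> Ss b0 Ot Ou e0 uj us tu.
have [s01 s1] := Ss; have c0 := dirichlet_norm_gt0 (kernel_alpha_gt0 Ss b0) (kernel_beta_gt0 Ss b0).
have /open_simplexP[t0 t1] := Ot.
rewrite !kappa_expR// mulrCA ler_pM2l// -expRD ler_expR addrC lerBlDr -lerBlDl.
have h0 : 0 <= h by exact: le_trans tu.
have d1 : 1 <= d%:R :> R by rewrite ler1n.
have s0 j : 0 <= s ord0 j / b by apply: divr_ge0; [have /andP[] := s01 j | exact: ltW].
have r0 : 0 <= (1 - l1norm s) / b by apply: divr_ge0; [rewrite subr_ge0 | exact: ltW].
rewrite /kernel_exponent opprD addrACA -mulrBr -sumrB.
apply: (@le_trans _ _ (\sum_j (s ord0 j / b) * (h / e) + (1 - l1norm s) / b * (d%:R * h / e))).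
  apply: lerD.
    apply: ler_sum => j _; rewrite -mulrBr; apply: ler_wpM2l => //.
    apply: lnB_le => //; apply: le_trans tu.
    by have := coord_le_norm (t - u) j; rewrite !mxE.
  apply: ler_wpM2l => //; apply: lnB_le => //; first by rewrite subr_gt0.
  rewrite (_ : _ - _ = \sum_j (u ord0 j - t ord0 j)); last by rewrite sumrB; ring.
  apply: le_trans (ler_norm_sum _ _ _) _; rewrite -[d in d%:R](card_ord d) mulr_natl -sumr_const.
  apply: ler_sum => j _; apply: le_trans tu; rewrite distrC.
  by have := coord_le_norm (t - u) j; rewrite !mxE.
rewrite -mulr_suml -mulr_suml -l1norm_ge0E; last by move=> j; have /andP[] := s01 j.
have l0 : 0 <= l1norm s by apply: sumr_ge0.
rewrite (_ : _ + _ = (l1norm s + (1 - l1norm s) * d%:R) * (h / (e * b))); last by field; rewrite !gt_eqF.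
rewrite -[X in _ <= X]mulrA; apply: ler_wpM2r; first by apply: divr_ge0 => //; apply/ltW/mulr_gt0.
by move: (l1norm s) (d%:R : R) l0 d1 s1 => x y *; nra.
Qed.

End kernel_variation.

(** * Taylor expansion on the open simplex *)

Section increments.
Context {R : realType}.

Lemma increment_le_itv (phi dphi : R -> R) (l e a : R) : 0 <= a ->
  (forall r : R, 0 <= r <= a -> is_derive r 1 phi (dphi r)) ->
  (forall r, 0 <= r <= a -> `|dphi r - l| <= e) ->
  `|phi a - phi 0 - l * a| <= e * a.
Proof.
move=> a0 dp le.
have [| |c] := @MVT_segment R phi dphi 0 a a0.
- by move=> r; rewrite in_itv/= => /andP[r0 r1]; apply: dp; rewrite !ltW.
- apply: derivable_within_continuous => r; rewrite in_itv/= => r01.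
  by have [] := dp r r01.
rewrite in_itv/= subr0 => c01 ->.
by rewrite -mulrBl normrM (ger0_norm a0) ler_wpM2r// le.
Qed.

Lemma increment_le (phi dphi : R -> R) (l e : R) :
  (forall r : R, 0 <= r <= 1 -> is_derive r 1 phi (dphi r)) ->
  (forall r : R, 0 <= r <= 1 -> `|dphi r - l| <= e) ->
  `|phi 1 - phi 0 - l| <= e.
Proof.
by move=> dp le; have := increment_le_itv ler01 dp le; rewrite !mulr1.
Qed.

Lemma is_derive_line (V : normedModType R) (h : V -> R) (y v : V) (r df : R) :
  is_derive (y + r *: v) v h df -> is_derive r 1 (fun r => h (y + r *: v)) df.
Proof.
move=> [dh Dh].
have E : (fun k : R => k^-1 *: ((((fun r => h (y + r *: v)) \o shift r) (k *: (1:R))) - h (y + r *: v))) =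
    (fun k : R => k^-1 *: (((h \o shift (y + r *: v)) (k *: v)) - h (y + r *: v))).
  apply/funext => k /=; congr (_ *: (h _ - _)).
  by rewrite [k *: 1]mulr1 scalerDl addrCA.
split; first by rewrite /derivable E.
by rewrite /derive E.
Qed.

End increments.

Section taylor.
Context {R : realType} (d : nat).
Local Notation S := (@simplex R d).
Local Notation O := (@open_simplex R d).
Implicit Types (s t v y c : 'rV[R]_d) (h : 'rV[R]_d -> R).

Lemma open_simplex_ball s : O s -> exists r e : R, [/\ 0 < r, 0 < e &
  forall t, `|t - s| <= 2 * r -> (forall j, e <= t ord0 j) /\ e <= 1 - \sum_j t ord0 j].
Proof.
move=> /open_simplex_interior[mu mu0 [sj ss]].
have d10 : 0 < d%:R + 1 :> R by rewrite ltr_wpDl.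
(* Moving every coordinate by at most [mu / (2 (d + 1))] moves their sum by at most [mu / 2], so
   half of [mu] survives. The radius [2 r] leaves room for whole cells whose design point is within
   [r]. *)
exists (mu / (4 * (d%:R + 1))), (mu / 2); split; rewrite ?divr_gt0 ?mulr_gt0//.
move=> t ts.
have h0 : 2 * (mu / (4 * (d%:R + 1))) * d%:R <= mu / 2.
  rewrite (_ : _ * _ = mu / 2 * (d%:R / (d%:R + 1))); last by field; rewrite gt_eqF.
  have m20 : 0 <= mu / 2 by apply: divr_ge0 => //; exact: ltW.
  by apply: ler_piMr => //; rewrite ler_pdivrMr// mul1r lerDl.
have h1 : 2 * (mu / (4 * (d%:R + 1))) <= mu / 2.
  rewrite (_ : _ * _ = mu / 2 / (d%:R + 1)); last by field; rewrite gt_eqF.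
  have m20 : 0 <= mu / 2 by apply: divr_ge0 => //; exact: ltW.
  by rewrite ler_pdivrMr//; apply: ler_peMr => //; rewrite lerDr.
have tj j : `|t ord0 j - s ord0 j| <= 2 * (mu / (4 * (d%:R + 1))).
  by apply: le_trans ts; have := coord_le_norm (t - s) j; rewrite !mxE.
split.
  by move=> j; have := sj j; have := tj j; rewrite ler_norml => /andP[]; lra.
have : \sum_j (t ord0 j - s ord0 j) <= 2 * (mu / (4 * (d%:R + 1))) * d%:R.
  rewrite [X in _ <= X]mulrC -[d in X in _ <= X * _](card_ord d) mulr_natl -sumr_const.
  by apply: ler_sum => j _; apply: le_trans (ler_norm _) _.
by rewrite sumrB; lra.
Qed.

Lemma nbhs_norm_le s (r : R) (A : set 'rV[R]_d) : 0 < r -> (forall t, `|t - s| < r -> A t) -> nbhs s A.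
Proof.
move=> r0 h; apply/nbhs_ballP; exists r => //= t.
by rewrite -ball_normE/= distrC => /h.
Qed.

Lemma open_simplex_open : open O.
Proof.
rewrite openE => s /open_simplex_ball[r [e [r0 e0 h]]].
apply: (@nbhs_norm_le s (2 * r)); first by rewrite mulr_gt0.
move=> t ts; have [tj ts1] := h t (ltW ts); apply/open_simplexP; split.
  by move=> j; apply: lt_le_trans (tj j).
by rewrite -subr_gt0; exact: lt_le_trans ts1.
Qed.

Lemma open_simplex_segment s t (r : R) : O s -> O t -> 0 <= r <= 1 -> O (s + r *: (t - s)).
Proof.
move=> /open_simplexP[s0 s1] /open_simplexP[t0 t1] /andP[r0 r1].
have E j : (s + r *: (t - s)) ord0 j = (1 - r) * s ord0 j + r * t ord0 j by rewrite !mxE; ring.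
apply/open_simplexP; split.
  move=> j; rewrite E; have [->|rn] := eqVneq r 0; first by rewrite subr0 mul1r mul0r addr0.
  by rewrite ltr_wpDl ?mulr_ge0 ?subr_ge0 ?(ltW (s0 j))// mulr_gt0// lt_neqAle eq_sym rn.
under eq_bigr do rewrite E.
rewrite big_split/= -!mulr_sumr.
move: (\sum_i s ord0 i) (\sum_i t ord0 i) s1 t1 => x z x1 z1.
have [->|rn] := eqVneq r 0; first by rewrite subr0 mul1r mul0r addr0.
have rp : 0 < r by rewrite lt_neqAle eq_sym rn.
by nra.
Qed.

Lemma simplex_compact : compact S.
Proof.
apply: bounded_closed_compact.
  exists 1; split; first exact: num_real.
  move=> M M1 s Ss; apply: le_trans (ltW M1); apply: norm_le_coord => // j.
  by have [/(_ j)/andP[s0 s1] _] := Ss; rewrite ger0_norm.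
have csum : continuous (fun s : 'rV[R]_d => \sum_j s ord0 j).
  by move=> s; apply: (@cvg_sumr R _ _ _ _ (nbhs_filter s)) => j; exact: coord_continuous.
have -> : S = (\bigcap_(j in [set: 'I_d]) [set s | 0 <= s ord0 j]) `&` [set s | \sum_j s ord0 j <= 1].
  by apply/seteqP; split => s; rewrite simplexP => -[s0 s1]; split => // j; [move=> _; exact: s0 | exact: (s0 j I)].
apply: closedI.
  apply: closed_bigI => j _.
  apply: (@closed_comp _ _ (fun s : 'rV[R]_d => s ord0 j) [set x | 0 <= x]).
    by move=> s _; exact: coord_continuous.
  exact: closed_ge.
apply: (@closed_comp _ _ (fun s : 'rV[R]_d => \sum_j s ord0 j) [set x | x <= 1]).
  by move=> s _; exact: csum.
exact: closed_le.
Qed.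

Lemma simplex_bounded h : {within S, continuous h} -> exists M, 0 <= M /\ forall s, S s -> `|h s| <= M.
Proof.
move=> ch; have S0 : S 0.
  by apply/simplexP; split => [j|]; [rewrite mxE | rewrite big1// => j _; rewrite mxE].
have ne : S !=set0 by exists 0.
have [c1 _ m1] := EVT_max_rV ne simplex_compact ch.
have [c2 _ m2] := EVT_min_rV ne simplex_compact ch.
exists (`|h c1| + `|h c2|); split; first by rewrite addr_ge0.
move=> s Ss; have := m1 s (mem_set Ss); have := m2 s (mem_set Ss) => h2 h1.
rewrite ler_norml; apply/andP; split.
  by have := ler_norm (- h c2); rewrite normrN; have := normr_ge0 (h c1); lra.
by have := ler_norm (h c1); have := normr_ge0 (h c2); lra.
Qed.

Lemma extends_continuously_bounded h : extends_continuously h ->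
  exists M, 0 <= M /\ forall s, O s -> `|h s| <= M.
Proof.
move=> [h' ch' E]; have [M [M0 hM]] := simplex_bounded ch'.
by exists M; split => // s Os; rewrite E// hM//; exact: open_simplex_sub.
Qed.

(** The extension is continuous relative to the simplex; at a point of the open simplex, which is
    open, this is ordinary continuity. *)
Lemma extends_continuously_near h s (e : R) : extends_continuously h -> O s -> 0 < e ->
  exists2 r : R, 0 < r & forall t, `|t - s| < r -> O t /\ `|h t - h s| <= e.
Proof.
move=> [h' ch' E] Os e0; have Ss := open_simplex_sub Os.
have nO : nbhs s O by move: open_simplex_open; rewrite openE => /(_ s Os).
have cO : {within O, continuous h'} := continuous_subspaceW (@open_simplex_sub R d) ch'.
rewrite (continuous_open_subspace _ open_simplex_open) in cO.
have cs : h' t @[t --> s] --> h' s by apply: cO; rewrite inE.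
have /cvgrPdist_le/(_ e e0) near := cs.
have /nbhs_ballP[r /= r0 hr] : nbhs s [set t | O t /\ `|h' s - h' t| <= e].
  exact: filterI nO near.
exists r => // t ts; have [Ot ht] : O t /\ `|h' s - h' t| <= e.
  by apply: hr; rewrite -ball_normE/= distrC.
by split => //; rewrite !E// distrC.
Qed.

End taylor.

Section directional.
Context {R : realType} (d : nat).
Local Notation O := (@open_simplex R d).
Implicit Types (s t v y c : 'rV[R]_d).
Variable h : 'rV[R]_d -> R.
Hypotheses (dh : forall j s, O s -> derivable h s (basis_rV j))
  (ch : forall j, extends_continuously (partial j h)).

Lemma partial_near s (e : R) : O s -> 0 < e -> exists2 r : R, 0 < r &
  forall t, `|t - s| < r -> O t /\ forall j, `|partial j h t - partial j h s| <= e.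
Proof.
move=> Os e0.
have /choice[r rP] : forall j, exists r : R, 0 < r /\
    forall t, `|t - s| < r -> O t /\ `|partial j h t - partial j h s| <= e.
  by move=> j; have [r r0 hr] := extends_continuously_near (ch j) Os e0; exists r.
have /nbhs_ballP[r0 /= r00 hr0] : nbhs s O by move: (@open_simplex_open R d); rewrite openE => /(_ s Os).
exists (\big[Num.min/r0]_j r j).
  by apply: lt_bigmin => // j _; have [] := rP j.
move=> t ts; split.
  apply: hr0; rewrite -ball_normE/= distrC; apply: lt_le_trans ts _.
  exact: bigmin_le_id.
move=> j; have [_ hj] := rP j; have [] // := hj t.
by apply: lt_le_trans ts _; exact: bigmin_le.
Qed.

(** Vertices of a staircase from [s] to [s + c]. *)
Definition path_point s c (k : nat) : 'rV[R]_d :=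
  \row_j (s ord0 j + (if (j < k)%N then c ord0 j else 0)).

Lemma path_pointS s c (k : 'I_d) :
  path_point s c k.+1 = path_point s c k + c ord0 k *: basis_rV k.
Proof.
apply/rowP => j; rewrite !mxE eqxx/= ltnS leq_eqVlt.
have [->|jk] := eqVneq j k; first by rewrite eqxx ltnn addr0 mulr1.
have -> : (j == k :> nat) = false by apply/negbTE.
by rewrite mulr0 addr0.
Qed.

(* Move along the coordinate axes one at a time. *)
Lemma increment_partial s (e r : R) c : 0 <= e ->
  (forall t, `|t - s| < r -> O t /\ forall j, `|partial j h t - partial j h s| <= e) ->
  `|c| < r ->
  `|h (s + c) - h s - \sum_j c ord0 j * partial j h s| <= e * \sum_j `|c ord0 j|.
Proof.
move=> e0 near cr.
have P0 : path_point s c 0 = s by apply/rowP => j; rewrite mxE ltn0 addr0.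
have Pd : path_point s c d = s + c by apply/rowP => j; rewrite !mxE ltn_ord.
have -> : h (s + c) - h s = \sum_(j < d) (h (path_point s c j.+1) - h (path_point s c j)).
  rewrite -Pd -[X in _ - h X]P0.
  rewrite -(big_mkord xpredT (fun j => h (path_point s c j.+1) - h (path_point s c j))).
  by rewrite telescope_sumr.
rewrite -sumrB; apply: le_trans (ler_norm_sum _ _ _) _; rewrite mulr_sumr.
apply: ler_sum => k _; set y := path_point s c k; rewrite path_pointS -/y.
pose phi (r : R) := h (y + r *: (c ord0 k *: basis_rV k)).
(* In the maximum norm the staircase never leaves the ball of radius [|c|] around [s]. *)
have close (z : R) : 0 <= z <= 1 -> `|y + z *: (c ord0 k *: basis_rV k) - s| < r.
  move=> /andP[z0 z1]; apply: le_lt_trans cr; apply: norm_le_coord => // j.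
  rewrite !mxE eqxx/= addrAC [_ + (if _ then _ else _)]addrC addrK.
  have cj := coord_le_norm c j.
  have [->|jk] := eqVneq j k; last by rewrite !mulr0 addr0; case: ifP; rewrite ?normr0.
  rewrite ltnn add0r mulr1 normrM ger0_norm//; apply: le_trans (coord_le_norm c k).
  by rewrite ler_piMl.
have -> : h (y + c ord0 k *: basis_rV k) = phi 1 by rewrite /phi scale1r.
have -> : h y = phi 0 by rewrite /phi scale0r addr0.
apply: (@increment_le R phi (fun z => c ord0 k * partial k h (y + z *: (c ord0 k *: basis_rV k)))).
  move=> z z01; have [Oz _] := near _ (close z z01).
  pose g (w : R) := h (y + w *: basis_rV k).
  have -> : phi = g \o (fun z => z * c ord0 k).
    by apply/funext => w; rewrite /phi /g/= scalerA.
  rewrite mulrC; apply: is_derive1_comp; last first.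
    have : is_derive z 1 (fun z : R => c ord0 k *: z) (c ord0 k *: (1 : R)) by exact: is_deriveZ.
    rewrite /GRing.scale/= mulr1; congr is_derive; apply/funext => w; exact: mulrC.
  apply: is_derive_line; rewrite scalerA in Oz; split; first exact: dh.
  by rewrite /partial scalerA.
move=> z z01; have [_ /(_ k) hz] := near _ (close z z01).
by rewrite -mulrBr normrM mulrC ler_wpM2r.
Qed.

(** The assumptions only give derivatives along the axes; continuity of the partial derivatives
    extends them to every direction. *)
Lemma is_derive_partial s v : O s -> is_derive s v h (\sum_j v ord0 j * partial j h s).
Proof.
move=> Os.
suff H : (fun k : R => k^-1 *: (((h \o shift s) (k *: v)) - h s)) @ 0^' --> \sum_j v ord0 j * partial j h s.
  by split; [apply/cvg_ex; exists (\sum_j v ord0 j * partial j h s) | exact: cvg_lim H].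
apply/cvgrPdist_le => e e0.
pose N := 1 + \sum_j `|v ord0 j|.
have N0 : 0 < N by rewrite ltr_wpDr// sumr_ge0.
have eN0 : 0 < e / N by rewrite divr_gt0.
have [r r0 near] := partial_near Os eN0.
have v10 : 0 < `|v| + 1 by rewrite ltr_wpDl.
near=> k.
have k0 : k != 0 by near: k; exact: nbhs_dnbhs_neq.
have kr : `|k| < r / (`|v| + 1).
  near: k; apply: nbhs_dnbhs; apply/nbhs_ballP; exists (r / (`|v| + 1)) => /=; first exact: divr_gt0.
  by move=> z; rewrite -ball_normE/= sub0r normrN.
have kv : `|k *: v| < r.
  rewrite normrZ; apply: (@le_lt_trans _ _ (`|k| * (`|v| + 1))); first by rewrite ler_wpM2l// lerDl.
  by rewrite -ltr_pdivlMr.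
have := increment_partial (ltW eN0) near kv.
have -> : \sum_j (k *: v) ord0 j * partial j h s = k * \sum_j v ord0 j * partial j h s.
  by rewrite mulr_sumr; apply: eq_bigr => j _; rewrite mxE mulrA.
have -> : \sum_j `|(k *: v) ord0 j| = `|k| * \sum_j `|v ord0 j|.
  by rewrite mulr_sumr; apply: eq_bigr => j _; rewrite mxE normrM.
set L := \sum_j v ord0 j * _; rewrite [s + _]addrC => H.
rewrite /= /GRing.scale/= distrC (_ : k^-1 * _ - L = k^-1 * (h (k *: v + s) - h s - k * L)); last first.
  by field.
rewrite normrM normfV mulrC ler_pdivrMr ?normr_gt0//; apply: le_trans H _.
rewrite mulrCA mulrC ler_wpM2r// -mulrA ler_piMr ?(ltW e0)// mulrC ler_pdivrMr// mul1r /N.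
by rewrite lerDr.
Unshelve. all: end_near. Qed.

End directional.

Local Opaque dirichlet_mean dirichlet_norm.

Section second_order.
Context {R : realType} (d : nat).
Local Notation S := (@simplex R d).
Local Notation O := (@open_simplex R d).
Implicit Types (s t v : 'rV[R]_d).
Variable m : 'rV[R]_d -> R.
Hypothesis C2m : C2_on_simplex m.
Local Notation D1 := (fun j => partial j m).
Local Notation D2 := (fun j k => partial j (partial k m)).

Let hess s v : R := \sum_k v ord0 k * \sum_j v ord0 j * D2 j k s.

Let dm1 s v : O s -> is_derive s v m (\sum_j v ord0 j * D1 j s).
Proof.
have [_ c1 _] := C2m; move=> Os; apply: is_derive_partial => // j; last by have [] := c1 j.
by move=> u Ou; have [h _] := c1 j; exact: h.
Qed.

Let dm2 k s v : O s -> is_derive s v (D1 k) (\sum_j v ord0 j * D2 j k s).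
Proof.
have [_ _ c2] := C2m; move=> Os; apply: is_derive_partial => // j; last by have [] := c2 j k.
by move=> u Ou; have [h _] := c2 j k; exact: h.
Qed.

(** The error is controlled by how far the second derivative along the segment is from [c]. The
    choice [c = 0] gives the global first-order bound, and the Hessian at [s] gives the local
    second-order one. *)
Lemma taylor2 s t (c E : R) : O s -> O t ->
  (forall r : R, 0 <= r <= 1 -> `|hess (s + r *: (t - s)) (t - s) - c| <= E) ->
  `|m t - m s - \sum_j (t ord0 j - s ord0 j) * D1 j s - c / 2| <= E.
Proof.
move=> Os Ot hE; set v := t - s.
have Or (r : R) : 0 <= r <= 1 -> O (s + r *: v) by exact: open_simplex_segment.
pose phi (r : R) := m (s + r *: v).
pose psi (r : R) := \sum_k v ord0 k * D1 k (s + r *: v).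
have dphi (r : R) : 0 <= r <= 1 -> is_derive r 1 phi (psi r).
  by move=> r01; apply: is_derive_line; apply: dm1; exact: Or.
have dpsi (r : R) : 0 <= r <= 1 -> is_derive r 1 psi (hess (s + r *: v) v).
  move=> r01.
  have dk k : is_derive r 1 (fun r => v ord0 k * D1 k (s + r *: v)) (v ord0 k * \sum_j v ord0 j * D2 j k (s + r *: v)).
    by apply: is_deriveZ; apply: is_derive_line; apply: dm2; exact: Or.
  have -> : psi = \sum_(k < d) (fun r => v ord0 k * D1 k (s + r *: v)).
    by apply/funext => z; rewrite fct_sumE.
  exact: is_derive_sum.
have psi_le (r : R) : 0 <= r <= 1 -> `|psi r - c * r - psi 0| <= E.
  move=> /andP[r0 r1].
  have := @increment_le_itv R psi (fun r => hess (s + r *: v) v) c E r r0.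
  rewrite [_ - psi 0 - _]addrAC => H; apply: le_trans (H _ _) _.
  - by move=> z /andP[z0 zr]; apply: dpsi; rewrite z0 (le_trans zr).
  - by move=> z /andP[z0 zr]; apply: hE; rewrite z0 (le_trans zr).
  - apply: ler_piMr => //; apply: le_trans (hE 0 _); first exact: normr_ge0.
    by rewrite lexx ler01.
have -> : \sum_j (t ord0 j - s ord0 j) * D1 j s = psi 0.
  by apply: eq_bigr => j _; rewrite scale0r addr0 !mxE.
have -> : m t = phi 1 by rewrite /phi scale1r addrC subrK.
have -> : m s = phi 0 by rewrite /phi scale0r addr0.
(* The derivative of [chi] stays within [E] of [psi 0], so one more mean value estimate finishes. *)
pose chi (r : R) := phi r - (c / 2) * (r * r).
have dchi (r : R) : 0 <= r <= 1 -> is_derive r 1 chi (psi r - c * r).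
  move=> r01; have dp := dphi r r01.
  have dr : is_derive r 1 (fun r : R => r * r) (2 * r).
    have : is_derive r 1 ((@id R) * (@id R)) (r *: (1:R) + r *: (1:R)) by exact: is_deriveM.
    by rewrite /GRing.scale/= mulr1 -mulr2n mulr_natl.
  have : is_derive r 1 (phi - (c / 2) *: (fun r : R => r * r)) (psi r - (c / 2) *: (2 * r)).
    exact: is_deriveB.
  by rewrite /GRing.scale/= mulrA divfK.
have := @increment_le_itv R chi (fun r => psi r - c * r) (psi 0) E 1 ler01 dchi psi_le.
by rewrite /chi !mulr1 !mulr0 subr0; congr (`|_| <= _); ring.
Qed.

Lemma quadratic_form_le v (A : 'I_d -> 'I_d -> R) (M : R) : 0 <= M ->
  (forall j k, `|A j k| <= M) ->
  `|\sum_k v ord0 k * \sum_j v ord0 j * A j k| <= M * (d%:R * \sum_j v ord0 j ^+ 2).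
Proof.
move=> M0 hM.
have -> : \sum_j v ord0 j ^+ 2 = \sum_j `|v ord0 j| ^+ 2.
  by apply: eq_bigr => j _; rewrite real_normK ?num_real.
apply: (@le_trans _ _ (M * (\sum_j `|v ord0 j|) ^+ 2)).
  apply: le_trans (ler_norm_sum _ _ _) _.
  rewrite expr2 mulrCA mulr_suml; apply: ler_sum => k _.
  rewrite normrM ler_wpM2l//; apply: le_trans (ler_norm_sum _ _ _) _.
  by rewrite mulr_sumr; apply: ler_sum => j _; rewrite normrM mulrC ler_wpM2r.
by apply: ler_wpM2l => //; exact: sqr_sum_le.
Qed.

Lemma hess_sub s u v : hess s v - hess u v =
  \sum_k v ord0 k * \sum_j v ord0 j * (D2 j k s - D2 j k u).
Proof.
rewrite /hess -sumrB; apply: eq_bigr => k _; rewrite -mulrBr -sumrB.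
by congr (_ * _); apply: eq_bigr => j _; rewrite mulrBr.
Qed.

Lemma sqdistE s t : sqdist s t = \sum_j (t - s) ord0 j ^+ 2.
Proof. by apply: eq_bigr => j _; rewrite !mxE. Qed.

Lemma partials_bounded : exists M, 0 <= M /\
  forall s, O s -> (forall j, `|D1 j s| <= M) /\ (forall j k, `|D2 j k s| <= M).
Proof.
have [_ c1 c2] := C2m.
have /choice[M1 hM1] : forall j, exists M, 0 <= M /\ forall s, O s -> `|D1 j s| <= M.
  by move=> j; have [_ /extends_continuously_bounded] := c1 j.
have /choice[M2 hM2] : forall jk : 'I_d * 'I_d, exists M, 0 <= M /\ forall s, O s -> `|D2 jk.1 jk.2 s| <= M.
  by move=> jk; have [_ /extends_continuously_bounded] := c2 jk.1 jk.2.
have S1 : 0 <= \sum_j M1 j by apply: sumr_ge0 => j _; have [] := hM1 j.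
have S2 : 0 <= \sum_jk M2 jk by apply: sumr_ge0 => j _; have [] := hM2 j.
exists (\sum_j M1 j + \sum_jk M2 jk); split; first exact: addr_ge0.
move=> s Os; split=> [j|j k].
  have [_ /(_ s Os) h] := hM1 j; apply: le_trans h _; rewrite (bigD1 j)//= -addrA lerDl addr_ge0//.
  by apply: sumr_ge0 => i _; have [] := hM1 i.
have [_ /(_ s Os) h] := hM2 (j, k); apply: le_trans h _.
rewrite [X in _ + X](bigD1 (j, k))//= addrCA lerDl addr_ge0//.
by apply: sumr_ge0 => i _; have [] := hM2 i.
Qed.

Lemma taylor1_le (M : R) : 0 <= M ->
  (forall s, O s -> (forall j, `|D1 j s| <= M) /\ (forall j k, `|D2 j k s| <= M)) ->
  forall s t, O s -> O t ->
  `|m t - m s - \sum_j (t ord0 j - s ord0 j) * D1 j s| <= M * (d%:R * sqdist s t).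
Proof.
move=> M0 hM s t Os Ot.
have := @taylor2 s t 0 (M * (d%:R * sqdist s t)) Os Ot.
rewrite mul0r subr0; apply => r r01; rewrite subr0 sqdistE; apply: quadratic_form_le => // j k.
by have [_] := hM _ (open_simplex_segment Os Ot r01); exact.
Qed.

Lemma taylor2_near s (e : R) : O s -> 0 < e -> exists2 r : R, 0 < r &
  forall t, O t -> `|t - s| < r ->
  `|m t - m s - \sum_j (t ord0 j - s ord0 j) * D1 j s - hess s (t - s) / 2| <= e * (d%:R * sqdist s t).
Proof.
move=> Os e0; have [_ _ c2] := C2m.
have /choice[rr rP] : forall jk : 'I_d * 'I_d, exists r : R, 0 < r /\
    forall t, `|t - s| < r -> O t /\ `|D2 jk.1 jk.2 t - D2 jk.1 jk.2 s| <= e.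
  move=> jk; have [_ c] := c2 jk.1 jk.2.
  by have [r r0 hr] := extends_continuously_near c Os e0; exists r.
exists (\big[Num.min/1]_jk rr jk).
  by apply: lt_bigmin => // jk _; have [] := rP jk.
move=> t Ot ts; apply: taylor2 => // r r01.
rewrite hess_sub sqdistE.
have hb j k : `|D2 j k (s + r *: (t - s)) - D2 j k s| <= e.
  have [_ h] := rP (j, k); have [] // := h (s + r *: (t - s)).
  rewrite addrAC subrr add0r normrZ; have /andP[r0 r1] := r01.
  rewrite (ger0_norm r0); apply: (@le_lt_trans _ _ `|t - s|); first by rewrite ler_piMl.
  by apply: lt_le_trans ts _; exact: bigmin_le.
by apply: quadratic_form_le => //; exact: ltW.
Qed.

Lemma C2_lipschitz : exists L, 0 <= L /\
  forall s t, O s -> O t -> `|m t - m s| <= L * `|t - s|.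
Proof.
have [M [M0 hM]] := partials_bounded.
exists (d%:R * M); split; first by rewrite mulr_ge0.
move=> s t Os Ot.
pose phi (r : R) := m (s + r *: (t - s)).
have -> : m t = phi 1 by rewrite /phi scale1r addrC subrK.
have -> : m s = phi 0 by rewrite /phi scale0r addr0.
rewrite -[phi 1 - _]subr0; apply: increment_le => r r01.
  by apply: is_derive_line; apply: dm1; exact: open_simplex_segment.
rewrite subr0; apply: le_trans (ler_norm_sum _ _ _) _.
rewrite -mulrA -[d in d%:R * _](card_ord d) mulr_natl -sumr_const; apply: ler_sum => j _.
rewrite normrM mulrC; apply: ler_pM => //; last exact: coord_le_norm.
by have [] := hM _ (open_simplex_segment Os Ot r01).
Qed.

End second_order.

(** * Bias *)

Lemma within_continuous_measurable (R : realType) n (A : set 'rV[R]_n) (h : 'rV[R]_n -> R) :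
  measurable A -> {within A, continuous h} -> measurable_fun A h.
Proof.
move=> mA ch.
apply: (@measurability _ _ _ R A h _ (measurable_realfun.RGenOInfty.measurableE R)).
move=> _ [_ [r ->] <-].
have /continuousP/(_ _ (@interval_open _ (BRight r) (BInfty R false) isT isT)) := ch.
rewrite open_subspaceP => -[V oV VA].
by rewrite setIC -VA; apply: measurableI => //; exact: open_measurable_rV.
Qed.

Section bias.
Context {R : realType} (d : nat).
Local Notation S := (@simplex R d).
Local Notation O := (@open_simplex R d).
Implicit Types (s t v : 'rV[R]_d).

Definition quadratic_poly s (c1 : 'I_d -> R) (c2 : 'I_d -> 'I_d -> R) t : R :=
  \sum_j c1 j * (t ord0 j - s ord0 j) +
  \sum_j \sum_k c2 j k * ((t ord0 j - s ord0 j) * (t ord0 k - s ord0 k)).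

Lemma bm_quadratic_poly s c1 c2 : bounded_measurable (quadratic_poly s c1 c2).
Proof.
apply: bmD; apply: bm_sum => j; first by apply: bmZ; exact: bm_sub_coord.
by apply: bm_sum => k; apply: bmZ; apply: bmM; exact: bm_sub_coord.
Qed.

Lemma kernel_mean_quadratic_poly s b c1 c2 : S s -> 0 < b ->
  kernel_mean s b (quadratic_poly s c1 c2) =
  \sum_j c1 j * kernel_mean s b (fun t => t ord0 j - s ord0 j) +
  \sum_j \sum_k c2 j k *
    kernel_mean s b (fun t => (t ord0 j - s ord0 j) * (t ord0 k - s ord0 k)).
Proof.
move=> Ss b0; have ka := kernel_alpha_gt0 Ss b0; have kb := kernel_beta_gt0 Ss b0.
have bl j : bounded_measurable (fun t : 'rV[R]_d => c1 j * (t ord0 j - s ord0 j)).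
  by apply: bmZ; exact: bm_sub_coord.
have bq j k : bounded_measurable (fun t : 'rV[R]_d => c2 j k * ((t ord0 j - s ord0 j) * (t ord0 k - s ord0 k))).
  by apply: bmZ; apply: bmM; exact: bm_sub_coord.
have bqs j : bounded_measurable (fun t : 'rV[R]_d => \sum_k c2 j k * ((t ord0 j - s ord0 j) * (t ord0 k - s ord0 k))).
  by apply: bm_sum => k; exact: bq.
rewrite /kernel_mean meanD//; [|exact: bm_sum..].
rewrite !mean_sum//; congr (_ + _); apply: eq_bigr => j _.
  by rewrite meanZ//; exact: bm_sub_coord.
rewrite mean_sum//; apply: eq_bigr => k _; rewrite meanZ//.
by apply: bmM; exact: bm_sub_coord.
Qed.

Variable m : 'rV[R]_d -> R.
Hypothesis C2m : C2_on_simplex m.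
Local Notation D1 := (fun j => partial j m).
Local Notation D2 := (fun j k => partial j (partial k m)).

Lemma bm_regression : bounded_measurable m.
Proof.
have [cm _ _] := C2m; split.
  apply: measurable_funS (within_continuous_measurable _ cm).
  - exact: measurable_simplex.
  - exact: open_simplex_sub.
  - exact: measurable_simplex.
have [M [_ hM]] := simplex_bounded cm.
by exists M => t /open_simplex_sub; exact: hM.
Qed.

Let rem s c1 c2 t := m t - m s - quadratic_poly s c1 c2 t.

Let bm_rem s c1 c2 : bounded_measurable (rem s c1 c2).
Proof.
have := bmD (bmD bm_regression (bm_cst d (- m s))) (bmZ (-1) (bm_quadratic_poly s c1 c2)).
by under [X in bounded_measurable X -> _]eq_fun do rewrite mulN1r.
Qed.

Let mean_rem s b c1 c2 : S s -> 0 < b ->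
  kernel_mean s b m - m s =
  kernel_mean s b (rem s c1 c2) + kernel_mean s b (quadratic_poly s c1 c2).
Proof.
move=> Ss b0; have ka := kernel_alpha_gt0 Ss b0; have kb := kernel_beta_gt0 Ss b0.
have bm := bm_regression; have bc := bm_cst d (- m s).
have br := bm_rem s c1 c2; have bq := bm_quadratic_poly s c1 c2.
rewrite /kernel_mean -[- m s](mean_cst ka kb) -(meanD ka kb bm bc) -(meanD ka kb br bq).
by apply: eq_mean => t _; rewrite /rem subrK.
Qed.

(** The first moments and the mean of [sqdist] are both [O(b)], and the derivatives are bounded up
    to the boundary, so a first-order expansion yields a constant valid for all [s]. *)
Lemma kernel_bias_le : exists C, 0 <= C /\ forall s b, O s -> 0 < b <= 1 ->
  `|kernel_mean s b m - m s| <= C * b.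
Proof.
have [M [M0 hM]] := partials_bounded C2m.
exists (M * (d%:R * sqdist_const d) + \sum_(j < d) M * (d%:R + 1)); split.
  rewrite addr_ge0//; last by apply: sumr_ge0 => j _; rewrite mulr_ge0// addr_ge0.
  by rewrite /sqdist_const !mulr_ge0// addr_ge0// mulr_ge0// addr_ge0.
move=> s b Os b01; have /andP[b0 b1] := b01; have Ss := open_simplex_sub Os.
have ka := kernel_alpha_gt0 Ss b0; have kb := kernel_beta_gt0 Ss b0.
rewrite (mean_rem (fun j => D1 j s) (fun _ _ => 0))// mulrDl.
apply: le_trans (ler_normD _ _) _; apply: lerD.
  apply: (@le_trans _ _ (kernel_mean s b (fun t => M * (d%:R * sqdist s t)))).
    apply: (ler_norm_mean ka kb); first exact: (bm_rem s).
      by do 2 apply: bmZ; exact: bm_sqdist.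
    move=> t Ot; have := taylor1_le C2m M0 hM Os Ot.
    rewrite /rem /quadratic_poly [X in _ - (_ + X)]big1 ?addr0; last first.
      by move=> j _; apply: big1 => k _; rewrite mul0r.
    by under eq_bigr do rewrite mulrC.
  rewrite /kernel_mean meanZ//; last by apply: bmZ; exact: bm_sqdist.
  rewrite meanZ//; last exact: bm_sqdist.
  by rewrite -mulrA ler_wpM2l// -mulrA ler_wpM2l//; exact: kernel_mean_sqdist_le.
rewrite kernel_mean_quadratic_poly// [X in _ + X]big1 ?addr0; last first.
  by move=> j _; apply: big1 => k _; rewrite mul0r.
apply: le_trans (ler_norm_sum _ _ _) _; rewrite mulr_suml; apply: ler_sum => j _.
rewrite normrM -mulrA; apply: ler_pM => //; first by have [] := hM s Os.
exact: kernel_mean_bias_le.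
Qed.

(** The quadratic Taylor polynomial has an explicit mean, which yields [g_fun]. The remainder is at
    most a small multiple of [sqdist] near [s] and a multiple of [sqdist ^+ 2] elsewhere, hence has
    mean [o(b)]. *)
Lemma kernel_bias_cvg s : O s ->
  (kernel_mean s b m - m s) / b @[b --> 0^'+] --> g_fun m s.
Proof.
move=> Os; have Ss := open_simplex_sub Os.
pose c1 j := D1 j s; pose c2 j k := 2^-1 * D2 j k s.
have remE t : rem s c1 c2 t = m t - m s - \sum_j (t ord0 j - s ord0 j) * partial j m s -
    (\sum_k (t - s) ord0 k * \sum_j (t - s) ord0 j * partial j (partial k m) s) / 2.
  rewrite /rem /quadratic_poly opprD addrA; congr (_ - _ - _).
    by apply: eq_bigr => j _; rewrite mulrC.
  rewrite mulr_suml exchange_big; apply: eq_bigr => k _/=.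
  rewrite mulr_sumr mulr_suml; apply: eq_bigr => j _.
  by rewrite !mxE /c2; ring.
have [M [M0 hM]] := partials_bounded C2m.
have rem_le t : O t -> `|rem s c1 c2 t| <= 2 * M * d%:R * sqdist s t.
  move=> Ot; rewrite remE; apply: le_trans (ler_normB _ _) _.
  have h1 := taylor1_le C2m M0 hM Os Ot.
  have h2 := @quadratic_form_le R d (t - s) (fun j k => D2 j k s) M M0 (fun j k => (hM s Os).2 j k).
  rewrite -sqdistE in h2.
  rewrite normrM (ger0_norm (_ : 0 <= 2^-1)); last by rewrite invr_ge0.
  have Q0 : 0 <= M * (d%:R * sqdist s t) by rewrite !mulr_ge0// sqdist_ge0.
  apply: le_trans (lerD h1 (_ : _ <= M * (d%:R * sqdist s t))) _; last first.
    by rewrite [leRHS](_ : _ = M * (d%:R * sqdist s t) + M * (d%:R * sqdist s t))//; ring.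
  apply: (le_trans (y := M * (d%:R * sqdist s t) * 2^-1)); first by rewrite ler_wpM2r// invr_ge0.
  by rewrite ler_pdivrMr ?ltr0n// ler_peMr// ler1n.
have rem_cvg : kernel_mean s b (rem s c1 c2) / b @[b --> 0^'+] --> 0.
  apply/cvgrPdist_le => e e0.
  have K0 : 0 <= d%:R * sqdist_const d :> R.
    by rewrite /sqdist_const !mulr_ge0// addr_ge0// mulr_ge0// addr_ge0.
  (* Makes the mean of the near part at most [e / 2 * b]; the added 1 keeps the denominator
     positive. *)
  pose e1 := e / 2 / (d%:R * sqdist_const d + 1).
  have e10 : 0 < e1 by rewrite !divr_gt0// ltr_wpDl.
  have e1K : e1 * (d%:R * sqdist_const d) <= e / 2.
    rewrite -mulrA ler_piMr//; first by rewrite divr_ge0// ltW.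
    by rewrite mulrC ler_pdivrMr ?mul1r ?lerDl// ltr_wpDl.
  have [r r0 hr] := taylor2_near C2m Os e10.
  (* Outside the ball [sqdist] is at least [r ^+ 2], so dividing by [r ^+ 2] turns the global bound
     [rem_le] into one by [sqdist ^+ 2]. *)
  pose K := 2 * M * d%:R / r ^+ 2.
  have K00 : 0 <= K by rewrite divr_ge0// ?sqr_ge0// !mulr_ge0.
  have remle t : O t -> `|rem s c1 c2 t| <= e1 * d%:R * sqdist s t + K * sqdist s t ^+ 2.
    move=> Ot; have Q0 := sqdist_ge0 s t.
    have [ts|ts] := ltP `|t - s| r.
      rewrite remE; apply: le_trans (hr t Ot ts) _.
      by rewrite mulrA lerDl mulr_ge0// sqr_ge0.
    apply: le_trans (rem_le t Ot) _.
    apply: ler_wpDl; first exact: (mulr_ge0 (mulr_ge0 (ltW e10) (ler0n _ _)) Q0).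
    have rQ : r ^+ 2 <= sqdist s t.
      by apply: le_trans (norm_sqr_le_sqdist s t); rewrite lerXn2r ?nnegrE ?normr_ge0 ?(ltW r0).
    rewrite /K expr2 [leRHS]mulrA; apply: ler_wpM2r => //.
    rewrite -[leRHS]mulrA; apply: ler_peMr; first by rewrite !mulr_ge0.
    by rewrite [leRHS]mulrC ler_pdivlMr ?mulr_gt0 ?mul1r.
  have hQ2 : \forall b \near 0^'+, `|K * (kernel_mean s b (fun t => sqdist s t ^+ 2) / b)| <= e / 2.
    have : (K * (kernel_mean s b (fun t => sqdist s t ^+ 2) / b)) @[b --> 0^'+] --> K * 0.
      by apply: cvgM; [exact: cvg_cst|exact: kernel_mean_sqdist2_cvg].
    by rewrite mulr0 => /cvgr0Pnorm_le; apply; rewrite divr_gt0.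
  near=> b.
  have b0 : 0 < b by near: b; exact: nbhs_right_gt.
  have b1 : b <= 1 by near: b; exact: nbhs_right_le.
  have ka := kernel_alpha_gt0 Ss b0; have kb := kernel_beta_gt0 Ss b0.
  rewrite sub0r normrN normrM normfV (gtr0_norm b0) ler_pdivrMr//.
  apply: (@le_trans _ _ (kernel_mean s b (fun t => e1 * d%:R * sqdist s t + K * sqdist s t ^+ 2))).
    apply: (ler_norm_mean ka kb); first exact: (bm_rem s).
      by apply: bmD; apply: bmZ; [|apply: bmX]; exact: bm_sqdist.
    exact: remle.
  have bQ2 : bounded_measurable (fun t => sqdist s t ^+ 2) by apply: bmX; exact: bm_sqdist.
  have bQ := bm_sqdist s.
  rewrite /kernel_mean (meanD ka kb (bmZ (e1 * d%:R) bQ) (bmZ K bQ2)).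
  rewrite (meanZ ka kb _ bQ) (meanZ ka kb _ bQ2) -!/(kernel_mean _ _ _).
  have := @kernel_mean_sqdist_le R d s b Ss; rewrite b0 b1 => /(_ isT) hs.
  have hq : K * kernel_mean s b (fun t => sqdist s t ^+ 2) <= e / 2 * b.
    rewrite -ler_pdivrMr// -mulrA; apply: le_trans (ler_norm _) _.
    by near: b.
  rewrite [X in _ <= X * _](splitr e) mulrDl; apply: lerD hq.
  apply: (le_trans (y := e1 * d%:R * (sqdist_const d * b))).
    by apply: ler_wpM2l => //; rewrite mulr_ge0// ltW.
  rewrite [leLHS](_ : _ = e1 * (d%:R * sqdist_const d) * b); last by rewrite -!mulrA.
  exact: (ler_wpM2r (ltW b0) e1K).
have -> : g_fun m s = 0 + (\sum_j c1 j * (1 - (d%:R + 1) * s ord0 j) +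
    \sum_j \sum_k c2 j k * (s ord0 j * ((j == k)%:R - s ord0 k))).
  rewrite /g_fun patchE mem_set// add0r; congr (_ + _).
    by apply: eq_bigr => j _; rewrite mulrC.
  rewrite mulr_sumr; apply: eq_bigr => j _; rewrite mulr_sumr; apply: eq_bigr => k _.
  by rewrite /c2; ring.
apply: (@cvg_trans _ ((fun b => kernel_mean s b (rem s c1 c2) / b +
  (\sum_j c1 j * (kernel_mean s b (fun t => t ord0 j - s ord0 j) / b) +
   \sum_j \sum_k c2 j k *
    (kernel_mean s b (fun t => (t ord0 j - s ord0 j) * (t ord0 k - s ord0 k)) / b))) @ 0^'+)).
  apply: near_eq_cvg; near=> b.
  have b0 : 0 < b by near: b; exact: nbhs_right_gt.
  rewrite (mean_rem c1 c2 Ss b0) kernel_mean_quadratic_poly// !mulrDl; congr (_ + (_ + _)).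
    by rewrite mulr_suml; apply: eq_bigr => j _; rewrite mulrA.
  rewrite mulr_suml; apply: eq_bigr => j _; rewrite mulr_suml; apply: eq_bigr => k _.
  by rewrite mulrA.
apply: cvgD => //; apply: cvgD; apply: cvg_sumr => j.
  by apply: cvgM; [exact: cvg_cst|exact: kernel_mean_bias_cvg].
apply: cvg_sumr => k.
by apply: cvgM; [exact: cvg_cst|exact: kernel_mean_cov_cvg].
Unshelve. all: by end_near.
Qed.

End bias.

Local Opaque kernel_sq_norm.

(** * Cells represented by their design points *)

Section design_cells.
Context {R : realType} (d : nat).
Hypothesis d_gt0 : (0 < d)%N.
Local Notation leb := (lebesgue_rV d : measure _ R).
Local Notation S := (@simplex R d).
Local Notation O := (@open_simplex R d).
Implicit Types (s t v : 'rV[R]_d) (h : 'rV[R]_d -> R).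

Lemma lipschitz_simplex_le h : [lipschitz h s | s in S] ->
  exists L, 0 <= L /\ forall s t, S s -> S t -> `|h s - h t| <= L * `|s - t|.
Proof.
move=> lh.
have [L [L0 hL]] : exists L : R, 0 <= L /\ (L).-lipschitz_S h.
  near (pinfty_nbhs R) => L; exists L; split; near: L; first exact: nbhs_pinfty_ge.
  exact: lh.
by exists L; split=> // s t Ss St; exact: (hL (s, t)).
Unshelve. all: by end_near.
Qed.

Lemma lipschitz_simplex_continuous h : [lipschitz h s | s in S] -> {within S, continuous h}.
Proof.
move=> /lipschitz_simplex_le[L [L0 hL]]; apply/subspace_continuousP => s Ss.
apply/cvgrPdist_le => e e0.
rewrite near_withinE; apply: (@nbhs_norm_le _ _ s (e / (L + 1))).
  by rewrite divr_gt0// ltr_wpDl.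
move=> t; rewrite distrC => st St; apply: le_trans (hL s t Ss St) _.
apply: (@le_trans _ _ ((L + 1) * (e / (L + 1)))).
  by apply: ler_pM => //; [rewrite lerDl|exact: ltW].
by rewrite mulrC divfK// gt_eqF// ltr_wpDl.
Qed.

Lemma simplex_bounded_measurable h : {within S, continuous h} -> bounded_measurable h.
Proof.
move=> ch; split.
  apply: measurable_funS (within_continuous_measurable _ ch).
  - exact: measurable_simplex.
  - exact: open_simplex_sub.
  - exact: measurable_simplex.
have [M [_ hM]] := simplex_bounded ch.
by exists M => t /open_simplex_sub; exact: hM.
Qed.

Section one_row.
Variables (n : nat) (B : 'I_n -> set 'rV[R]_d) (x : 'I_n -> 'rV[R]_d) (D : R).
Hypotheses (cB : forall i, compact (B i))
  (disj : forall i j, i != j -> (B i)° `&` (B j)° = set0)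
  (cover : \bigcup_i B i = S)
  (fr : forall i, leb (frontier (B i)) = 0%E).
Hypotheses (xO : forall i, O (x i)) (Bx : forall i t, B i t -> `|t - x i| <= D).

Let BS i : B i `<=` S.
Proof. by move=> t Bt; rewrite -cover; exists i. Qed.

Let bmB i : bounded_measurable (\1_(B i) : 'rV[R]_d -> R).
Proof. by apply: bm_indic; exact: compact_measurable_rV. Qed.

(** The mean of the Gasser-Mueller estimator, for [s] in the simplex, by [kernel_cell_weight]. *)
Definition cell_mean (m : 'rV[R]_d -> R) s b := \sum_i m (x i) * kernel_mean s b \1_(B i).

Lemma cell_mean_near m L s b : 0 <= L -> 0 <= D -> bounded_measurable m ->
  (forall s t, O s -> O t -> `|m t - m s| <= L * `|t - s|) -> S s -> 0 < b ->
  `|cell_mean m s b - kernel_mean s b m| <= L * D.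
Proof.
move=> L0 D0 bm lm Ss b0; have ka := kernel_alpha_gt0 Ss b0; have kb := kernel_beta_gt0 Ss b0.
rewrite -(sum_kernel_mean_cells cB disj cover fr Ss b0 bm) -sumrB.
have -> : L * D = \sum_i L * D * kernel_mean s b \1_(B i).
  rewrite -mulr_sumr -[LHS]mulr1; congr (_ * _).
  transitivity (kernel_mean s b (fun=> 1)); first by rewrite /kernel_mean (mean_cst ka kb).
  rewrite -(sum_kernel_mean_cells cB disj cover fr Ss b0 (bm_cst d 1)).
  by apply: eq_bigr => i _; apply: eq_mean => t _; rewrite mul1r.
apply: le_trans (ler_norm_sum _ _ _) _; apply: ler_sum => i _.
rewrite /kernel_mean -!meanZ// -[X in _ - X]mul1r -mulNr -meanZ//; last exact: bmM.
have b1 : bounded_measurable (fun t => m (x i) * \1_(B i) t) by exact: bmZ.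
have b2 : bounded_measurable (fun t => -1 * (m t * \1_(B i) t)) by apply: bmZ; exact: bmM.
rewrite -(meanD ka kb b1 b2); apply: (ler_norm_mean ka kb); first exact: bmD.
  exact: bmZ.
move=> t Ot; rewrite mulN1r -mulrBl normrM distrC indicE.
have [Bt|Bt] := boolP (t \in B i); last by rewrite normr0 !mulr0.
rewrite normr1 !mulr1; apply: le_trans (lm (x i) t _ Ot) _; first exact: xO.
by apply: ler_wpM2l => //; apply: Bx; rewrite -inE.
Qed.

(** Combined with the prescribed masses, this determines cell volumes: [n] times the volume times
    [f (x i)] is close to 1. *)
Lemma cell_mass_near (f : 'rV[R]_d -> R) L i : 0 <= L -> 0 <= D -> bounded_measurable f ->
  measurable_fun S f ->
  (forall s t, S s -> S t -> `|f s - f t| <= L * `|s - t|) ->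
  `|\int[leb]_(t in B i) f t - f (x i) * open_integral \1_(B i)|
    <= L * D * open_integral \1_(B i).
Proof.
move=> L0 D0 bf mf lf.
have mB : measurable (B i) by exact: compact_measurable_rV.
rewrite (Rintegral_cell d_gt0 mB (@BS i) mf (bm_integrable_open bf)) /open_integral.
have b1 : bounded_measurable (fun t => \1_(B i) t * f t) by exact: bmM.
have b2 (c : R) : bounded_measurable (fun t => c * \1_(B i) t) by exact: bmZ.
have mO := @measurable_open_simplex R d.
rewrite -!RintegralZl//; try exact: bm_integrable_open.
rewrite -RintegralB//; try exact: bm_integrable_open.
have b3 : bounded_measurable (fun t => \1_(B i) t * f t - f (x i) * \1_(B i) t).
  have := bmD b1 (b2 (- f (x i))).
  by under [X in bounded_measurable X -> _]eq_fun do rewrite mulNr.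
apply: le_trans (le_normr_Rintegral mO (bm_integrable_open b3)) _.
apply: le_Rintegral => //; [|exact: bm_integrable_open|].
  exact: integrable_norm (bm_integrable_open b3).
move=> t Ot; rewrite [f (x i) * _]mulrC -mulrBr normrM mulrC indicE.
have [Bt|Bt] := boolP (t \in B i); last by rewrite normr0 !mulr0.
rewrite normr1 !mulr1; apply: le_trans (lf t (x i) _ _) _.
- exact: open_simplex_sub.
- exact: open_simplex_sub.
- by apply: ler_wpM2l => //; apply: Bx; rewrite -inE.
Qed.

Lemma cell_mass_ge (f : 'rV[R]_d -> R) c i : bounded_measurable f ->
  measurable_fun S f -> (forall s, S s -> c <= f s) ->
  c * open_integral \1_(B i) <= \int[leb]_(t in B i) f t.
Proof.
move=> bf mf cf.
have mB : measurable (B i) by exact: compact_measurable_rV.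
rewrite (Rintegral_cell d_gt0 mB (@BS i) mf (bm_integrable_open bf)) /open_integral.
have mO := @measurable_open_simplex R d.
rewrite -!RintegralZl//; try exact: bm_integrable_open.
apply: le_Rintegral => //; try (apply: bm_integrable_open).
- exact: bmZ.
- exact: bmM.
- move=> t Ot; rewrite mulrC ler_wpM2l//; last by apply: cf; exact: open_simplex_sub.
Qed.

End one_row.
End design_cells.

(** * Variance *)

Local Opaque open_integral.

Section row_variance.
Context {R : realType} (d : nat).
Hypothesis d_gt0 : (0 < d)%N.
Local Notation leb := (@lebesgue_rV R d).
Local Notation S := (@simplex R d).
Local Notation O := (@open_simplex R d).
Variables (n : nat) (B : 'I_n -> set 'rV[R]_d).
Hypotheses (cB : forall i, compact (B i)) (BS : forall i, B i `<=` S)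
  (disj : forall i j, i != j -> (B i)° `&` (B j)° = set0)
  (cover : \bigcup_i B i = S) (fr : forall i, leb (frontier (B i)) = 0%E).
Variables (sig : 'I_n -> R) (T : R).
Hypothesis sig0 : forall i, 0 <= sig i.
(** In the application this is close to [sigmasq / f] at the design point; the row estimates use
    only an upper bound and the values near [s]. *)
Let theta i := n%:R * sig i * open_integral \1_(B i).
Hypothesis thetaT : forall i, theta i <= T.

Definition row_variance s b : R := \sum_i sig i * kernel_mean s b \1_(B i) ^+ 2.

Let mB i : measurable (B i). Proof. exact: compact_measurable_rV. Qed.

Let p s b i := kernel_mean s (b / 2) \1_(B i).

Let sum_p s b : S s -> 0 < b -> \sum_i p s b i = 1.
Proof.
move=> Ss b0; have b20 : 0 < b / 2 by rewrite divr_gt0.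
transitivity (\sum_i kernel_mean s (b / 2) (fun t => 1 * \1_(B i) t)).
  by apply: eq_bigr => i _; apply: eq_mean => t _; rewrite mul1r.
rewrite (sum_kernel_mean_cells cB disj cover fr Ss b20 (bm_cst d 1)).
exact: (mean1 (kernel_alpha_gt0 Ss b20) (kernel_beta_gt0 Ss b20)).
Qed.

Let p_ge0 s b i : S s -> 0 < b -> 0 <= p s b i.
Proof. by move=> Ss b0; apply: kernel_mean_indic_ge0; rewrite ?divr_gt0. Qed.

Let term_le s b i : S s -> 0 < b ->
  n%:R * (sig i * kernel_mean s b \1_(B i) ^+ 2) <= theta i * (kernel_sq_norm s b * p s b i).
Proof.
move=> Ss b0; rewrite /theta -[X in _ <= X]mulrA -[X in _ <= X]mulrA.
apply: ler_wpM2l => //; apply: ler_wpM2l => //.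
exact: (cell_weight_sqr_le Ss b0 (mB i)).
Qed.

Lemma row_variance_ge0 s b : 0 <= row_variance s b.
Proof. by apply: sumr_ge0 => i _; rewrite mulr_ge0 ?sqr_ge0. Qed.

Lemma row_variance_le s b : S s -> 0 < b ->
  n%:R * row_variance s b <= T * kernel_sq_norm s b.
Proof.
move=> Ss b0; have q0 := kernel_sq_norm_gt0 Ss b0.
rewrite /row_variance mulr_sumr.
apply: (@le_trans _ _ (\sum_i T * (kernel_sq_norm s b * p s b i))).
  apply: ler_sum => i _; apply: le_trans (term_le i Ss b0) _.
  by apply: ler_wpM2r => //; apply: mulr_ge0; [exact: ltW | exact: p_ge0].
by rewrite -!mulr_sumr sum_p// mulr1.
Qed.

(* The three error terms come from the oscillation of [theta], from that of the kernel
   on the cells near [s], and from the far cells. *)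
Lemma row_variance_near s b (x : 'I_n -> 'rV[R]_d) (v0 e0 e r h : R) :
  O s -> 0 < b <= 1 -> 0 <= v0 -> 0 <= e0 -> 0 < e -> 0 < r -> 0 <= h <= r / 2 ->
  (forall i, B i (x i)) ->
  (forall i t, B i t -> `|t - x i| <= h) ->
  (forall i, `|x i - s| < r -> `|theta i - v0| <= e0) ->
  (forall t, O t -> `|t - s| <= 2 * r -> (forall j, e <= t ord0 j) /\ e <= 1 - \sum_j t ord0 j) ->
  `|n%:R * row_variance s b - kernel_sq_norm s b * v0| <=
  kernel_sq_norm s b *
    (e0 + T * (d%:R * (2 * h) / (e * b)) + (T + v0) * (4 / r ^+ 2) * (sqdist_const d * b)).
Proof.
move=> Os /andP[b0 b1] v00 e00 ep rp /andP[h0 hr] Bx hB near inner.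
have Ss := open_simplex_sub Os.
have b20 : 0 < b / 2 by rewrite divr_gt0.
have b21 : b / 2 <= 1 by rewrite ler_pdivrMr//; lra.
set q := kernel_sq_norm s b; have q0 : 0 < q := kernel_sq_norm_gt0 Ss b0.
set K := d%:R * (2 * h) / (e * b).
have K0 : 0 <= K by apply: divr_ge0; [rewrite !mulr_ge0 | apply/ltW/mulr_gt0].
pose m2 i := kernel_mean s (b / 2) (fun t => sqdist s t * \1_(B i) t).
have ka := kernel_alpha_gt0 Ss b20; have kb := kernel_beta_gt0 Ss b20.
have m20 i : 0 <= m2 i.
  by apply: (mean_ge0 ka kb) => t _; rewrite mulr_ge0 ?sqdist_ge0// indicE.
have th0 i : 0 <= theta i.
  by rewrite /theta mulr_ge0 ?mulr_ge0// cell_length_ge0.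
have sum_m2 : \sum_i m2 i <= sqdist_const d * b.
  rewrite /m2 (sum_kernel_mean_cells cB disj cover fr Ss b20 (bm_sqdist s)).
  apply: le_trans (kernel_mean_sqdist_le Ss _) _; first by rewrite b20.
  apply: ler_wpM2l; first by rewrite /sqdist_const mulr_ge0 ?addr_ge0 ?mulr_ge0 ?addr_ge0.
  by lra.
have key i : `|n%:R * (sig i * kernel_mean s b \1_(B i) ^+ 2) - q * v0 * p s b i| <=
    q * ((e0 + T * K) * p s b i + (T + v0) * (4 / r ^+ 2) * m2 i).
  have pi0 := p_ge0 i Ss b0.
  set y := n%:R * _.
  have y0 : 0 <= y.
    by apply: mulr_ge0 => //; apply: mulr_ge0 => //; exact: sqr_ge0.
  have yle : y <= theta i * (q * p s b i) := term_le i Ss b0.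
  have T0 : 0 <= T by exact: le_trans (thetaT i).
  have qp0 : 0 <= q * p s b i by rewrite mulr_ge0// ltW.
  have w1 : 0 <= (e0 + T * K) * p s b i.
    by apply: mulr_ge0; [apply: addr_ge0; [exact: e00 | exact: mulr_ge0] | exact: pi0].
  have r40 : 0 <= 4 / r ^+ 2 by apply: divr_ge0; [exact: ler0n | exact: sqr_ge0].
  have w2 : 0 <= (T + v0) * (4 / r ^+ 2) * m2 i.
    apply: mulr_ge0; last exact: m20.
    by apply: mulr_ge0; [exact: addr_ge0 | exact: r40].
  have [xs|xs] := ltP `|x i - s| r.
    have bB t : B i t -> `|t - s| <= 2 * r.
      move=> Bt; rewrite (_ : t - s = (t - x i) + (x i - s)); last by rewrite addrA subrK.
      by apply: le_trans (ler_normD _ _) _; have := hB i t Bt; lra.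
    (* Two points of a cell are within [2 h], so on a cell near [s] the kernel varies by a factor at
       least [expR (- K)], and the reverse Cauchy-Schwarz inequality applies. *)
    have yge : expR (- K) * (theta i * (q * p s b i)) <= y.
      have -> : expR (- K) * (theta i * (q * p s b i)) =
          n%:R * (sig i * (expR (- K) * (open_integral \1_(B i) * (q * p s b i)))).
        by rewrite /theta; move: (q * p s b i) (expR _) => z1 z2; ring.
      rewrite /y; apply: ler_wpM2l; first exact: ler0n.
      apply: ler_wpM2l; first exact: sig0.
      apply: (cell_weight_sqr_ge Ss b0 (mB i)); first exact: expR_ge0.
      move=> t u Ot Ou Bt Bu; have [uj us] := inner u Ou (bB u Bu).
      apply: kappa_variation => //.
      rewrite (_ : t - u = (t - x i) - (u - x i)); last by rewrite opprB addrA subrK.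
      apply: le_trans (ler_normB _ _) _.
      by have := hB i t Bt; have := hB i u Bu; lra.
    have eK : 1 - K <= expR (- K) by have := expR_ge1Dx (- K).
    have yge2 : (1 - K) * (theta i * (q * p s b i)) <= y.
      by apply: le_trans yge; apply: ler_wpM2r => //; rewrite mulr_ge0.
    have nn := near i xs.
    have TK : theta i * K <= T * K by apply: ler_wpM2r.
    apply: (@le_trans _ _ (q * ((e0 + T * K) * p s b i))); last first.
      apply: ler_wpM2l; first exact: ltW.
      by rewrite lerDl.
    have -> : q * v0 * p s b i = v0 * (q * p s b i) by ring.
    have -> : q * ((e0 + T * K) * p s b i) = (e0 + T * K) * (q * p s b i) by ring.
    move: (q * p s b i) qp0 yle yge2 => z z0 yle yge2.
    move: nn; rewrite !ler_norml => /andP[n1 n2].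
    have n1z := ler_wpM2r z0 n1; have n2z := ler_wpM2r z0 n2.
    have TKz := ler_wpM2r z0 TK.
    have TKz0 : 0 <= T * K * z by apply: mulr_ge0 => //; exact: mulr_ge0.
    by apply/andP; split; lra.
  apply: (@le_trans _ _ (q * ((T + v0) * (4 / r ^+ 2) * m2 i))); last first.
    apply: ler_wpM2l; first exact: ltW.
    by rewrite lerDr.
  (* Chebyshev on one cell: its design point is at distance at least [r] from [s] and its points are
     within [r / 2] of it, so [sqdist] is at least [r ^+ 2 / 4] there. *)
  have pm : p s b i <= 4 / r ^+ 2 * m2 i.
    rewrite /p /m2 /kernel_mean -(meanZ ka kb); last first.
      by apply: bmM; [exact: bm_sqdist | exact: bm_indic].
    apply: (le_mean ka kb).
    - exact: bm_indic.
    - by apply: bmZ; apply: bmM; [exact: bm_sqdist | exact: bm_indic].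
    move=> t Ot; rewrite indicE; case: (boolP (t \in B i)) => tB; last by rewrite !mulr0.
    rewrite mulr1; have ts : r / 2 <= `|t - s|.
      have := hB i t; rewrite -inE => /(_ tB) => ht.
      have : `|x i - s| <= `|t - x i| + `|t - s|.
        rewrite (_ : x i - s = (x i - t) + (t - s)); last by rewrite addrA subrK.
        by rewrite [`|t - x i|]distrC; exact: ler_normD.
      by lra.
    have : (r / 2) ^+ 2 <= sqdist s t.
      apply: le_trans (norm_sqr_le_sqdist s t).
      by rewrite ler_sqr ?nnegrE// divr_ge0// ltW.
    move=> hh; apply: (@le_trans _ _ (4 / r ^+ 2 * (r / 2) ^+ 2)); last exact: ler_wpM2l.
    rewrite (_ : 4 / r ^+ 2 * (r / 2) ^+ 2 = 1)//.
    by field; rewrite gt_eqF.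
  have z1 : (T + v0) * (q * p s b i) <= q * ((T + v0) * (4 / r ^+ 2) * m2 i).
    rewrite mulrCA; apply: ler_wpM2l; first exact: ltW.
    by rewrite -[X in _ <= X]mulrA; apply: ler_wpM2l; [exact: addr_ge0 | exact: pm].
  apply: le_trans z1.
  have -> : q * v0 * p s b i = v0 * (q * p s b i) by ring.
  move: (q * p s b i) qp0 yle => z z0 yle.
  have tz : theta i * z <= T * z by apply: ler_wpM2r.
  have vz : 0 <= v0 * z by rewrite mulr_ge0.
  have Tz : 0 <= T * z by rewrite mulr_ge0.
  by rewrite ler_norml; apply/andP; split; lra.
have qv : q * v0 = \sum_i q * v0 * p s b i by rewrite -mulr_sumr sum_p// mulr1.
rewrite /row_variance mulr_sumr [X in _ - X]qv -sumrB.
apply: le_trans (ler_norm_sum _ _ _) _.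
apply: (@le_trans _ _ (\sum_i q * ((e0 + T * K) * p s b i + (T + v0) * (4 / r ^+ 2) * m2 i))).
  by apply: ler_sum => i _; exact: key.
rewrite -mulr_sumr; apply: ler_wpM2l; first exact: ltW.
rewrite big_split/= -!mulr_sumr sum_p// mulr1 lerD2l.
(* The sign of [T] is read off some [theta i], which requires an index; an empty row contradicts
   [sum_p]. *)
case: (posnP n) => [n0|npos].
  have : \sum_i p s b i = 1 := sum_p Ss b0.
  rewrite big1 => [/esym/eqP|i _]; first by rewrite oner_eq0.
  by have := ltn_ord i; rewrite {2}n0.
have T0 : 0 <= T by apply: le_trans (thetaT (Ordinal npos)).
apply: ler_wpM2l; last exact: sum_m2.
apply: mulr_ge0; first exact: addr_ge0.
by apply: divr_ge0; [exact: ler0n | exact: sqr_ge0].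
Qed.

End row_variance.

(** * Triangular arrays *)

Local Opaque kernel_mean.

Section triangular_array.
Context {R : realType} (d : nat).
Hypothesis d_gt0 : (0 < d)%N.
Local Notation leb := (lebesgue_rV d : measure _ R).
Local Notation S := (@simplex R d).
Local Notation O := (@open_simplex R d).
Implicit Types (s t v : 'rV[R]_d) (h : 'rV[R]_d -> R).
Variables (f sigmasq m : 'rV[R]_d -> R).
Variables (x : forall n : nat, 'I_n -> 'rV[R]_d) (B : forall n : nat, 'I_n -> set 'rV[R]_d).
Arguments x : clear implicits.
Arguments B : clear implicits.
Hypothesis xO : forall n i, O (x n i).
Hypothesis hA1 : regularity f sigmasq m.
Hypothesis hA2 : positivity f sigmasq.
Hypothesis hA4 : cells f x B.
Local Notation rho := (fun n : nat => n%:R `^ (- d%:R^-1) : R).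
Local Notation L n i := (open_integral (\1_(B n i) : 'rV[R]_d -> R)).

Lemma cell_sub n i : B n i `<=` S.
Proof. by have [] := cells_convex_compact hA4 i. Qed.

Lemma cell_compact n i : compact (B n i).
Proof. by have [] := cells_convex_compact hA4 i. Qed.

Lemma cell_near : exists K, 0 <= K /\ \forall n \near \oo, forall i,
  [/\ forall t, B n i t -> `|t - x n i| <= K * rho n,
      n%:R * L n i <= K & `|n%:R * L n i * f (x n i) - 1| <= K * rho n].
Proof.
have [[lf _ _] [[s0 Ss0 [fmin f0]] _]] := (hA1, hA2).
have [Lf [Lf0 hLf]] := lipschitz_simplex_le lf.
have cf := lipschitz_simplex_continuous lf.
have bf := simplex_bounded_measurable cf.
have mf : measurable_fun S f by apply: within_continuous_measurable => //; exact: measurable_simplex.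
have [C0 hdiam] := cells_diam hA4; have [C1 hmass] := cells_mass hA4.
pose D := Num.max C0 0; pose M := Num.max C1 0.
have D0 : 0 <= D by rewrite le_max lexx orbT.
have M0 : 0 <= M by rewrite le_max lexx orbT.
(* For large [n] the mass of a cell is at most [(1 + M) / n], and [f s0] is the minimum of [f], so
   [n] times the volume is at most [K]. *)
pose K := (1 + M) / f s0.
have K0 : 0 <= K by rewrite divr_ge0 ?addr_ge0 ?ler01 ?(ltW f0).
have LDK0 := mulr_ge0 (mulr_ge0 Lf0 D0) K0.
exists (D + K + (M + Lf * D * K)); split; first exact: addr_ge0 (addr_ge0 D0 K0) (addr_ge0 M0 LDK0).
near=> n.
have hd : forall i, diam (B n i) <= C0 * rho n by near: n; exact: hdiam.
have hm : forall i, `|\int[leb]_(t in B n i) f t - n%:R^-1| <= C1 * n%:R `^ (- 1 - d%:R^-1).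
  by near: n; exact: hmass.
have n0 : (0 < n)%N by near: n; exact: nbhs_infty_gt.
have nR0 : 0 < n%:R :> R by rewrite ltr0n.
have rho0 : 0 <= rho n by exact: powR_ge0.
have rho1 : rho n <= 1.
  rewrite -[leRHS](powRr0 n%:R) /=.
  by apply: ler_powR; rewrite ?ler1n// oppr_le0 invr_ge0.
have hD i t : B n i t -> `|t - x n i| <= D * rho n.
  move=> Bt; apply: le_trans (diam_ge (compact_bounded (@cell_compact n i)) Bt (_ : B n i (x n i))) _.
    by apply: interior_subset; exact: cells_design hA4 _ _.
  apply: le_trans (hd i) _.
  by rewrite ler_wpM2r// le_max lexx.
move=> i.
have hM : `|\int[leb]_(t in B n i) f t - n%:R^-1| <= M * rho n / n%:R.
  apply: le_trans (hm i) _.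
  rewrite powRD; last by rewrite (gt_eqF nR0) implybT.
  rewrite powR_inv1 ?ler0n// mulrCA mulrC ler_wpM2r ?invr_ge0//.
  by rewrite ler_wpM2r// le_max lexx.
have [cB disj cover fr] : [/\ forall i, compact (B n i),
    forall i j, i != j -> (B n i)° `&` (B n j)° = set0, \bigcup_i B n i = S &
    forall i, leb (frontier (B n i)) = 0%E].
  split; [exact: cell_compact|exact: cells_interior_disjoint hA4 _|exact: cells_cover hA4 _ n0|exact: cells_frontier hA4 _].
have L0 : 0 <= L n i by exact: cell_length_ge0.
have nI : `|n%:R * \int[leb]_(t in B n i) f t - 1| <= M * rho n.
  have -> : n%:R * \int[leb]_(t in B n i) f t - 1 = n%:R * (\int[leb]_(t in B n i) f t - n%:R^-1).
    by rewrite mulrBr mulfV// gt_eqF.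
  rewrite normrM (gtr0_norm nR0) mulrC -ler_pdivlMr//.
have Mrho : M * rho n <= M by rewrite ler_piMr.
have nLK : n%:R * L n i <= K.
  rewrite /K ler_pdivlMr//.
  have h := cell_mass_ge d_gt0 cB cover i bf mf fmin.
  have := ler_wpM2l (ltW nR0) h.
  move: nI; rewrite ler_norml => /andP[_ nI]; move: nI Mrho.
  move: (n%:R * _) => I; rewrite mulrCA mulrC.
  move: (n%:R * _) (rho n) => u w; lra.
split.
- move=> t /(hD i) h; apply: le_trans h _; rewrite ler_wpM2r// -!addrA lerDl.
  exact: addr_ge0 K0 (addr_ge0 M0 LDK0).
- apply: le_trans nLK _; rewrite [leRHS](_ : _ = K + (D + (M + Lf * D * K))); last by ring.
  by rewrite lerDl; exact: addr_ge0 D0 (addr_ge0 M0 LDK0).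
- have lfS s t : S s -> S t -> `|f s - f t| <= Lf * `|s - t| by exact: hLf.
  have := @cell_mass_near R d d_gt0 n (B n) (x n) (D * rho n) cB cover (@xO n) hD f Lf i Lf0 (mulr_ge0 D0 rho0) bf mf lfS.
  move=> /(ler_wpM2l (ltW nR0)); rewrite -{1}(gtr0_norm nR0) -normrM mulrBr.
  have e1 : n%:R * (Lf * (D * rho n) * L n i) <= Lf * D * K * rho n.
    rewrite [leLHS](_ : _ = Lf * D * (n%:R * L n i) * rho n); last by ring.
    by rewrite ler_wpM2r// ler_wpM2l// mulr_ge0.
  have e2 : n%:R * (f (x n i) * L n i) = n%:R * L n i * f (x n i) by ring.
  rewrite e2 => /le_trans/(_ e1); move: nI.
  have e3 : (D + K + (M + Lf * D * K)) * rho n = (D + K) * rho n + (M * rho n + Lf * D * K * rho n).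
    by ring.
  have : 0 <= (D + K) * rho n by rewrite mulr_ge0// addr_ge0.
  rewrite e3; move: (n%:R * \int[leb]_(t in B n i) f t) (n%:R * L n i * f (x n i)) (M * rho n) (Lf * D * K * rho n) ((D + K) * rho n).
  by move=> a b c e g g0; rewrite !ler_norml => /andP[a1 a2] /andP[b1 b2]; apply/andP; split; lra.
Unshelve. all: by end_near.
Qed.

(** Used with [a] and [c] the values of [sigmasq] and [f] at a design point, [a'] and [c'] those at
    [s], and [u] equal to [n] times the cell volume. The errors come from replacing [u] by [1 / c],
    [a] by [a'] and [c] by [c']. *)
Let ratio_near (a u c a' c' : R) (A F E1 E2 E3 : R) : 0 < F -> 0 <= A -> F <= c -> F <= c' ->
  0 <= a <= A -> 0 <= a' <= A -> `|u * c - 1| <= E1 -> `|a - a'| <= E2 -> `|c - c'| <= E3 ->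
  `|a * u - a' / c'| <= A * E1 / F + E2 / F + A * E3 / F ^+ 2.
Proof.
move=> F0 A0 Fc Fc' /andP[a0 aA] /andP[a'0 a'A] h1 h2 h3.
have c0 : 0 < c by exact: lt_le_trans Fc.
have c'0 : 0 < c' by exact: lt_le_trans Fc'.
have -> : a * u - a' / c' = a * (u * c - 1) / c + (a - a') / c + a' * (c' - c) / (c * c').
  by field; rewrite ?gt_eqF.
have hle (p q z : R) : `|p| <= q -> F <= z -> `|p / z| <= q / F.
  move=> pq Fz; have z0 := lt_le_trans F0 Fz.
  rewrite normrM normfV (gtr0_norm z0); apply: ler_pM => //; first by rewrite invr_ge0 ltW.
  by rewrite lef_pV2.
apply: le_trans (ler_normD _ _) _; apply: lerD.
  apply: le_trans (ler_normD _ _) _; apply: lerD; apply: hle => //.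
  by rewrite normrM (ger0_norm a0); apply: ler_pM.
have cc0 : 0 < c * c' by rewrite mulr_gt0.
rewrite normrM normfV (gtr0_norm cc0); apply: ler_pM => //; first by rewrite invr_ge0 ltW.
  by rewrite normrM (ger0_norm a'0) distrC; apply: ler_pM.
rewrite lef_pV2 ?posrE ?exprn_gt0// expr2; apply: ler_pM => //; exact: ltW.
Qed.

Lemma sigmasq_ge0 s : S s -> 0 <= sigmasq s.
Proof. by have [_ [s1 _ [h h1]]] := hA2; move=> Ss; apply: le_trans (h s Ss); exact: ltW. Qed.

Lemma variance_density_ratio_near : exists T, 0 <= T /\ \forall n \near \oo, forall i,
  n%:R * sigmasq (x n i) * L n i <= T /\
  forall s, S s -> `|n%:R * sigmasq (x n i) * L n i - sigmasq s / f s|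
    <= T * (rho n + `|x n i - s|).
Proof.
have [[lf ls _] [[s0 Ss0 [fmin f0]] _]] := (hA1, hA2).
have [Lf [Lf0 hLf]] := lipschitz_simplex_le lf.
have [Ls [Ls0 hLs]] := lipschitz_simplex_le ls.
have [A [A0 hA]] := simplex_bounded (lipschitz_simplex_continuous ls).
have sA s : S s -> 0 <= sigmasq s <= A.
  by move=> Ss; rewrite sigmasq_ge0//= (le_trans (ler_norm _))// hA.
have [K [K0 hK]] := cell_near.
pose F := f s0; have F0 : 0 < F by [].
have T1 : 0 <= A * K by exact: mulr_ge0.
have T2 : 0 <= A * K / F by apply: divr_ge0 => //; exact: ltW.
have T3 : 0 <= Ls / F by apply: divr_ge0 => //; exact: ltW.
have T4 : 0 <= A * Lf / F ^+ 2 by rewrite divr_ge0 ?sqr_ge0// mulr_ge0.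
exists (A * K + (A * K / F + (Ls / F + A * Lf / F ^+ 2))); split.
  exact: addr_ge0 T1 (addr_ge0 T2 (addr_ge0 T3 T4)).
apply: filterS hK => n hn i; have [_ h1 h2] := hn i.
have xS : S (x n i) by exact: open_simplex_sub.
have L0 : 0 <= L n i by exact: cell_length_ge0.
have /andP[sx0 sxA] := sA _ xS.
split.
  apply: (@le_trans _ _ (A * K)); last by rewrite lerDl; exact: addr_ge0 T2 (addr_ge0 T3 T4).
  by rewrite [n%:R * _]mulrC -mulrA; apply: ler_pM => //; rewrite mulr_ge0.
move=> s Ss.
have -> : n%:R * sigmasq (x n i) * L n i = sigmasq (x n i) * (n%:R * L n i) by ring.
have := @ratio_near (sigmasq (x n i)) (n%:R * L n i) (f (x n i)) (sigmasq s) (f s) A F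
  (K * rho n) (Ls * `|x n i - s|) (Lf * `|x n i - s|) F0 A0 (fmin _ xS) (fmin _ Ss) (sA _ xS) (sA _ Ss)
  h2 (hLs _ _ xS Ss) (hLf _ _ xS Ss).
move=> /le_trans; apply.
have r0 : 0 <= rho n by exact: powR_ge0.
have q0 : 0 <= `|x n i - s| by [].
rewrite [leLHS](_ : _ = A * K / F * rho n + (Ls / F + A * Lf / F ^+ 2) * `|x n i - s|); last by ring.
rewrite mulrDr; move: (rho n) (`|x n i - s|) r0 q0 => r q r0 q0.
apply: lerD; apply: ler_wpM2r => //.
  rewrite addrCA lerDl; exact: addr_ge0 T1 (addr_ge0 T3 T4).
by rewrite addrA lerDr; exact: addr_ge0 T1 T2.
Qed.

Variable b : nat -> R.
Hypothesis hA3 : bandwidth d b.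

Lemma bandwidth_right : b n @[n --> \oo] --> 0^'+.
Proof.
have [b0 bcvg _] := hA3.
move=> U /bcvg hU0; have hU : \forall n \near \oo, 0 < b n -> U (b n) by exact: hU0.
suff : \forall n \near \oo, U (b n) by [].
near=> n.
have h : 0 < b n -> U (b n) by near: n; exact: hU.
apply: h; apply: b0; near: n; exact: nbhs_infty_gt.
Unshelve. all: by end_near.
Qed.

Lemma cell_size_bandwidth : rho n / b n @[n --> \oo] --> (0 : R).
Proof.
have [b0 _ /eqoP hb] := hA3; apply/cvgr0Pnorm_le => e e0.
have he := hb e e0; near=> n.
have bn : 0 < b n by apply: b0; near: n; exact: nbhs_infty_gt.
rewrite normrM normfV (gtr0_norm bn) ler_pdivrMr//.
have : `|rho n| <= e * `|b n| by near: n; exact: he.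
by rewrite (gtr0_norm bn).
Unshelve. all: by end_near.
Qed.

Lemma cell_size_cvg : rho n @[n --> \oo] --> (0 : R).
Proof.
have [b0 bcvg _] := hA3.
have : rho n / b n * b n @[n --> \oo] --> (0 * 0 : R) by apply: cvgM => //; exact: cell_size_bandwidth.
rewrite mulr0; apply: cvg_trans; apply: near_eq_cvg; near=> n.
rewrite divfK// gt_eqF// b0//; near: n; exact: nbhs_infty_gt.
Unshelve. all: by end_near.
Qed.

End triangular_array.

Local Opaque sq_norm_ratio.

Lemma sqdist_const_ge0 (R : realType) d : 0 <= sqdist_const d :> R.
Proof. by rewrite /sqdist_const mulr_ge0// addr_ge0// mulr_ge0// addr_ge0. Qed.

Local Opaque sqdist_const.

(** * Limits and dominating functions of the bias and the variance *)

Section bias_variance_limits.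
Context {R : realType} (d : nat).
Hypothesis d_gt0 : (0 < d)%N.
Local Notation leb := (lebesgue_rV d : measure _ R).
Local Notation S := (@simplex R d).
Local Notation O := (@open_simplex R d).
Implicit Types (s t v : 'rV[R]_d) (h : 'rV[R]_d -> R).
Variables (f sigmasq m : 'rV[R]_d -> R).
Variables (x : forall n : nat, 'I_n -> 'rV[R]_d) (B : forall n : nat, 'I_n -> set 'rV[R]_d).
Arguments x : clear implicits.
Arguments B : clear implicits.
Hypothesis xO : forall n i, O (x n i).
Hypothesis hA1 : regularity f sigmasq m.
Hypothesis hA2 : positivity f sigmasq.
Hypothesis hA4 : cells f x B.
Variable b : nat -> R.
Hypothesis hA3 : bandwidth d b.
Local Notation rho := (fun n : nat => n%:R `^ (- d%:R^-1) : R).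
Local Notation V n s := (row_variance (B n) (fun i => sigmasq (x n i)) s (b n)).

Lemma cells_row n : (0 < n)%N -> [/\ forall i, compact (B n i),
  forall i j, i != j -> (B n i)° `&` (B n j)° = set0, \bigcup_i B n i = S &
  forall i, leb (frontier (B n i)) = 0%E].
Proof.
move=> n0; split; [by move=> i; exact: cell_compact hA4 _ _|exact: cells_interior_disjoint hA4 _|
  exact: cells_cover hA4 _ n0|exact: cells_frontier hA4 _].
Qed.

Lemma bandwidth_near : \forall n \near \oo, (0 < n)%N /\ 0 < b n <= 1.
Proof.
have [b0 bcvg _] := hA3; near=> n.
have n0 : (0 < n)%N by near: n; exact: nbhs_infty_gt.
split=> //; rewrite b0//=; apply: le_trans (ler_norm _) _; near: n.
by have /cvgr0Pnorm_le := bcvg; apply.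
Unshelve. all: by end_near.
Qed.

Lemma variance_dominated : exists C, 0 <= C /\ \forall n \near \oo, forall s, O s ->
  n%:R * b n `^ (d%:R / 2) * V n s <= C * psi0 s.
Proof.
have [T [T0 hT]] := variance_density_ratio_near d_gt0 xO hA1 hA2 hA4.
pose G : R := 2 * 2 ^+ d * (d%:R + 2) ^+ (2 * d).
have G0 : 0 <= G.
  by apply: mulr_ge0; [apply: mulr_ge0 => //; exact: exprn_ge0|apply: exprn_ge0; exact: addr_ge0].
exists (T * G); split; first exact: mulr_ge0.
near=> n => s Os.
have [n0 b01] : (0 < n)%N /\ 0 < b n <= 1 by near: n; exact: bandwidth_near.
have /andP[b0 b1] := b01; have Ss := open_simplex_sub Os.
have hn : forall i, n%:R * sigmasq (x n i) * open_integral \1_(B n i) <= T.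
  by near: n; apply: filterS hT => n h i; have [] := h i.
have [cB disj cover fr] := cells_row n0.
have sig0 i : 0 <= sigmasq (x n i) by apply: sigmasq_ge0 hA2 _ _; exact: open_simplex_sub.
have h := row_variance_le cB disj cover fr sig0 hn Ss b0.
have := ler_wpM2l (powR_ge0 (b n) (d%:R / 2)) h.
rewrite mulrA [_ * n%:R]mulrC => /le_trans; apply.
rewrite mulrCA kernel_sq_normE// -mulrA; apply: ler_wpM2l => //.
rewrite mulrC; apply: ler_wpM2r; first exact: powR_ge0.
exact: sq_norm_ratio_le.
Unshelve. all: by end_near.
Qed.

Let scaled_dist (p q w v X Y : R) : 0 <= p -> p * q = w -> `|X - q * v| <= q * Y ->
  `|p * X - w * v| <= w * Y.
Proof.
move=> p0 <- h; rewrite -!mulrA -mulrBr normrM (ger0_norm p0); exact: ler_wpM2l.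
Qed.

Lemma variance_cvg s : O s ->
  n%:R * b n `^ (d%:R / 2) * V n s @[n --> \oo] --> v_fun f sigmasq s.
Proof.
move=> Os; have Ss := open_simplex_sub Os.
have [K [K0 hK]] := cell_near d_gt0 xO hA1 hA2 hA4.
have [T [T0 hT]] := variance_density_ratio_near d_gt0 xO hA1 hA2 hA4.
have [r0 [e [r00 e0 hball]]] := open_simplex_ball Os.
pose v0 := sigmasq s / f s.
have v00 : 0 <= v0.
  apply: divr_ge0; first exact: (sigmasq_ge0 hA2).
  by have [[s1 _ [h h1]] _] := hA2; apply: le_trans (h s Ss); exact: ltW.
have p0 : 0 <= psi0 s by exact: powR_ge0.
pose G : R := 2 * 2 ^+ d * (d%:R + 2) ^+ (2 * d).
have G0 : 0 <= G.
  by apply: mulr_ge0; [apply: mulr_ge0 => //; exact: exprn_ge0|apply: exprn_ge0; exact: addr_ge0].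
have -> : v_fun f sigmasq s = psi0 s * v0 by rewrite /v_fun patchE mem_set// mulrA.
apply/cvgrPdist_le => eps eps0.
pose c := psi0 s * G * T; have c0 : 0 <= c by rewrite mulr_ge0// mulr_ge0.
have e3 : 0 < eps / 3 by rewrite divr_gt0.
(* The oscillation of [theta] on the ball of radius [r] is the one error that does not vanish with
   [n], so [r] is fixed first; [del] and the normalizing ratio take the other two thirds. *)
have [r rr0 [rle cr]] : exists2 r, 0 < r & r <= r0 /\ c * r <= eps / 3.
  exists (Num.min r0 (eps / 3 / (c + 1))).
    by rewrite lt_min r00 divr_gt0// ltr_wpDl.
  split; first by rewrite ge_min lexx.
  apply: (@le_trans _ _ (c * (eps / 3 / (c + 1)))); first by rewrite ler_wpM2l// ge_min lexx orbT.
  by rewrite mulrCA ler_piMr// ?(ltW e3)// ler_pdivrMr ?mul1r ?lerDl// ltr_wpDl.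
(* Coefficients of [rho n / b n] and of [b n] in the bound of [row_variance_near] with
   [h = K * rho n]. *)
pose k1 := T * (d%:R * (2 * K)) / e; pose k2 := (T + v0) * (4 / r ^+ 2) * sqdist_const d.
pose del n := T * rho n + k1 * (rho n / b n) + k2 * b n.
have rcvg := cell_size_cvg hA3; have rbcvg := cell_size_bandwidth hA3.
have bright := bandwidth_right hA3; have [_ bcvg _] := hA3.
have delcvg : psi0 s * G * del n @[n --> \oo] --> (0 : R).
  rewrite [X in _ --> X](_ : _ = psi0 s * G * (T * 0 + k1 * 0 + k2 * 0)); last by rewrite !mulr0 !addr0 mulr0.
  by apply: cvgM; [exact: cvg_cst|]; do 2 (apply: cvgD; last by apply: cvgM; [exact: cvg_cst|]); apply: cvgM; [exact: cvg_cst|].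
have ratcvg : psi0 s * v0 * (sq_norm_ratio s (b n) - 1) @[n --> \oo] --> (0 : R).
  rewrite [X in _ --> X](_ : _ = psi0 s * v0 * (1 - 1)); last by rewrite subrr mulr0.
  apply: cvgM; [exact: cvg_cst|apply: cvgB; [|exact: cvg_cst]].
  exact: (cvg_comp _ _ bright (sq_norm_ratio_cvg Os)).
have /cvgr0Pnorm_le/(_ _ e3) hdel := delcvg.
have /cvgr0Pnorm_le/(_ _ e3) hrat := ratcvg.
have hKr : \forall n \near \oo, K * rho n <= r / 2.
  have : K * rho n @[n --> \oo] --> K * 0 by apply: cvgM; [exact: cvg_cst|].
  rewrite mulr0 => /cvgr0Pnorm_le/(_ (r / 2)) h; have {}h := h (divr_gt0 rr0 (ltr0n _ 2)).
  by apply: filterS h => n; apply: le_trans; exact: ler_norm.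
near=> n.
have [n0 b01] : (0 < n)%N /\ 0 < b n <= 1 by near: n; exact: bandwidth_near.
have /andP[b0 b1] := b01.
have [cB disj cover fr] := cells_row n0.
have sig0 i : 0 <= sigmasq (x n i) by apply: sigmasq_ge0 hA2 _ _; exact: open_simplex_sub.
have hKn : forall i, [/\ forall t, B n i t -> `|t - x n i| <= K * rho n,
      n%:R * open_integral \1_(B n i) <= K & `|n%:R * open_integral \1_(B n i) * f (x n i) - 1| <= K * rho n].
  by near: n; exact: hK.
have hTn : forall i, n%:R * sigmasq (x n i) * open_integral \1_(B n i) <= T /\
  forall s, S s -> `|n%:R * sigmasq (x n i) * open_integral \1_(B n i) - sigmasq s / f s|
    <= T * (rho n + `|x n i - s|) by near: n; exact: hT.
have hTn1 i : n%:R * sigmasq (x n i) * open_integral \1_(B n i) <= T by have [] := hTn i.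
have Bx i t : B n i t -> `|t - x n i| <= K * rho n by have [h _ _] := hKn i; exact: h.
have xB i : B n i (x n i) by apply: interior_subset; exact: cells_design hA4 _ _.
have rho0 : 0 <= rho n by exact: powR_ge0.
have hh : 0 <= K * rho n <= r / 2.
  by rewrite mulr_ge0//=; near: n.
have e00 : 0 <= T * (rho n + r) by rewrite mulr_ge0// addr_ge0// ltW.
have hth i : `|x n i - s| < r -> `|n%:R * sigmasq (x n i) * open_integral \1_(B n i) - v0| <= T * (rho n + r).
  move=> xr; have [_ /(_ s Ss) h] := hTn i; apply: le_trans h _.
  by rewrite ler_wpM2l// lerD2l ltW.
have hb t : O t -> `|t - s| <= 2 * r -> (forall j : 'I_d, e <= t ord0 j) /\ e <= 1 - \sum_j t ord0 j.
  by move=> _ ts; apply: hball; apply: le_trans ts _; rewrite ler_wpM2l.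
have := row_variance_near d_gt0 cB disj cover fr sig0 hTn1 Os b01 v00 e00 e0 rr0 hh xB Bx hth hb.
have P0 := powR_ge0 (b n) (d%:R / 2).
move=> /(scaled_dist P0 (kernel_sq_normE Os b0)).
rewrite mulrA [b n `^ _ * n%:R]mulrC.
have -> : T * (rho n + r) + T * (d%:R * (2 * (K * rho n)) / (e * b n)) +
     (T + v0) * (4 / r ^+ 2) * (sqdist_const d * b n) = T * r + del n.
  rewrite /del /k1 /k2 invfM; ring.
have : `|psi0 s * G * del n| <= eps / 3 by near: n; exact: hdel.
have : `|psi0 s * v0 * (sq_norm_ratio s (b n) - 1)| <= eps / 3 by near: n; exact: hrat.
have qG := sq_norm_ratio_le Os b01; have q0 : 0 <= sq_norm_ratio s (b n) by exact: sq_norm_ratio_ge0.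
have del0 : 0 <= del n.
  rewrite /del; apply: addr_ge0; first apply: addr_ge0.
  - exact: mulr_ge0.
  - apply: mulr_ge0; last by apply: divr_ge0 => //; exact: ltW.
    by apply: divr_ge0; [rewrite !mulr_ge0|exact: ltW].
  - apply: mulr_ge0; last exact: ltW.
    apply: mulr_ge0; last exact: sqdist_const_ge0.
    by apply: mulr_ge0; [exact: addr_ge0|apply: divr_ge0 => //; exact: sqr_ge0].
have Tr0 : 0 <= T * r + del n by rewrite addr_ge0// mulr_ge0// ltW.
have : psi0 s * sq_norm_ratio s (b n) * (T * r + del n) <= c * r + psi0 s * G * del n.
  rewrite [leRHS](_ : _ = psi0 s * G * (T * r + del n)); last by rewrite /c; ring.
  by apply: ler_wpM2r => //; apply: ler_wpM2l.
rewrite -[psi0 s * v0 * _]/(psi0 s * v0 * (sq_norm_ratio s (b n) - 1)).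
have -> : psi0 s * v0 * (sq_norm_ratio s (b n) - 1) = psi0 s * sq_norm_ratio s (b n) * v0 - psi0 s * v0 by ring.
move: cr; move: (psi0 s * sq_norm_ratio s (b n) * (T * r + del n)) (psi0 s * G * del n) (c * r)
  (psi0 s * sq_norm_ratio s (b n) * v0) (psi0 s * v0) (n%:R * b n `^ (d%:R / 2) * V n s).
move=> {Tr0 del0 qG q0 P0 e3 c0} y1 y2 y3 y4 y5 y6 cr h1; rewrite !ler_norml.
move=> /andP[a1 a2] /andP[a3 a4] /andP[a5 a6]; apply/andP; split; lra.
Unshelve. all: by end_near.
Qed.

Local Notation M n s := (cell_mean (B n) (x n) m s (b n)).

(** The discretization error has the order of the cell diameter, which the bandwidth condition makes
    [o(b)]. *)
Lemma cell_mean_kernel_mean : exists C, 0 <= C /\ \forall n \near \oo, forall s, O s ->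
  `|M n s - kernel_mean s (b n) m| <= C * rho n.
Proof.
have [_ _ C2m] := hA1.
have [K [K0 hK]] := cell_near d_gt0 xO hA1 hA2 hA4.
have [L [L0 hL]] := C2_lipschitz C2m.
exists (L * K); split; first exact: mulr_ge0.
near=> n => s Os.
have [n0 /andP[b0 b1]] : (0 < n)%N /\ 0 < b n <= 1 by near: n; exact: bandwidth_near.
have [cB disj cover fr] := cells_row n0.
have Bx : forall i t, B n i t -> `|t - x n i| <= K * rho n.
  by near: n; apply: filterS hK => n h i; have [h1 _ _] := h i; exact: h1.
rewrite -mulrA; apply: cell_mean_near => //.
- by rewrite mulr_ge0// powR_ge0.
- exact: bm_regression.
- exact: open_simplex_sub.
Unshelve. all: by end_near.
Qed.

Lemma bias_dominated : exists C, 0 <= C /\ \forall n \near \oo, forall s, O s ->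
  `|M n s - m s| <= C * b n.
Proof.
have [_ _ C2m] := hA1.
have [C [C0 hC]] := cell_mean_kernel_mean.
have [D [D0 hD]] := kernel_bias_le C2m.
exists (C + D); split; first exact: addr_ge0.
have /cvgr0Pnorm_le/(_ 1 ltr01) hrb := cell_size_bandwidth hA3.
near=> n => s Os.
have [n0 b01] : (0 < n)%N /\ 0 < b n <= 1 by near: n; exact: bandwidth_near.
have /andP[b0 b1] := b01.
rewrite -(subrK (kernel_mean s (b n) m) (M n s)) -addrA mulrDl.
apply: le_trans (ler_normD _ _) _; apply: lerD; last exact: hD.
have h : forall s, O s -> `|M n s - kernel_mean s (b n) m| <= C * rho n by near: n; exact: hC.
apply: le_trans (h s Os) _; apply: ler_wpM2l => //.
rewrite -[leRHS]mul1r -ler_pdivrMr//; apply: le_trans (ler_norm _) _.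
by near: n; exact: hrb.
Unshelve. all: by end_near.
Qed.

Lemma bias_cvg s : O s -> (M n s - m s) / b n @[n --> \oo] --> g_fun m s.
Proof.
move=> Os; have [_ _ C2m] := hA1.
have [C [C0 hC]] := cell_mean_kernel_mean.
have rbcvg := cell_size_bandwidth hA3; have bright := bandwidth_right hA3.
have h1 : (M n s - kernel_mean s (b n) m) / b n @[n --> \oo] --> (0 : R).
  apply/cvgr0Pnorm_le => e e0.
  have : C * (rho n / b n) @[n --> \oo] --> C * 0 by apply: cvgM; [exact: cvg_cst|].
  rewrite mulr0 => /cvgr0Pnorm_le/(_ e e0) he.
  near=> n.
  have [n0 /andP[b0 b1]] : (0 < n)%N /\ 0 < b n <= 1 by near: n; exact: bandwidth_near.
  rewrite normrM normfV (gtr0_norm b0) ler_pdivrMr//.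
  have h : forall s, O s -> `|M n s - kernel_mean s (b n) m| <= C * rho n by near: n; exact: hC.
  apply: le_trans (h s Os) _; rewrite -ler_pdivrMr// -mulrA; apply: le_trans (ler_norm _) _.
  by near: n; exact: he.
have h2 : (kernel_mean s (b n) m - m s) / b n @[n --> \oo] --> g_fun m s.
  exact: (cvg_comp _ _ bright (kernel_bias_cvg C2m Os)).
have h3 : ((M n s - kernel_mean s (b n) m) / b n + (kernel_mean s (b n) m - m s) / b n) @[n --> \oo]
    --> 0 + g_fun m s by exact: cvgD.
rewrite add0r in h3; apply: cvg_trans h3; apply: near_eq_cvg; near=> n.
by rewrite -mulrDl addrA subrK.
Unshelve. all: by end_near.
Qed.

End bias_variance_limits.

(** * Integrated mean squared error *)

Section mise.
Context {R : realType} (d : nat).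
Hypothesis d_gt0 : (0 < d)%N.
Local Notation leb := (lebesgue_rV d : measure _ R).
Local Notation S := (@simplex R d).
Local Notation O := (@open_simplex R d).
Implicit Types (s t v : 'rV[R]_d) (h : 'rV[R]_d -> R).
Context {dO : measure_display} {Omega : measurableType dO} (P : probability Omega R).
Variables (f sigmasq m : 'rV[R]_d -> R).
Variables (x : forall n : nat, 'I_n -> 'rV[R]_d) (eps : forall n : nat, 'I_n -> {RV P >-> R}).
Variable B : forall n : nat, 'I_n -> set 'rV[R]_d.
Arguments x : clear implicits.
Arguments B : clear implicits.
Arguments eps : clear implicits.
Hypothesis xO : forall n i, O (x n i).
Hypothesis eps_errors : errors sigmasq x eps.
Hypothesis hA1 : regularity f sigmasq m.
Hypothesis hA2 : positivity f sigmasq.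
Hypothesis hA4 : cells f x B.
Variable b : nat -> R.
Hypothesis hA3 : bandwidth d b.
Local Notation V n s := (row_variance (B n) (fun i => sigmasq (x n i)) s (b n)).
Local Notation M n s := (cell_mean (B n) (x n) m s (b n)).

Let mB n i : measurable (B n i).
Proof. by apply: compact_measurable_rV; exact: cell_compact hA4 _ _. Qed.

Let w_measurable n i : 0 < b n -> measurable_fun S (fun s => kernel_mean s (b n) \1_(B n i)).
Proof.
move=> b0; have BS : B n i `<=` S by exact: cell_sub hA4 _ _.
apply: (eq_measurable_fun _ _ (measurable_cell_weight d_gt0 (mB i) BS b0)).
by move=> s; rewrite inE => Ss; rewrite kernel_cell_weight.
Qed.

Let m_measurable : measurable_fun S m.
Proof.
have [_ _ [cm _ _]] := hA1.
by apply: within_continuous_measurable => //; exact: measurable_simplex.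
Qed.

Let bias_measurable n : 0 < b n -> measurable_fun S (fun s => M n s - m s).
Proof.
move=> b0; apply: measurable_funB => //; apply: measurable_sum => i.
by apply: measurable_funM => //; exact: w_measurable.
Qed.

Let variance_measurable n : 0 < b n -> measurable_fun S (fun s => V n s).
Proof.
move=> b0; apply: measurable_sum => i; apply: measurable_funM => //.
by apply: (measurable_funX 2); exact: w_measurable.
Qed.

Let onO (h : 'rV[R]_d -> R) : measurable_fun S h -> measurable_fun O h.
Proof. by move=> mh; apply: measurable_funS mh; [exact: measurable_simplex|exact: open_simplex_sub]. Qed.

Let MSE_E n s : S s -> 0 < b n ->
  MSE m (x n) (eps n) (B n) (b n) s = ((M n s - m s) ^+ 2 + V n s)%:E.
Proof.
move=> Ss b0; have [ind mean0 var] := eps_errors n.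
rewrite (MSE_bias_variance m (B n) s (b n) ind mean0 var); congr ((_ ^+ 2 + _)%:E).
  by congr (_ - _); apply: eq_bigr => i _; rewrite kernel_cell_weight//; exact: cell_sub hA4 _ _.
by apply: eq_bigr => i _; rewrite kernel_cell_weight//; exact: cell_sub hA4 _ _.
Qed.

Let Rintegral_simplex0 (h : 'rV[R]_d -> R) : (forall s, ~ O s -> h s = 0) ->
  \int[leb]_(s in S) h s = \int[leb]_(s in O) h s.
Proof.
move=> h0; rewrite [LHS]Rintegral_mkcond [RHS]Rintegral_mkcond; apply: eq_Rintegral => s _.
rewrite !patchE; have [Os|Os] := boolP (s \in O).
  by rewrite mem_set//; apply: open_simplex_sub; rewrite -inE.
by case: ifP => // _; apply: h0 => Os'; move: Os; rewrite mem_set.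
Qed.

Local Notation beta n s := ((M n s - m s) / b n).
Local Notation nu n s := (n%:R * b n `^ (d%:R / 2) * V n s).

Let nu_ge0 n s : 0 <= nu n s.
Proof.
apply: mulr_ge0; first by rewrite mulr_ge0// powR_ge0.
by apply: row_variance_ge0 => i; apply: sigmasq_ge0 hA2 _ _; exact: open_simplex_sub.
Qed.

Lemma int_g2E : int_g2 m = \int[leb]_(s in O) (g_fun m s ^+ 2).
Proof. by rewrite /int_g2 Rintegral_simplex0 // => s Os; rewrite /g_fun patchE memNset// expr0n. Qed.

Lemma int_vE : int_v f sigmasq = \int[leb]_(s in O) v_fun f sigmasq s.
Proof. by rewrite /int_v Rintegral_simplex0 // => s Os; rewrite /v_fun patchE memNset. Qed.

(** Integrability of the limit is kept for the strict positivity of [int_g2], on which the optimal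
    bandwidth depends. *)
Lemma bias_integral : leb.-integrable O (EFin \o (fun s => g_fun m s ^+ 2)) /\
  \int[leb]_(s in O) (beta n s ^+ 2) @[n --> \oo] --> int_g2 m.
Proof.
rewrite int_g2E.
have [C [C0 hC]] := bias_dominated d_gt0 xO hA1 hA2 hA4 hA3.
apply: (@dominated_Rintegral_cvg _ _ _ _ (fun=> C ^+ 2)).
- near=> n.
  have [n0 /andP[b0 b1]] : (0 < n)%N /\ 0 < b n <= 1 by near: n; exact: (bandwidth_near hA3).
  have hCn : forall s, O s -> `|M n s - m s| <= C * b n by near: n; exact: hC.
  split.
    apply: onO; apply: (measurable_funX 2); apply: measurable_funM => //; exact: bias_measurable.
  move=> s Os; rewrite normrX lerXn2r ?nnegrE//.
  by rewrite normrM normfV (gtr0_norm b0) ler_pdivrMr// hCn.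
- move=> s Os; have h := bias_cvg d_gt0 xO hA1 hA2 hA4 hA3 Os.
  by rewrite expr2; under eq_fun do rewrite expr2; exact: cvgM.
- by apply: bm_integrable_open; exact: bm_cst.
Unshelve. all: by end_near.
Qed.

Lemma variance_integral : leb.-integrable O (EFin \o v_fun f sigmasq) /\
  \int[leb]_(s in O) nu n s @[n --> \oo] --> int_v f sigmasq.
Proof.
rewrite int_vE.
have [C [C0 hC]] := variance_dominated d_gt0 xO hA1 hA2 hA4 hA3.
apply: (@dominated_Rintegral_cvg _ _ _ _ (fun s => C * psi0 s)).
- near=> n.
  have [n0 /andP[b0 b1]] : (0 < n)%N /\ 0 < b n <= 1 by near: n; exact: (bandwidth_near hA3).
  have hCn : forall s, O s -> nu n s <= C * psi0 s by near: n; exact: hC.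
  split.
    by apply: onO; apply: measurable_funM => //; exact: variance_measurable.
  by move=> s Os; rewrite ger0_norm ?hCn.
- by move=> s Os; exact: (variance_cvg d_gt0 xO hA1 hA2 hA4 hA3 Os).
- exact: (@integrableZl _ _ _ leb O (@measurable_open_simplex R d) C _ (psi0_integrable d)).
Unshelve. all: by end_near.
Qed.

Let MISE_E : \forall n \near \oo, MISE m (x n) (eps n) (B n) (b n) =
  (b n ^+ 2 * \int[leb]_(s in O) (beta n s ^+ 2) +
   n%:R^-1 * b n `^ (- (d%:R / 2)) * \int[leb]_(s in O) nu n s)%:E.
Proof.
have [C [C0 hC]] := bias_dominated d_gt0 xO hA1 hA2 hA4 hA3.
have [D [D0 hD]] := variance_dominated d_gt0 xO hA1 hA2 hA4 hA3.
have mO := @measurable_open_simplex R d.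
near=> n.
have [n0 /andP[b0 b1]] : (0 < n)%N /\ 0 < b n <= 1 by near: n; exact: (bandwidth_near hA3).
have hCn : forall s, O s -> `|M n s - m s| <= C * b n by near: n; exact: hC.
have hDn : forall s, O s -> nu n s <= D * psi0 s by near: n; exact: hD.
have mbeta : measurable_fun O (fun s => beta n s ^+ 2).
  by apply: onO; apply: (measurable_funX 2); apply: measurable_funM => //; exact: bias_measurable.
have mnu : measurable_fun O (fun s => nu n s).
  by apply: onO; apply: measurable_funM => //; exact: variance_measurable.
have ibeta : leb.-integrable O (EFin \o (fun s => beta n s ^+ 2)).
  apply: bm_integrable_open; split=> //; exists (C ^+ 2) => s Os.
  rewrite normrX lerXn2r ?nnegrE//.
  by rewrite normrM normfV (gtr0_norm b0) ler_pdivrMr// hCn.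
have inu : leb.-integrable O (EFin \o (fun s => nu n s)).
  apply: le_integrable (@integrableZl _ _ _ leb O mO D _ (psi0_integrable d)) => //.
    exact/measurable_EFinP.
  move=> s Os; rewrite /= lee_fin ger0_norm//.
  by apply: le_trans (hDn s Os) _; exact: ler_norm.
pose c1 := b n ^+ 2; pose c2 := n%:R^-1 * b n `^ (- (d%:R / 2)).
have hE s : (M n s - m s) ^+ 2 + V n s = c1 * beta n s ^+ 2 + c2 * nu n s.
  have bn0 : b n != 0 by rewrite gt_eqF.
  rewrite /c1 exprMn exprVn mulrCA mulfV ?expf_neq0// mulr1; congr (_ + _).
  have p0 : n%:R * b n `^ (d%:R / 2) != 0 by rewrite mulf_neq0// ?pnatr_eq0 -?lt0n// gt_eqF// powR_gt0.
  by rewrite /c2 powRN -invfM mulrA mulVf// mul1r.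
rewrite /MISE.
transitivity (\int[leb]_(s in S) ((M n s - m s) ^+ 2 + V n s)%:E)%E.
  by apply: eq_integral => s; rewrite inE => Ss; rewrite MSE_E.
have mh : measurable_fun S (fun s => (M n s - m s) ^+ 2 + V n s).
  by apply: measurable_funD; [apply: (measurable_funX 2); exact: bias_measurable|exact: variance_measurable].
have i1 := @integrableZl _ _ _ leb O mO c1 _ ibeta.
have i2 := @integrableZl _ _ _ leb O mO c2 _ inu.
have ih : leb.-integrable O (EFin \o (fun s => (M n s - m s) ^+ 2 + V n s)).
  have := @integrableD _ _ _ leb O mO _ _ i1 i2.
  by apply: eq_integrable => // s _ /=; rewrite hE.
have [iS eS] := Rintegral_simplex_open d_gt0 mh ih.
rewrite -[LHS]fineK; last by apply: integrable_fin_num iS; exact: measurable_simplex.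
congr (_%:E); rewrite [LHS]eS.
under eq_Rintegral do rewrite hE.
have i1' : leb.-integrable O (EFin \o (fun s => c1 * beta n s ^+ 2)) by exact: i1.
have i2' : leb.-integrable O (EFin \o (fun s => c2 * nu n s)) by exact: i2.
by rewrite (RintegralD mO i1' i2') (RintegralZl c1 mO ibeta) (RintegralZl c2 mO inu).
Unshelve. all: by end_near.
Qed.

Lemma MISE_asymptotics : exists2 r : nat -> R,
  r =o_\oo (fun n => b n ^+ 2 + n%:R^-1 * b n `^ (- (d%:R / 2))) &
  \forall n \near \oo, MISE m (x n) (eps n) (B n) (b n) =
    (b n ^+ 2 * int_g2 m + n%:R^-1 * b n `^ (- (d%:R / 2)) * int_v f sigmasq + r n)%:E.
Proof.
pose J1 n := \int[leb]_(s in O) (beta n s ^+ 2).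
pose J2 n := \int[leb]_(s in O) nu n s.
(* Each normalized integral minus its limit, weighted by its own rate. *)
exists (fun n => b n ^+ 2 * (J1 n - int_g2 m) +
    n%:R^-1 * b n `^ (- (d%:R / 2)) * (J2 n - int_v f sigmasq)).
  apply/eqoP => e e0.
  have [_] := bias_integral => /cvgrPdist_le/(_ e e0) h1.
  have [_] := variance_integral => /cvgrPdist_le/(_ e e0) h2.
  near=> n.
  have c1 : 0 <= b n ^+ 2 by exact: sqr_ge0.
  have c2 : 0 <= n%:R^-1 * b n `^ (- (d%:R / 2)) by rewrite mulr_ge0 ?powR_ge0// invr_ge0.
  have j1 : `|int_g2 m - J1 n| <= e by near: n; exact: h1.
  have j2 : `|int_v f sigmasq - J2 n| <= e by near: n; exact: h2.
  rewrite (ger0_norm (addr_ge0 c1 c2)) [leRHS]mulrC [leRHS]mulrDl.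
  apply: le_trans (ler_normD _ _) _; apply: lerD; rewrite normrM ger0_norm//.
    by apply: ler_wpM2l => //; rewrite distrC.
  by apply: ler_wpM2l => //; rewrite distrC.
apply: filterS MISE_E => n ->; congr (_%:E).
by rewrite !mulrBr -/(J1 n) -/(J2 n); ring.
Unshelve. all: by end_near.
Qed.

End mise.

(** * Optimal bandwidth *)

Section positive_integral.
Context {R : realType} (d : nat).
Local Notation leb := (lebesgue_rV d : measure _ R).
Local Notation O := (@open_simplex R d).
Implicit Types (s t : 'rV[R]_d).

(** A zero integral would force [h] to vanish almost everywhere, but it is positive on a cube around
    [s], which has positive volume. *)
Lemma Rintegral_open_simplex_gt0 (h : 'rV[R]_d -> R) s r : O s -> 0 < r ->
  (forall t, O t -> 0 <= h t) -> (forall t, `|t - s| < r -> O t -> 0 < h t) ->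
  leb.-integrable O (EFin \o h) -> 0 < \int[leb]_(t in O) h t.
Proof.
move=> Os r0 h0 hs ih; have mO := @measurable_open_simplex R d.
rewrite lt_neqAle Rintegral_ge0// andbT; apply/eqP => int0.
have [r1 [e [r10 e0 hball]]] := open_simplex_ball Os.
pose q := Num.min (r / 2) r1.
have q0 : 0 < q by rewrite lt_min r10 divr_gt0.
have qr : q < r.
  by rewrite gt_min; apply/orP; left; rewrite ltr_pdivrMr// ltr_pMr// ltr1n.
pose box := [set v : 'rV[R]_d | forall j, (s - const_mx q) ord0 j <= v ord0 j <= (s + const_mx q) ord0 j].
have mbox : measurable box.
  have -> : box = \bigcap_(j in [set: 'I_d]) rV_coord j @^-1` `[(s - const_mx q) ord0 j, (s + const_mx q) ord0 j].
    by apply/seteqP; split => v /= bv j; have := bv j; rewrite /= in_itv//=; exact.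
  apply: fin_bigcap_measurable => // j _.
  by rewrite -[X in measurable X]setTI; exact: measurable_rV_coord.
have box_gt0 : (0 < leb box)%E.
  have -> : leb box = (\prod_(j < d) ((s + const_mx q) ord0 j - (s - const_mx q) ord0 j))%:E.
    by apply: lebesgue_rV_box => j; rewrite !mxE; move: (s ord0 j) => u; lra.
  by rewrite lte_fin; apply: prodr_gt0 => j _; rewrite !mxE; move: (s ord0 j) => u; lra.
have box_near v : box v -> `|v - s| <= q.
  move=> bv; apply: norm_le_coord => [|j]; first exact: ltW.
  by have := bv j; rewrite !mxE ler_norml => /andP[h1 h2]; apply/andP; split; lra.
have boxO v : box v -> O v.
  move=> /box_near vs; have [|tj ts] := hball v.
    by apply: le_trans vs _; rewrite ge_min; apply/orP; right; rewrite ler_peMl ?ltW// ltr1n.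
  apply/open_simplexP; split; first by move=> j; apply: lt_le_trans (tj j).
  by rewrite -subr_gt0; exact: lt_le_trans ts.
have := ih => /integrableP[mh _].
have int0' : (\int[leb]_(t in O) `|(EFin \o h) t| = 0)%E.
  transitivity (\int[leb]_(t in O) (h t)%:E)%E.
    by apply: eq_integral => t; rewrite inE => Ot /=; rewrite ger0_norm ?h0.
  by rewrite -[LHS]fineK ?(integrable_fin_num mO ih)//; congr (_%:E); rewrite int0.
have /(ae_eq_integral_abs leb mO mh) [N [mN N0 hN]] := int0'.
have boxN : box `<=` N.
  move=> v bv; apply: hN => /= /(_ (boxO v bv)) [hv].
  have := hs v (le_lt_trans (box_near v bv) qr) (boxO v bv).
  by rewrite hv ltxx.
by move: box_gt0; rewrite (subset_measure0 mbox mN boxN N0) ltxx.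
Qed.

(** Spreads a nonzero value of [g_fun] to a neighbourhood, where its square contributes to [int_g2].
    The extension by 0 is invisible near [s] because the open simplex is open. *)
Lemma g_fun_continuous (m : 'rV[R]_d -> R) s : C2_on_simplex m -> O s ->
  g_fun m t @[t --> s] --> g_fun m s.
Proof.
move=> [_ c1 c2] Os.
have cvg_ext (h : 'rV[R]_d -> R) : extends_continuously h -> h t @[t --> s] --> h s.
  move=> ch; apply/(@cvgrPdist_le _ _ _ _ (nbhs_filter s)) => e e0.
  have [r r0 hr] := extends_continuously_near ch Os e0.
  by apply: (nbhs_norm_le r0) => t ts; rewrite distrC; have [] := hr t ts.
have ccoord j : t ord0 j @[t --> s] --> (s ord0 j : R) by exact: coord_continuous.
pose G t := \sum_(j < d) (1 - (d%:R + 1) * t ord0 j) * partial j m t +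
  2^-1 * \sum_(j < d) \sum_(k < d)
    t ord0 j * ((j == k)%:R - t ord0 k) * partial j (partial k m) t.
have GE t : O t -> g_fun m t = G t by move=> Ot; rewrite /g_fun patchE mem_set.
rewrite (GE s Os); apply: (@cvg_trans _ (G t @[t --> s])).
  have [r [e [r0 e0 hball]]] := open_simplex_ball Os.
  suff nh : nbhs s [set t | G t = g_fun m t] by exact: (@near_eq_cvg _ _ (nbhs s) (nbhs_filter s) _ _ nh).
  apply: (nbhs_norm_le r0) => t ts /=; rewrite GE//.
  have [|tj ts1] := hball t; first by apply: le_trans (ltW ts) _; rewrite ler_peMl ?ltW// ltr1n.
  apply/open_simplexP; split; first by move=> j; apply: lt_le_trans (tj j).
  by rewrite -subr_gt0; exact: lt_le_trans ts1.
have Fs := nbhs_filter s.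
have cM (u w : 'rV[R]_d -> R) (l k : R) : u t @[t --> s] --> l -> w t @[t --> s] --> k ->
    u t * w t @[t --> s] --> l * k by exact: (@cvgM R _ _ Fs).
have cB (c : R) (u : 'rV[R]_d -> R) l : u t @[t --> s] --> l -> c - u t @[t --> s] --> c - l.
  by move=> cu; apply: (@cvgB _ _ _ _ Fs) => //; exact: cvg_cst.
apply: (@cvgD _ _ _ _ Fs).
  apply: (@cvg_sumr _ _ _ _ _ Fs) => j.
  apply: (cM (fun t => 1 - (d%:R + 1) * t ord0 j) (partial j m)); last by apply: cvg_ext; have [] := c1 j.
  apply: (cB 1 (fun t => (d%:R + 1) * t ord0 j)).
  by apply: (cM (fun=> d%:R + 1) (fun t => t ord0 j)); [exact: cvg_cst|exact: ccoord].
apply: (cM (fun=> 2^-1) (fun t => \sum_(j < d) \sum_(k < d)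
    t ord0 j * ((j == k)%:R - t ord0 k) * partial j (partial k m) t)); first exact: cvg_cst.
apply: (@cvg_sumr _ _ _ _ _ Fs) => j; apply: (@cvg_sumr _ _ _ _ _ Fs) => k.
apply: (cM (fun t => t ord0 j * ((j == k)%:R - t ord0 k)) (partial j (partial k m))); last first.
  by apply: cvg_ext; have [] := c2 j k.
by apply: (cM (fun t => t ord0 j) (fun t => (j == k)%:R - t ord0 k)); [exact: ccoord|apply: cB; exact: ccoord].
Qed.

End positive_integral.

Section optimal_bandwidth.
Context {R : realType} (d : nat).
Hypothesis d_gt0 : (0 < d)%N.
Variables (G V : R).
Hypotheses (G0 : 0 < G) (V0 : 0 < V).
Local Notation D := (d%:R : R).
Local Notation A n b := (b ^+ 2 * G + n%:R^-1 * b `^ (- (D / 2)) * V).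
Local Notation bo n := (n%:R `^ (- (2 / (D + 4))) * (D / 4 * (V / G)) `^ (2 / (D + 4))).

Let D0 : 0 < D. Proof. by rewrite ltr0n. Qed.
Let D40 : D + 4 != 0. Proof. by rewrite gt_eqF// addr_gt0. Qed.
Let Dn0 : D != 0. Proof. by rewrite gt_eqF. Qed.

Let delta := ln (D / 4).
(** The logarithm of [bo n]. Writing all positive quantities as exponentials turns the power
    identities below into linear identities between exponents. *)
Let y0 n := 2 / (D + 4) * (delta + ln V - ln G - ln n%:R).

Let powR_exp (u v : R) : expR u `^ v = expR (u * v). Proof. by rewrite expRM. Qed.
Let deltaE : expR delta = D / 4. Proof. by rewrite lnK// posrE divr_gt0. Qed.
Let VE : expR (ln V) = V. Proof. by rewrite lnK. Qed.
Let GE : expR (ln G) = G. Proof. by rewrite lnK. Qed.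
Let nE n : (0 < n)%N -> expR (ln n%:R) = n%:R :> R.
Proof. by move=> n0; rewrite lnK// posrE ltr0n. Qed.

Let boE n : (0 < n)%N -> bo n = expR (y0 n).
Proof.
move=> n0; rewrite -{1}(nE n0) -deltaE -{1}VE -{1}GE -expRN -!expRD !powR_exp -expRD.
by congr expR; rewrite /y0; field.
Qed.

(** The criterion in the variable [y = ln (b / b_opt)]: the two terms of the bracket have opposite
    derivatives at [y = 0], which is what the formula for [b_opt] achieves. *)
Let AE n y : (0 < n)%N ->
  A n (expR (y0 n + y)) = G * expR (2 * y0 n) * (expR (2 * y) + 4 / D * expR (- (D / 2 * y))).
Proof.
move=> n0; rewrite mulrDr -expRM_natl; congr (_ + _).
  by rewrite mulrC -mulrA -expRD; congr (_ * expR _); rewrite -mulrDr.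
have -> : 4 / D = expR (- delta) by rewrite expRN deltaE invf_div.
rewrite powR_exp -{1}(nE n0) -expRN -{1}VE -{1}GE -!expRD; congr expR.
by rewrite /y0; field.
Qed.

Lemma bandwidth_opt_gt0 n : (0 < n)%N -> 0 < bo n.
Proof. by move=> n0; rewrite boE// expR_gt0. Qed.

Lemma bandwidth_opt_min n b : (0 < n)%N -> 0 < b -> b != bo n -> A n (bo n) < A n b.
Proof.
move=> n0 b0; rewrite boE// => bb.
pose y := ln b - y0 n.
have yb : b = expR (y0 n + y) by rewrite /y addrC subrK lnK.
have yn0 : y != 0 by apply: contra_neq bb => y_0; rewrite yb y_0 addr0.
rewrite -{1 2}[y0 n]addr0 yb !AE// !mulr0 oppr0 expR0 mulr1.
rewrite ltr_pM2l ?mulr_gt0 ?expR_gt0//.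
have h1 : 1 + 2 * y < expR (2 * y) by apply: expR_gt1Dx; rewrite mulf_neq0.
have h2 : 1 - D / 2 * y < expR (- (D / 2 * y)).
  by apply: expR_gt1Dx; rewrite oppr_eq0 !mulf_neq0// invr_neq0.
have h3 : 4 / D * (1 - D / 2 * y) < 4 / D * expR (- (D / 2 * y)) by rewrite ltr_pM2l// divr_gt0.
(* The linear terms of the two convexity bounds cancel, leaving the value at [y = 0]. *)
have h4 : 4 / D * (1 - D / 2 * y) = 4 / D - 2 * y by field.
by rewrite h4 in h3; move: h1 h3; move: (4 / D * expR (- (D / 2 * y))) (expR (2 * y)) (4 / D) => v u w; lra.
Qed.

Lemma bandwidth_opt_value n : (0 < n)%N -> A n (bo n) =
  n%:R `^ (- (4 / (D + 4))) * ((1 + D / 4) / (D / 4) `^ (D / (D + 4))) *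
  (V `^ (4 / (D + 4)) / G `^ (- (D / (D + 4)))).
Proof.
move=> n0; rewrite boE// -{1 2}[y0 n]addr0 AE// !mulr0 oppr0 expR0 mulr1.
have -> : 1 + 4 / D = (1 + D / 4) * expR (- delta).
  by rewrite expRN deltaE; field.
rewrite -(nE n0) -[X in _ / X `^ _]deltaE -{1}VE -{1 2}GE !powR_exp -!expRN.
rewrite [X in _ = X](_ : _ = (1 + D / 4) * (expR (ln n%:R * - (4 / (D + 4))) *
  expR (- (delta * (D / (D + 4)))) * (expR (ln V * (4 / (D + 4))) *
  expR (- (ln G * - (D / (D + 4))))))); last by ring.
rewrite mulrCA -!expRD; congr (_ * expR _).
by rewrite /y0; field.
Qed.

(** At the optimum both rates are proportional to [n^(-4/(d+4))], so the remainder of the general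
    expansion is small relative to this single power. *)
Lemma bandwidth_opt_rate : exists K, 0 < K /\ forall n, (0 < n)%N ->
  bo n ^+ 2 + n%:R^-1 * bo n `^ (- (D / 2)) = K * n%:R `^ (- (4 / (D + 4))).
Proof.
pose C := expR (4 / (D + 4) * (delta + ln V - ln G)).
exists (C * (1 + G / V * (4 / D))); split.
  by rewrite mulr_gt0 ?expR_gt0// addr_gt0// mulr_gt0 ?divr_gt0.
move=> n n0.
have e1 : bo n ^+ 2 = C * n%:R `^ (- (4 / (D + 4))).
  rewrite boE// -expRM_natl -{1}(nE n0) powR_exp -expRD; congr expR.
  by rewrite /y0; field.
have e2 : n%:R^-1 * bo n `^ (- (D / 2)) = G / V * (4 / D) * bo n ^+ 2.
  have -> : 4 / D = expR (- delta) by rewrite expRN deltaE invf_div.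
  rewrite boE// -expRM_natl powR_exp -{1}(nE n0) -expRN -{1}VE -{1}GE -expRN -!expRD; congr expR.
  by rewrite /y0; field.
by rewrite e2 e1; ring.
Qed.

Let powR_nat_cvg0 (a : R) : 0 < a -> n%:R `^ (- a) @[n --> \oo] --> (0 : R).
Proof.
move=> a0; apply/cvgr0Pnorm_le => e e0.
near=> n.
have n0 : (0 < n)%N by near: n; exact: nbhs_infty_gt.
rewrite ger0_norm ?powR_ge0// -(nE n0) powR_exp -[leRHS](lnK e0) ler_expR.
rewrite mulrN lerNl -ler_pdivrMr//.
rewrite -ler_expR (nE n0); apply/ltW; near: n; exact: nbhs_infty_gtr.
Unshelve. all: by end_near.
Qed.

Lemma bandwidth_opt_bandwidth : (d < 4)%N -> bandwidth d (fun n => bo n).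
Proof.
move=> d4; have D4 : D < 4 by rewrite ltr_nat.
pose c := (D / 4 * (V / G)) `^ (2 / (D + 4)).
have c0 : 0 < c by rewrite powR_gt0// mulr_gt0 ?divr_gt0.
split.
- by move=> n; exact: bandwidth_opt_gt0.
- have : n%:R `^ (- (2 / (D + 4))) * c @[n --> \oo] --> 0 * c.
    apply: cvgM; last exact: cvg_cst.
    by apply: powR_nat_cvg0; rewrite divr_gt0// addr_gt0.
  by rewrite mul0r.
- apply/eqoP => e e0.
  pose a := D^-1 - 2 / (D + 4).
  have a0 : 0 < a.
    (* The restriction to dimensions below 4 enters here: the cells are small relative to [b_opt]
       when [a] is positive. *)
    have -> : a = (4 - D) / (D * (D + 4)) by rewrite /a; field; rewrite D40 Dn0.
    by rewrite divr_gt0 ?subr_gt0// mulr_gt0// addr_gt0.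
  have /cvgr0Pnorm_le/(_ (e * c) (mulr_gt0 e0 c0)) h := powR_nat_cvg0 a0.
  near=> n.
  have n0 : (0 < n)%N by near: n; exact: nbhs_infty_gt.
  have hn : `|n%:R `^ (- a)| <= e * c by near: n; exact: h.
  rewrite (ger0_norm (powR_ge0 _ _)) (gtr0_norm (bandwidth_opt_gt0 n0)).
  have -> : - D^-1 = - a - 2 / (D + 4) by rewrite /a; ring.
  rewrite powRD; last by rewrite pnatr_eq0 -lt0n n0 implybT.
  rewrite -/c [n%:R `^ (- (2 / (D + 4))) * c]mulrC mulrA; apply: ler_wpM2r; first exact: powR_ge0.
  by apply: le_trans hn; exact: ler_norm.
Unshelve. all: by end_near.
Qed.

End optimal_bandwidth.

Theorem theorem4p4 (R : realType) (d : nat) (d_gt0 : (0 < d)%N)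
    (dO : measure_display) (Omega : measurableType dO) (P : probability Omega R)
    (f sigmasq m : 'rV[R]_d -> R)
    (x : forall n : nat, 'I_n -> 'rV[R]_d)
    (eps : forall n : nat, 'I_n -> {RV P >-> R})
    (B : forall n : nat, 'I_n -> set 'rV[R]_d)
    (b : nat -> R)
    (f_density : density_on_simplex f)
    (x_design : design f x)
    (eps_errors : errors sigmasq x eps)
    (hA1 : regularity f sigmasq m) (hA2 : positivity f sigmasq) (hA3 : bandwidth d b) (hA4 : cells f x B) :
  (exists2 r : nat -> R,
      r =o_\oo (fun n => b n ^+ 2 + n%:R^-1 * b n `^ (- (d%:R / 2))) &
      \forall n \near \oo,
        MISE m (x n) (eps n) (B n) (b n) =
        (b n ^+ 2 * int_g2 m
         + n%:R^-1 * b n `^ (- (d%:R / 2)) * int_v f sigmasq + r n)%:E) /\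
  ((exists2 s, open_simplex s & g_fun m s != 0) ->
   (exists2 s, simplex s & sigmasq s != 0) ->
   d \in [:: 1; 2; 3]%N ->
   (forall n, (0 < n)%N ->
      0 < b_opt m f sigmasq n /\
      forall b' : R, 0 < b' -> b' != b_opt m f sigmasq n ->
        amise m f sigmasq n (b_opt m f sigmasq n) < amise m f sigmasq n b') /\
   (exists2 r : nat -> R,
      r =o_\oo (fun n => n%:R `^ (- (4 / (d%:R + 4)))) &
      \forall n \near \oo,
        MISE m (x n) (eps n) (B n) (b_opt m f sigmasq n) =
        (n%:R `^ (- (4 / (d%:R + 4)))
         * ((1 + d%:R / 4) / (d%:R / 4) `^ (d%:R / (d%:R + 4)))
         * (int_v f sigmasq `^ (4 / (d%:R + 4))
            / int_g2 m `^ (- (d%:R / (d%:R + 4))))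
         + r n)%:E)).
Proof.
have half (u : R) : 0 < u / 2 -> u <= u / 2 -> False by lra.
have [xO _] := x_design.
split; first exact: (MISE_asymptotics d_gt0 xO eps_errors hA1 hA2 hA4 hA3).
move=> [s Os gs] _ d123.
have [ig2 _] := bias_integral d_gt0 xO hA1 hA2 hA4 hA3.
have [iv _] := variance_integral d_gt0 xO hA1 hA2 hA4 hA3.
have [_ _ C2m] := hA1.
have v_gt0 t : open_simplex t -> 0 < v_fun f sigmasq t.
  move=> Ot; have St := open_simplex_sub Ot.
  have [[s1 _ [f1 f10]] [s2 _ [s21 s20]]] := hA2.
  rewrite /v_fun patchE mem_set//; apply: divr_gt0; last exact: lt_le_trans f10 (f1 t St).
  apply: mulr_gt0; last exact: lt_le_trans s20 (s21 t St).
  have [t01 t1] := Ot; apply: powR_gt0; apply: mulr_gt0; first apply: mulr_gt0.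
  - by apply: exprn_gt0; apply: mulr_gt0 => //; exact: pi_gt0.
  - by rewrite subr_gt0.
  - by apply: prodr_gt0 => j _; have /andP[] := t01 j.
have V0 : 0 < int_v f sigmasq.
  rewrite int_vE; apply: (Rintegral_open_simplex_gt0 Os ltr01) => // t; last by move=> _; exact: v_gt0.
  by move=> Ot; apply: ltW; exact: v_gt0.
(* By continuity [g_fun] stays within half of [|g_fun m s|] of its value at [s], hence does not
   vanish near [s]. *)
have G0 : 0 < int_g2 m.
  have gs0 : 0 < `|g_fun m s| / 2 by rewrite divr_gt0// normr_gt0.
  have cg := g_fun_continuous C2m Os.
  have /(@cvgrPdist_le _ _ _ _ (nbhs_filter s)) /(_ _ gs0) := cg.
  move=> /nbhs_ballP[r /= r0 hr].
  rewrite int_g2E; apply: (Rintegral_open_simplex_gt0 Os r0) => // t; first by move=> _; exact: sqr_ge0.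
  move=> ts Ot; rewrite lt_neqAle sqr_ge0 andbT eq_sym sqrf_eq0; apply/eqP => gt0.
  have := hr t; rewrite -ball_normE /= distrC => /(_ ts).
  by rewrite gt0 subr0; exact: half.
have d4 : (d < 4)%N by move: d123; rewrite !inE => /or3P[] /eqP ->.
split.
  move=> n n0; split; first exact: (bandwidth_opt_gt0 d_gt0 G0 V0 n0).
  by move=> b' b'0; exact: (bandwidth_opt_min d_gt0 G0 V0 n0 b'0).
have hb := bandwidth_opt_bandwidth d_gt0 G0 V0 d4.
(* The expansion holds for every admissible bandwidth sequence and is applied a second time, to
   [b_opt] in place of [b]. *)
have [r /eqoP ro hr] := MISE_asymptotics d_gt0 xO eps_errors hA1 hA2 hA4 hb.
have [K [K0 hK]] := bandwidth_opt_rate d_gt0 G0 V0.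
exists r.
  apply/eqoP => e e0; have h := ro (e / K) (divr_gt0 e0 K0).
  near=> n.
  have n0 : (0 < n)%N by near: n; exact: nbhs_infty_gt.
  have hn : `|r n| <= e / K * `|b_opt m f sigmasq n ^+ 2 + n%:R^-1 * b_opt m f sigmasq n `^ (- (d%:R / 2))|.
    by near: n; exact: h.
  apply: le_trans hn _.
  by rewrite hK// normrM (gtr0_norm K0) mulrA divfK// gt_eqF.
near=> n.
have n0 : (0 < n)%N by near: n; exact: nbhs_infty_gt.
have hn : MISE m (x n) (eps n) (B n) (b_opt m f sigmasq n) =
  (b_opt m f sigmasq n ^+ 2 * int_g2 m
   + n%:R^-1 * b_opt m f sigmasq n `^ (- (d%:R / 2)) * int_v f sigmasq + r n)%:E by near: n; exact: hr.
rewrite hn; congr ((_ + _)%:E).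
exact: (bandwidth_opt_value d_gt0 G0 V0 n0).
Unshelve. all: by end_near.
Qed.
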